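(* Bin Packing can be solved deterministically in time $O((k!)^2\cdot k\cdot 2^k\cdot n\log(n))$, where $n$ is the number of items and $k$ is the number of small items.
   Context: Bin Packing: given a sequence $\mathcal{I}=(i_1,\dots,i_n)$ of items with sizes in $\mathbb{Q}_{\ge 0}$ and a capacity $T\in\mathbb{Q}_{\ge 0}$, find an assignment of the items to bins such that the total size in each bin is at most $T$, using the minimum number of bins. A subsequence of items is 3-incompatible if no three distinct items of it (distinct positions in the sequence) have total size at most $T$. The large items form a largest 3-incompatible subsequence of $\mathcal{I}$, the remaining items are small, and $k$ is the number of small items. *)

(* Defs.v *)
From mathcomp Require Import all_boot all_order all_algebra.
Set Implicit Arguments. Unset Strict Implicit. Unset Printing Implicit Defensive.
Import Order.TTheory GRing.Theory Num.Theory.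
Local Open Scope ring_scope.

Definition feasible_assignment (s : seq rat) (T : rat) (b : nat -> nat) : Prop :=
  forall c : nat, \sum_(j < size s | b j == c) s`_j <= T.

Definition incompatible3 (s : seq rat) (T : rat) (S : {set 'I_(size s)}) : bool :=
  [forall a in S, forall b in S, forall c in S,
     [&& a != b, a != c & b != c] ==> (T < s`_a + s`_b + s`_c)].

Definition num_large (s : seq rat) (T : rat) : nat :=
  \max_(S : {set 'I_(size s)} | incompatible3 T S) #|S|.

Definition num_small (s : seq rat) (T : rat) : nat := (size s - num_large s T)%N.

Definition addr (q : rat) : nat := `|Num.floor q|%N.

Inductive instr : Type :=
  | IConst of nat & rat
  | IAdd of nat & nat & nat
  | ISub of nat & nat & nat
  | ILoad of nat & nat
  | IStore of nat & nat
  | IJle of nat & nat & nat.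

Definition program := seq instr.

Record state := State { pc : nat; regs : nat -> rat }.

Definition upd (r : nat -> rat) (i : nat) (v : rat) : nat -> rat :=
  fun x => if x == i then v else r x.

Definition halted (P : program) (st : state) : bool := (size P <= pc st)%N.

Definition step (P : program) (st : state) : state :=
  let: State p r := st in
  match nth None (map Some P) p with
  | None => st
  | Some (IConst i q) => State p.+1 (upd r i q)
  | Some (IAdd i j l) => State p.+1 (upd r i (r j + r l))
  | Some (ISub i j l) => State p.+1 (upd r i (r j - r l))
  | Some (ILoad i j) => State p.+1 (upd r i (r (addr (r j))))
  | Some (IStore i j) => State p.+1 (upd r (addr (r i)) (r j))
  | Some (IJle i j t) => State (if r i <= r j then t else p.+1) r
  end.

Definition run (P : program) (t : nat) (st : state) : state := iter t (step P) st.

(* Input encoding: R[0] = n, R[1] = T, R[2+j] = size of item j, all other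
   registers 0; execution starts at pc = 0. *)
Definition init_state (s : seq rat) (T : rat) : state :=
  State 0 (fun x => if x == 0%N then (size s)%:R
                    else if x == 1%N then T
                    else s`_(x - 2)).

Definition solves (s : seq rat) (T : rat) (r : nat -> rat) : Prop :=
  exists (m : nat) (b : nat -> nat),
    [/\ r 0%N = m%:R,
        forall j, (j < size s)%N -> (b j < m)%N /\ r (j + 2)%N = (b j)%:R,
        feasible_assignment s T b &
        forall (m' : nat) (b' : nat -> nat),
          (forall j, (j < size s)%N -> (b' j < m')%N) ->
          feasible_assignment s T b' -> (m <= m')%N].

(* Main.v *)
Require Import Defs.
From Stdlib Require Import Classical.
From mathcomp Require Import all_boot all_order all_algebra.
From mathcomp Require Import zify lra.
Set Implicit Arguments. Unset Strict Implicit. Unset Printing Implicit Defensive.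
Import Order.TTheory GRing.Theory Num.Theory.
Local Open Scope ring_scope.

(** Sort the items by decreasing size. The large items are the first [m], with [m] maximal such
    that the three smallest of them exceed [T] together; so a bin holds at most two large items.
    With [N] bins, at most [q = min (k, N)] bins are special, that is, hold a small item, and there
    are [q ^ k] ways to place the small items into them. A placement leaves capacities
    [c_1, ..., c_q <= T] for at most two large items each. Pad the large items with items of size 0
    to a multiset of size [2 N]: we need pairs of sums at most [c_1, ..., c_q] such that the rest can
    be paired within [T]. By Hall, a multiset can be paired within [T] iff for every [x > T / 2] it
    has at most as many elements [>= x] as elements [<= T - x], iff pairing the largest element with
    the smallest one, and so on, works.

    By an exchange argument, the special bin whose second item is smallest may receive the greedy
    pair instead: the smallest possible second item, then the largest possible first one, subject
    to Hall's condition for the rest. Hence, when there is a packing, the greedy strategy succeeds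
    on the special bins taken in some order, that is, for one of the placements enumerated. A greedy
    pair is found by one linear scan, so a placement costs [O (k n)]. The number [N] runs from the
    optimum [N0] for the large items alone to at most [N0 + k]. In total this is
    [O (n log n) + (k + 1) k ^ k O (k n)], and [k ^ k <= k! ^ 2]. *)

(** * Structured register programs *)

(** The greedy choice is justified only for the special bin whose second item is smallest, and the
    program cannot tell which bin that is. It need not: serving the bins in another order amounts to
    renumbering them, and the enumeration runs over all maps from small items to bin numbers, hence
    over all numberings. Hall's condition is kept in counting form because the exchange then splits
    at a single threshold: for large [T - x] the counts come from the old rest, for small [T - x]
    from the greedy remainder, since the other special bins use no item that small. The factor
    [2 ^ k] of the bound pays for the at most [k + 1] values of the number of bins. The bound
    concerns a bare register machine whose input fills the registers from 2 on, so that no register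
    with a fixed address is free. The algorithm is therefore written in a small array language,
    compiled to memory beyond the input. Only loop iterations are counted there: the compiled code
    spends at most a constant number of instructions on each. *)

Inductive rcmd : Type :=
  | RConst of nat & rat
  | RAdd of nat & nat & nat
  | RSub of nat & nat & nat
  | RLoad of nat & nat
  | RStore of nat & nat
  | RSeq of rcmd & rcmd
  | RIf of nat & nat & rcmd & rcmd
  | RLoop of rcmd & nat & nat & rcmd.

(** Jump targets are absolute, hence the start address [p]. [IJle 0 0 q] is an unconditional jump.
    The else branch of a conditional comes first, since [IJle] jumps when its test succeeds. *)
Fixpoint code (c : rcmd) (p : nat) : program :=
  match c with
  | RConst i q => [:: IConst i q]
  | RAdd i j l => [:: IAdd i j l]
  | RSub i j l => [:: ISub i j l]
  | RLoad i j => [:: ILoad i j]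
  | RStore i j => [:: IStore i j]
  | RSeq c1 c2 => let P1 := code c1 p in P1 ++ code c2 (p + size P1)
  | RIf i j c1 c2 =>
      let P2 := code c2 p.+1 in
      let p1 := ((p.+1 + size P2).+1)%N in
      let P1 := code c1 p1 in
      IJle i j p1 :: P2 ++ IJle 0 0 (p1 + size P1) :: P1
  | RLoop c0 i j c1 =>
      let P0 := code c0 p in
      let p1 := ((p + size P0).+2)%N in
      let P1 := code c1 p1 in
      P0 ++ IJle i j p1 :: IJle 0 0 (p1 + size P1).+1 :: rcons P1 (IJle 0 0 p)
  end.

Fixpoint csize (c : rcmd) : nat :=
  match c with
  | RSeq c1 c2 => csize c1 + csize c2
  | RIf i j c1 c2 => (csize c1 + csize c2).+2
  | RLoop c0 i j c1 => (csize c0 + csize c1).+3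
  | _ => 1
  end%N.

Lemma size_code c p : size (code c p) = csize c.
Proof.
elim: c p => //= [c1 IH1 c2 IH2|i j c1 IH1 c2 IH2|c0 IH0 i j c1 IH1] p;
  rewrite ?size_cat /= ?size_cat ?size_rcons /= ?size_cat ?IH0 ?IH1 ?IH2; lia.
Qed.

(* The count [t] is the number of loop iterations; straight-line code is free. *)
Inductive rexec : rcmd -> (nat -> rat) -> nat -> (nat -> rat) -> Prop :=
  | ExConst i q r : rexec (RConst i q) r 0 (upd r i q)
  | ExAdd i j l r : rexec (RAdd i j l) r 0 (upd r i (r j + r l))
  | ExSub i j l r : rexec (RSub i j l) r 0 (upd r i (r j - r l))
  | ExLoad i j r : rexec (RLoad i j) r 0 (upd r i (r (addr (r j))))
  | ExStore i j r : rexec (RStore i j) r 0 (upd r (addr (r i)) (r j))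
  | ExSeq c1 c2 r t1 r1 t2 r2 :
      rexec c1 r t1 r1 -> rexec c2 r1 t2 r2 -> rexec (RSeq c1 c2) r (t1 + t2) r2
  | ExIfT i j c1 c2 r t r1 :
      r i <= r j -> rexec c1 r t r1 -> rexec (RIf i j c1 c2) r t r1
  | ExIfF i j c1 c2 r t r1 :
      ~~ (r i <= r j) -> rexec c2 r t r1 -> rexec (RIf i j c1 c2) r t r1
  | ExLoopF c0 i j c1 r t r1 :
      rexec c0 r t r1 -> ~~ (r1 i <= r1 j) -> rexec (RLoop c0 i j c1) r t r1
  | ExLoopT c0 i j c1 r t0 r0 t1 r1 t2 r2 :
      rexec c0 r t0 r0 -> r0 i <= r0 j -> rexec c1 r0 t1 r1 ->
      rexec (RLoop c0 i j c1) r1 t2 r2 ->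
      rexec (RLoop c0 i j c1) r (t0 + t1 + t2).+1 r2.

Lemma nth_fetch (a b : program) x :
  nth None (map Some (a ++ x :: b)) (size a) = Some x.
Proof. by rewrite map_cat nth_cat size_map ltnn subnn. Qed.

Lemma run_add P t1 t2 st : run P (t1 + t2) st = run P t2 (run P t1 st).
Proof. by rewrite /run addnC iterD. Qed.

Lemma run1 P a x b p r : P = a ++ x :: b -> p = size a ->
  run P 1 (State p r) =
  match x with
  | IConst i q => State p.+1 (upd r i q)
  | IAdd i j l => State p.+1 (upd r i (r j + r l))
  | ISub i j l => State p.+1 (upd r i (r j - r l))
  | ILoad i j => State p.+1 (upd r i (r (addr (r j))))
  | IStore i j => State p.+1 (upd r (addr (r i)) (r j))
  | IJle i j t => State (if r i <= r j then t else p.+1) r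
  end.
Proof. by move=> -> ->; rewrite /run /= nth_fetch; case: x. Qed.

(** Without iterations each instruction is passed at most once, and each loop iteration pays for at
    most one further traversal of the code, whence the factor [t.+1]. *)
Lemma rexec_run c r t r' : rexec c r t r' ->
  forall P a b p, P = a ++ code c p ++ b -> p = size a ->
  exists u, (u <= csize c * t.+1)%N /\
    run P u (State p r) = State (p + csize c) r'.
Proof.
elim=> {c r t r'}.
- by move=> i q r P a b p eP ep; exists 1%N; rewrite (run1 _ eP ep) addn1.
- by move=> i j l r P a b p eP ep; exists 1%N; rewrite (run1 _ eP ep) addn1.
- by move=> i j l r P a b p eP ep; exists 1%N; rewrite (run1 _ eP ep) addn1.
- by move=> i j r P a b p eP ep; exists 1%N; rewrite (run1 _ eP ep) addn1.
- by move=> i j r P a b p eP ep; exists 1%N; rewrite (run1 _ eP ep) addn1.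
- move=> c1 c2 r t1 r1 t2 r2 _ IH1 _ IH2 P a b p eP ep.
  rewrite /= size_code -?catA in eP.
  have [u1 [le1 E1]] := IH1 P _ _ p eP ep.
  rewrite catA in eP.
  have [|u2 [le2 E2]] := IH2 P _ _ _ eP; first by rewrite size_cat size_code ep.
  exists (u1 + u2)%N; split; first by rewrite /=; nia.
  by rewrite run_add E1 E2 /= addnA.
- move=> i j c1 c2 r t r1 le_ij _ IH P a b p eP ep.
  rewrite /= !size_code in eP; set p1 := (_.+1 + _).+1%N in eP.
  have E0 := run1 r eP ep; rewrite le_ij in E0.
  have [||u [le_u E]] := IH P (a ++ IJle i j p1 :: code c2 p.+1 ++
      [:: IJle 0 0 (p1 + csize c1)]) b p1.
  + by rewrite eP -?catA /= -?catA.
  + by rewrite /p1 size_cat /= size_cat /= size_code ep; lia.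
  exists (1 + u)%N; split; first by rewrite /=; nia.
  by rewrite run_add E0 E; congr State; rewrite /p1 /=; lia.
- move=> i j c1 c2 r t r1 nle_ij _ IH P a b p eP ep.
  rewrite /= !size_code in eP; set p1 := (_.+1 + _).+1%N in eP.
  have E0 := run1 r eP ep; rewrite (negbTE nle_ij) in E0.
  have [||u [le_u E]] := IH P (a ++ [:: IJle i j p1])
      (IJle 0 0 (p1 + csize c1) :: code c1 p1 ++ b) p.+1.
  + by rewrite eP -?catA /= -?catA.
  + by rewrite size_cat /= ep; lia.
  have E2 : run P 1 (State (p.+1 + csize c2) r1) = State (p1 + csize c1) r1.
    rewrite (@run1 P (a ++ IJle i j p1 :: code c2 p.+1)
      (IJle 0 0 (p1 + csize c1)) (code c1 p1 ++ b)) ?lexx //.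
    + by rewrite eP -?catA /= -?catA.
    + by rewrite size_cat /= size_code ep; lia.
  exists (1 + u + 1)%N; split; first by rewrite /=; nia.
  by rewrite !run_add E0 E E2; congr State; rewrite /p1 /=; lia.
- move=> c0 i j c1 r t r1 _ IH nle_ij P a b p eP ep.
  rewrite /= !size_code in eP; set p1 := (_ + _).+2%N in eP.
  have [||u [le_u E]] := IH P a ([:: IJle i j p1, IJle 0 0 (p1 + csize c1).+1 &
      rcons (code c1 p1) (IJle 0 0 p)] ++ b) p => //.
    by rewrite eP -?catA.
  have E1 : run P 1 (State (p + csize c0) r1) = State (p + csize c0).+1 r1.
    rewrite (@run1 P (a ++ code c0 p) (IJle i j p1) (IJle 0 0 (p1 + csize c1).+1 ::
      rcons (code c1 p1) (IJle 0 0 p) ++ b)) ?(negbTE nle_ij) //.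
    + by rewrite eP -?catA.
    + by rewrite size_cat /= size_code ep.
  have E2 : run P 1 (State (p + csize c0).+1 r1) = State (p1 + csize c1).+1 r1.
    rewrite (@run1 P (a ++ code c0 p ++ [:: IJle i j p1]) (IJle 0 0 (p1 + csize c1).+1)
      (rcons (code c1 p1) (IJle 0 0 p) ++ b)) ?lexx //.
    + by rewrite eP -?catA.
    + by rewrite !size_cat /= size_code ep; lia.
  exists (u + 1 + 1)%N; split; first by rewrite /=; nia.
  by rewrite !run_add E E1 E2; congr State; rewrite /p1 /=; lia.
- move=> c0 i j c1 r t0 r0 t1 r1 t2 r2 _ IH0 le_ij _ IH1 _ IH2 P a b p eP ep.
  have [u2 [le_u2 E2]] := IH2 P a b p eP ep.
  rewrite /= !size_code in eP; set p1 := (_ + _).+2%N in eP.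
  have [||u0 [le_u0 E0]] := IH0 P a ([:: IJle i j p1, IJle 0 0 (p1 + csize c1).+1 &
      rcons (code c1 p1) (IJle 0 0 p)] ++ b) p => //.
    by rewrite eP -?catA.
  have E1 : run P 1 (State (p + csize c0) r0) = State p1 r0.
    rewrite (@run1 P (a ++ code c0 p) (IJle i j p1) (IJle 0 0 (p1 + csize c1).+1 ::
      rcons (code c1 p1) (IJle 0 0 p) ++ b)) ?le_ij //.
    + by rewrite eP -?catA.
    + by rewrite size_cat /= size_code ep.
  have [||u1 [le_u1 E3]] := IH1 P (a ++ code c0 p ++
      [:: IJle i j p1; IJle 0 0 (p1 + csize c1).+1]) (IJle 0 0 p :: b) p1.
  + by rewrite eP -?catA /= -cats1 -?catA.
  + by rewrite !size_cat /= size_code /p1; lia.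
  have E4 : run P 1 (State (p1 + csize c1) r1) = State p r1.
    rewrite (@run1 P (a ++ code c0 p ++ [:: IJle i j p1, IJle 0 0 (p1 + csize c1).+1
      & code c1 p1]) (IJle 0 0 p) b) ?lexx //.
    + by rewrite eP -?catA /= -cats1 -?catA.
    + by rewrite !size_cat /= !size_code /p1; lia.
  exists (u0 + 1 + u1 + 1 + u2)%N; split; first by rewrite /= in le_u2 *; nia.
  by rewrite !run_add E0 E1 E3 E4 E2.
Qed.

(** * A typed array language and its compilation *)

Inductive nexp : Type :=
  | NC of nat
  | NA of nat & nexp
  | NPlus of nexp & nexp
  | NMinus of nexp & nexp.

Inductive qexp : Type :=
  | QC of rat
  | QA of nat & nexp
  | QPlus of qexp & qexp
  | QMinus of qexp & qexp.

Inductive bexp : Type :=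
  | NLe of nexp & nexp
  | QLe of qexp & qexp.

Inductive cmd : Type :=
  | Skip
  | NPut of nat & nexp & nexp
  | QPut of nat & nexp & qexp
  | Seq of cmd & cmd
  | If of bexp & cmd & cmd
  | While of bexp & cmd.

Record store := Store { nats : nat -> nat -> nat; rats : nat -> nat -> rat }.

Definition put (V : Type) (f : nat -> nat -> V) (a i : nat) (v : V) :=
  fun a' => if a' == a then fun i' => if i' == i then v else f a i' else f a'.

Fixpoint evn (s : store) (e : nexp) : nat :=
  match e with
  | NC c => c
  | NA a e => nats s a (evn s e)
  | NPlus e1 e2 => evn s e1 + evn s e2
  | NMinus e1 e2 => evn s e1 - evn s e2
  end%N.

Fixpoint evq (s : store) (e : qexp) : rat :=
  match e with
  | QC c => c
  | QA a e => rats s a (evn s e)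
  | QPlus e1 e2 => evq s e1 + evq s e2
  | QMinus e1 e2 => evq s e1 - evq s e2
  end.

Definition evb (s : store) (b : bexp) : bool :=
  match b with
  | NLe e1 e2 => (evn s e1 <= evn s e2)%N
  | QLe e1 e2 => evq s e1 <= evq s e2
  end.

Inductive exec : cmd -> store -> nat -> store -> Prop :=
  | ESkip s : exec Skip s 0 s
  | ENPut a e1 e2 s :
      exec (NPut a e1 e2) s 0 (Store (put (nats s) a (evn s e1) (evn s e2)) (rats s))
  | EQPut a e1 e2 s :
      exec (QPut a e1 e2) s 0 (Store (nats s) (put (rats s) a (evn s e1) (evq s e2)))
  | ESeq c1 c2 s t1 s1 t2 s2 :
      exec c1 s t1 s1 -> exec c2 s1 t2 s2 -> exec (Seq c1 c2) s (t1 + t2) s2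
  | EIf b c1 c2 s t s1 :
      exec (if evb s b then c1 else c2) s t s1 -> exec (If b c1 c2) s t s1
  | EWhileF b c s : ~~ evb s b -> exec (While b c) s 0 s
  | EWhileT b c s t1 s1 t2 s2 :
      evb s b -> exec c s t1 s1 -> exec (While b c) s1 t2 s2 ->
      exec (While b c) s (t1 + t2).+1 s2.

(* Cell [i] of the natural array [a] lives at address [B + 128 i + a], cell [i] of
   the rational array [a] at [B + 128 i + 63 + a].  Register 0 holds [B]; the
   registers from 2 up to 64 serve as an expression stack. *)
Definition locate (d s slot : nat) : rcmd :=
  RSeq (RAdd d d d) (RSeq (RAdd d d d) (RSeq (RAdd d d d) (RSeq (RAdd d d d)
  (RSeq (RAdd d d d) (RSeq (RAdd d d d) (RSeq (RAdd d d d) (RSeq (RAdd d d 0)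
  (RSeq (RConst s slot%:R) (RAdd d d s))))))))).

(** [d] is the top of the expression stack: the value is left in register [d], and a second operand
    is computed above it in [d.+1]. The conditional for [NMinus] truncates the subtraction at 0, as
    on naturals. *)
Fixpoint cn (e : nexp) (d : nat) : rcmd :=
  match e with
  | NC c => RConst d c%:R
  | NA a e => RSeq (cn e d) (RSeq (locate d d.+1 a) (RLoad d d))
  | NPlus e1 e2 => RSeq (cn e1 d) (RSeq (cn e2 d.+1) (RAdd d d d.+1))
  | NMinus e1 e2 => RSeq (cn e1 d) (RSeq (cn e2 d.+1)
                     (RIf d d.+1 (RConst d 0) (RSub d d d.+1)))
  end.

Fixpoint cq (e : qexp) (d : nat) : rcmd :=
  match e with
  | QC c => RConst d c
  | QA a e => RSeq (cn e d) (RSeq (locate d d.+1 (63 + a)) (RLoad d d))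
  | QPlus e1 e2 => RSeq (cq e1 d) (RSeq (cq e2 d.+1) (RAdd d d d.+1))
  | QMinus e1 e2 => RSeq (cq e1 d) (RSeq (cq e2 d.+1) (RSub d d d.+1))
  end.

Definition cb (b : bexp) : rcmd :=
  match b with
  | NLe e1 e2 => RSeq (cn e1 2) (cn e2 3)
  | QLe e1 e2 => RSeq (cq e1 2) (cq e2 3)
  end.

Fixpoint cc (c : cmd) : rcmd :=
  match c with
  | Skip => RConst 2 0
  | NPut a e1 e2 =>
      RSeq (cn e1 2) (RSeq (cn e2 3) (RSeq (locate 2 4 a) (RStore 2 3)))
  | QPut a e1 e2 =>
      RSeq (cn e1 2) (RSeq (cq e2 3) (RSeq (locate 2 4 (63 + a)) (RStore 2 3)))
  | Seq c1 c2 => RSeq (cc c1) (cc c2)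
  | If b c1 c2 => RSeq (cb b) (RIf 2 3 (cc c1) (cc c2))
  | While b c => RLoop (cb b) 2 3 (cc c)
  end.

(** Static safety: array numbers stay within the block of 128 addresses of one index, and the stack
    stays below register 64, so that even the scratch register [d.+1] of [locate] lies below the
    memory, which starts at [B > 64]. *)
Fixpoint okn (e : nexp) (d : nat) : bool :=
  match e with
  | NC c => d < 64
  | NA a e => [&& a < 63, d < 64 & okn e d]
  | NPlus e1 e2 | NMinus e1 e2 => okn e1 d && okn e2 d.+1
  end%N.

Fixpoint okq (e : qexp) (d : nat) : bool :=
  match e with
  | QC c => d < 64
  | QA a e => [&& a < 65, d < 64 & okn e d]
  | QPlus e1 e2 | QMinus e1 e2 => okq e1 d && okq e2 d.+1
  end%N.

Lemma okn_lt e d : okn e d -> (d < 64)%N.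
Proof.
by elim: e d => //= [a e _ d /and3P[]|e IH ? _ d /andP[/IH]|e IH ? _ d /andP[/IH]].
Qed.

Lemma okq_lt e d : okq e d -> (d < 64)%N.
Proof.
by elim: e d => //= [a e d /and3P[]|e IH ? _ d /andP[/IH]|e IH ? _ d /andP[/IH]].
Qed.

Definition okb (b : bexp) : bool :=
  match b with
  | NLe e1 e2 => okn e1 2 && okn e2 3
  | QLe e1 e2 => okq e1 2 && okq e2 3
  end%N.

Fixpoint okc (c : cmd) : bool :=
  match c with
  | Skip => true
  | NPut a e1 e2 => [&& a < 63, okn e1 2 & okn e2 3]
  | QPut a e1 e2 => [&& a < 65, okn e1 2 & okq e2 3]
  | Seq c1 c2 => okc c1 && okc c2
  | If b c1 c2 => [&& okb b, okc c1 & okc c2]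
  | While b c => okb b && okc c
  end%N.

Definition represents (B : nat) (s : store) (r : nat -> rat) : Prop :=
  [/\ r 0%N = B%:R,
      forall a i, (a < 63)%N -> r (B + 128 * i + a)%N = (nats s a i)%:R &
      forall a i, (a < 65)%N -> r (B + 128 * i + (63 + a))%N = rats s a i].

Lemma addr_nat x : addr x%:R = x.
Proof. by rewrite /addr -[x%:R]/((x%:Z)%:~R) intrKfloor. Qed.

(** What an evaluation at stack level [d] must leave alone: the base address and the pending
    operands below [d], and the memory from [B] on. *)
Definition agree (B d : nat) (r r' : nat -> rat) : Prop :=
  forall x, (x < d)%N || (B <= x)%N -> r' x = r x.

Lemma represents_agree B d s r r' :
  (0 < d)%N -> represents B s r -> agree B d r r' -> represents B s r'.
Proof.
move=> d0 [r0 rN rQ] ag; split; first by rewrite ag // d0.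
- by move=> a i lt_a; rewrite ag ?rN //; lia.
- by move=> a i lt_a; rewrite ag ?rQ //; lia.
Qed.

Lemma locate_exec B r d s slot i : (64 < B)%N -> (1 < d < 64)%N -> (d < s < 65)%N ->
  r 0%N = B%:R -> r d = i%:R ->
  exists r', [/\ rexec (locate d s slot) r 0 r',
    r' d = (B + 128 * i + slot)%:R,
    forall x, (d < x < s)%N -> r' x = r x & agree B d r r'].
Proof.
move=> B64 d1 ds r0 rd; eexists; split.
- do 8! [apply: (ExSeq (t1 := 0) (t2 := 0)); first exact: ExAdd].
  by apply: (ExSeq (t1 := 0) (t2 := 0)); [exact: ExConst | exact: ExAdd].
- rewrite /upd !eqxx.
  have -> : (d == s) = false by lia.
  have -> : (0 == d)%N = false by lia.
  by rewrite r0 rd; lra.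
- move=> x xds; rewrite /upd !ifF //; lia.
- move=> x xB; rewrite /upd !ifF //; lia.
Qed.

Section Compile.
Variable B : nat.
Hypothesis B64 : (64 < B)%N.

Lemma cn_exec e d s r : (1 < d)%N -> okn e d -> represents B s r ->
  exists r', [/\ rexec (cn e d) r 0 r', r' d = (evn s e)%:R & agree B d r r'].
Proof.
elim: e d r => /= [c|a e IH|e1 IH1 e2 IH2|e1 IH1 e2 IH2] d r d1.
- move=> d64 _; eexists; split; first exact: ExConst.
    by rewrite /upd eqxx.
  by move=> x xB; rewrite /upd ifF //; lia.
- case/and3P=> a63 d64 ok rep.
  have [r1 [E1 v1 ag1]] := IH d r d1 ok rep.
  have rep1 := represents_agree (ltnW d1) rep ag1.
  have [r10 r1N r1Q] := rep1.
  have [|||r2 [E2 v2 _ ag2]] := @locate_exec B r1 d d.+1 a _ B64 _ _ _ v1 => //; try lia.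
  have rep2 := represents_agree (ltnW d1) rep1 ag2.
  have [_ r2N _] := rep2.
  eexists; split.
  + apply: (ExSeq (t1 := 0) E1 (t2 := 0)); apply: (ExSeq (t1 := 0) E2 (t2 := 0)).
    exact: ExLoad.
  + by rewrite /upd eqxx v2 addr_nat r2N.
  + move=> x xB; rewrite /upd ifF ?ag2 ?ag1 //; lia.
- case/andP=> ok1 ok2 rep.
  have [r1 [E1 v1 ag1]] := IH1 d r d1 ok1 rep.
  have rep1 := represents_agree (ltnW d1) rep ag1.
  have [r2 [E2 v2 ag2]] := IH2 d.+1 r1 (ltnW d1) ok2 rep1.
  have d64 := okn_lt ok1.
  eexists; split.
  + apply: (ExSeq (t1 := 0) E1 (t2 := 0)); apply: (ExSeq (t1 := 0) E2 (t2 := 0)).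
    exact: ExAdd.
  + by rewrite /upd eqxx v2 ag2 ?ltnSn // v1 natrD.
  + move=> x xB; rewrite /upd ifF ?ag2 ?ag1 //; lia.
- case/andP=> ok1 ok2 rep.
  have [r1 [E1 v1 ag1]] := IH1 d r d1 ok1 rep.
  have rep1 := represents_agree (ltnW d1) rep ag1.
  have [r2 [E2 v2 ag2]] := IH2 d.+1 r1 (ltnW d1) ok2 rep1.
  have d64 := okn_lt ok1.
  have v2' : r2 d = (evn s e1)%:R by rewrite ag2 ?ltnSn.
  case: (leqP (evn s e1) (evn s e2)) => le12; eexists; split.
  + apply: (ExSeq (t1 := 0) E1 (t2 := 0)); apply: (ExSeq (t1 := 0) E2 (t2 := 0)).
    by apply: ExIfT; [rewrite v2 v2' ler_nat | exact: ExConst].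
  + by rewrite /upd eqxx; move/eqP: le12 => ->.
  + move=> x xB; rewrite /upd ifF ?ag2 ?ag1 //; lia.
  + apply: (ExSeq (t1 := 0) E1 (t2 := 0)); apply: (ExSeq (t1 := 0) E2 (t2 := 0)).
    by apply: ExIfF; [rewrite v2 v2' ler_nat -ltnNge | exact: ExSub].
  + by rewrite /upd eqxx v2 v2' natrB // ltnW.
  + move=> x xB; rewrite /upd ifF ?ag2 ?ag1 //; lia.
Qed.

Lemma cq_exec e d s r : (1 < d)%N -> okq e d -> represents B s r ->
  exists r', [/\ rexec (cq e d) r 0 r', r' d = evq s e & agree B d r r'].
Proof.
elim: e d r => /= [c|a e|e1 IH1 e2 IH2|e1 IH1 e2 IH2] d r d1.
- move=> d64 _; eexists; split; first exact: ExConst.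
    by rewrite /upd eqxx.
  by move=> x xB; rewrite /upd ifF //; lia.
- case/and3P=> a63 d64 ok rep.
  have [r1 [E1 v1 ag1]] := cn_exec d1 ok rep.
  have rep1 := represents_agree (ltnW d1) rep ag1.
  have [r10 r1N r1Q] := rep1.
  have [|||r2 [E2 v2 _ ag2]] := @locate_exec B r1 d d.+1 (63 + a) _ B64 _ _ _ v1 => //; try lia.
  have rep2 := represents_agree (ltnW d1) rep1 ag2.
  have [_ _ r2Q] := rep2.
  eexists; split.
  + apply: (ExSeq (t1 := 0) E1 (t2 := 0)); apply: (ExSeq (t1 := 0) E2 (t2 := 0)).
    exact: ExLoad.
  + by rewrite /upd eqxx v2 addr_nat r2Q.
  + move=> x xB; rewrite /upd ifF ?ag2 ?ag1 //; lia.
- case/andP=> ok1 ok2 rep.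
  have [r1 [E1 v1 ag1]] := IH1 d r d1 ok1 rep.
  have rep1 := represents_agree (ltnW d1) rep ag1.
  have [r2 [E2 v2 ag2]] := IH2 d.+1 r1 (ltnW d1) ok2 rep1.
  have d64 := okq_lt ok1.
  eexists; split.
  + apply: (ExSeq (t1 := 0) E1 (t2 := 0)); apply: (ExSeq (t1 := 0) E2 (t2 := 0)).
    exact: ExAdd.
  + by rewrite /upd eqxx v2 ag2 ?ltnSn // v1.
  + move=> x xB; rewrite /upd ifF ?ag2 ?ag1 //; lia.
- case/andP=> ok1 ok2 rep.
  have [r1 [E1 v1 ag1]] := IH1 d r d1 ok1 rep.
  have rep1 := represents_agree (ltnW d1) rep ag1.
  have [r2 [E2 v2 ag2]] := IH2 d.+1 r1 (ltnW d1) ok2 rep1.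
  have d64 := okq_lt ok1.
  eexists; split.
  + apply: (ExSeq (t1 := 0) E1 (t2 := 0)); apply: (ExSeq (t1 := 0) E2 (t2 := 0)).
    exact: ExSub.
  + by rewrite /upd eqxx v2 ag2 ?ltnSn // v1.
  + move=> x xB; rewrite /upd ifF ?ag2 ?ag1 //; lia.
Qed.

Lemma cb_exec b s r : okb b -> represents B s r ->
  exists r', [/\ rexec (cb b) r 0 r', (r' 2%N <= r' 3%N) = evb s b & represents B s r'].
Proof.
case: b => e1 e2 /= /andP[ok1 ok2] rep.
- have [r1 [E1 v1 ag1]] := @cn_exec e1 2 s r isT ok1 rep.
  have rep1 := @represents_agree B 2 _ _ _ isT rep ag1.
  have [r2 [E2 v2 ag2]] := @cn_exec e2 3 s r1 isT ok2 rep1.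
  exists r2; split; first exact: (ExSeq E1 E2).
    by rewrite v2 ag2 // v1 ler_nat.
  exact: (@represents_agree B 3 _ _ _ isT rep1 ag2).
- have [r1 [E1 v1 ag1]] := @cq_exec e1 2 s r isT ok1 rep.
  have rep1 := @represents_agree B 2 _ _ _ isT rep ag1.
  have [r2 [E2 v2 ag2]] := @cq_exec e2 3 s r1 isT ok2 rep1.
  exists r2; split; first exact: (ExSeq E1 E2).
    by rewrite v2 ag2 // v1.
  exact: (@represents_agree B 3 _ _ _ isT rep1 ag2).
Qed.

Lemma cc_exec c s t s' : exec c s t s' -> okc c -> forall r, represents B s r ->
  exists r', rexec (cc c) r t r' /\ represents B s' r'.
Proof.
elim=> {c s t s'} /=.
- move=> s _ r rep; eexists; split; first exact: ExConst.
  apply: (@represents_agree B 2 _ _ _ isT rep).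
  by move=> x xB; rewrite /upd ifF //; lia.
- move=> a e1 e2 s /and3P[lta ok1 ok2] r rep.
  have [r1 [E1 v1 ag1]] := @cn_exec e1 2 s r isT ok1 rep.
  have rep1 := @represents_agree B 2 _ _ _ isT rep ag1.
  have [r2 [E2 v2 ag2]] := @cn_exec e2 3 s r1 isT ok2 rep1.
  have rep2 := @represents_agree B 3 _ _ _ isT rep1 ag2.
  rewrite -(ag2 2%N isT) in v1; have [r20 _ _] := rep2.
  have [r3 [E3 v3 ag3' ag3]] := @locate_exec B r2 2 4 a _ B64 isT isT r20 v1.
  have [r30 r3N r3Q] := @represents_agree B 2 _ _ _ isT rep2 ag3.
  eexists; split.
  + apply: (ExSeq (t1 := 0) E1 (t2 := 0)); apply: (ExSeq (t1 := 0) E2 (t2 := 0)).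
    apply: (ExSeq (t1 := 0) E3 (t2 := 0)); exact: ExStore.
  + rewrite v3 addr_nat ag3' // v2; split=> /=.
    * by rewrite /upd ifF //; lia.
    * move=> a' i lta'; rewrite /upd /put; case: (a' =P a) => [->|ne]; last first.
        by rewrite ifF ?r3N //; lia.
      case: (i =P _) => [->|ne]; first by rewrite eqxx.
      by rewrite ifF ?r3N //; lia.
    * by move=> a' i lta'; rewrite /upd ifF ?r3Q //; lia.
- move=> a e1 e2 s /and3P[lta ok1 ok2] r rep.
  have [r1 [E1 v1 ag1]] := @cn_exec e1 2 s r isT ok1 rep.
  have rep1 := @represents_agree B 2 _ _ _ isT rep ag1.
  have [r2 [E2 v2 ag2]] := @cq_exec e2 3 s r1 isT ok2 rep1.
  have rep2 := @represents_agree B 3 _ _ _ isT rep1 ag2.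
  rewrite -(ag2 2%N isT) in v1; have [r20 _ _] := rep2.
  have [r3 [E3 v3 ag3' ag3]] := @locate_exec B r2 2 4 (63 + a) _ B64 isT isT r20 v1.
  have [r30 r3N r3Q] := @represents_agree B 2 _ _ _ isT rep2 ag3.
  eexists; split.
  + apply: (ExSeq (t1 := 0) E1 (t2 := 0)); apply: (ExSeq (t1 := 0) E2 (t2 := 0)).
    apply: (ExSeq (t1 := 0) E3 (t2 := 0)); exact: ExStore.
  + rewrite v3 addr_nat ag3' // v2; split=> /=.
    * by rewrite /upd ifF //; lia.
    * by move=> a' i lta'; rewrite /upd ifF ?r3N //; lia.
    * move=> a' i lta'; rewrite /upd /put; case: (a' =P a) => [->|ne]; last first.
        by rewrite ifF ?r3Q //; lia.
      case: (i =P _) => [->|ne]; first by rewrite eqxx.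
      by rewrite ifF ?r3Q //; lia.
- move=> c1 c2 s t1 s1 t2 s2 _ IH1 _ IH2 /andP[ok1 ok2] r rep.
  have [r1 [E1 rep1]] := IH1 ok1 r rep.
  have [r2 [E2 rep2]] := IH2 ok2 r1 rep1.
  by exists r2; split=> //; apply: ExSeq E1 E2.
- move=> b c1 c2 s t s1 _ IH /and3P[okb ok1 ok2] r rep.
  have [r0 [E0 v0 rep0]] := cb_exec okb rep.
  case: (evb s b) v0 IH => v0 IH.
  + have [r1 [E1 rep1]] := IH ok1 r0 rep0; exists r1; split=> //.
    by apply: (ExSeq (t1 := 0) E0); apply: ExIfT.
  + have [r1 [E1 rep1]] := IH ok2 r0 rep0; exists r1; split=> //.
    by apply: (ExSeq (t1 := 0) E0); apply: ExIfF; rewrite ?v0.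
- move=> b c s nb /andP[okb ok] r rep.
  have [r0 [E0 v0 rep0]] := cb_exec okb rep.
  by exists r0; split=> //; apply: ExLoopF; rewrite ?v0.
- move=> b c s t1 s1 t2 s2 evs _ IH1 _ IH2 /andP[okb ok] r rep.
  have [r0 [E0 v0 rep0]] := cb_exec okb rep.
  have [r1 [E1 rep1]] := IH1 ok r0 rep0.
  have [|r2 [E2 rep2]] := IH2 _ r1 rep1; first by rewrite okb.
  exists r2; split=> //; rewrite -[t1]/(0 + t1)%N.
  by apply: ExLoopT E0 _ E1 E2; rewrite v0.
Qed.

End Compile.

(** * Verification conditions *)

Fixpoint modn_ (c : cmd) : seq nat :=
  match c with
  | NPut a _ _ => [:: a]
  | Seq c1 c2 | If _ c1 c2 => modn_ c1 ++ modn_ c2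
  | While _ c => modn_ c
  | _ => [::]
  end.

Fixpoint modq (c : cmd) : seq nat :=
  match c with
  | QPut a _ _ => [:: a]
  | Seq c1 c2 | If _ c1 c2 => modq c1 ++ modq c2
  | While _ c => modq c
  | _ => [::]
  end.

Definition frame (c : cmd) (s s' : store) : Prop :=
  (forall a, a \notin modn_ c -> nats s' a = nats s a) /\
  (forall a, a \notin modq c -> rats s' a = rats s a).

Lemma exec_frame c s t s' : exec c s t s' -> frame c s s'.
Proof.
elim=> {c s t s'} //=.
- by move=> a e1 e2 s; split=> //= a'; rewrite inE /put => /negbTE ->.
- by move=> a e1 e2 s; split=> //= a'; rewrite inE /put => /negbTE ->.
- move=> c1 c2 s t1 s1 t2 s2 _ [n1 q1] _ [n2 q2].
  by split=> a /=; rewrite mem_cat negb_or => /andP[? ?];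
    rewrite ?n2 ?n1 ?q2 ?q1.
- move=> b c1 c2 s t s1 _ [n1 q1].
  split=> a /=; rewrite mem_cat negb_or => /andP[? ?].
    by apply: n1; case: ifP.
  by apply: q1; case: ifP.
- move=> b c s t1 s1 t2 s2 _ _ [n1 q1] _ [n2 q2].
  by split=> a /= ha; rewrite ?n2 ?n1 ?q2 ?q1.
Qed.

Definition wp (c : cmd) (s : store) (R : nat -> store -> Prop) : Prop :=
  exists t s', exec c s t s' /\ R t s'.

(** Besides weakening, this hands [frame c s s'] to the consumer. Specifications thus state only
    what a command changes; the rest follows from the syntactic list of assigned arrays. *)
Lemma wp_mono c s (R R' : nat -> store -> Prop) :
  wp c s R -> (forall t s', frame c s s' -> R t s' -> R' t s') -> wp c s R'.
Proof.
by move=> [t [s' [E r]]] h; exists t, s'; split=> //; apply: h (exec_frame E) r.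
Qed.

Lemma wp_skip s (R : nat -> store -> Prop) : R 0%N s -> wp Skip s R.
Proof. by move=> r; exists 0%N, s; split=> //; constructor. Qed.

Lemma wp_nput a e1 e2 s (R : nat -> store -> Prop) :
  R 0%N (Store (put (nats s) a (evn s e1) (evn s e2)) (rats s)) -> wp (NPut a e1 e2) s R.
Proof. by move=> r; eexists; eexists; split; last exact: r; constructor. Qed.

Lemma wp_qput a e1 e2 s (R : nat -> store -> Prop) :
  R 0%N (Store (nats s) (put (rats s) a (evn s e1) (evq s e2))) -> wp (QPut a e1 e2) s R.
Proof. by move=> r; eexists; eexists; split; last exact: r; constructor. Qed.

Lemma wp_seq c1 c2 s (R : nat -> store -> Prop) :
  wp c1 s (fun t1 s1 => wp c2 s1 (fun t2 s2 => R (t1 + t2)%N s2)) ->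
  wp (Seq c1 c2) s R.
Proof.
move=> [t1 [s1 [E1 [t2 [s2 [E2 r]]]]]].
by exists (t1 + t2)%N, s2; split=> //; apply: ESeq E1 E2.
Qed.

Lemma wp_if b c1 c2 s (R : nat -> store -> Prop) :
  (evb s b -> wp c1 s R) -> (~~ evb s b -> wp c2 s R) -> wp (If b c1 c2) s R.
Proof.
move=> h1 h2; case E: (evb s b).
  have [t [s' [E1 r]]] := h1 E; exists t, s'; split=> //.
  by apply: EIf; rewrite E.
have [t [s' [E1 r]]] := h2 (negbT E); exists t, s'; split=> //.
by apply: EIf; rewrite E.
Qed.

(* [F] is a potential paying for the remaining iterations. *)
Lemma wp_while (I : store -> Prop) (F : store -> nat) b c s (R : nat -> store -> Prop) :
  I s ->
  (forall s1, frame c s s1 -> I s1 -> evb s1 b ->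
     wp c s1 (fun t s2 => I s2 /\ (t + F s2 < F s1)%N)) ->
  (forall t s1, frame c s s1 -> I s1 -> ~~ evb s1 b -> (t + F s1 <= F s)%N -> R t s1) ->
  wp (While b c) s R.
Proof.
move=> Is body post.
suff: forall m s1, (F s1 <= m)%N -> frame c s s1 -> I s1 ->
    wp (While b c) s1 (fun t s2 => [/\ frame c s s2, I s2, ~~ evb s2 b &
      (t + F s2 <= F s1)%N]).
  move=> /(_ (F s) s (leqnn _)) [//|//|t [s' [E [f i n le]]]].
  by exists t, s'; split=> //; apply: post.
elim=> [|m IH] s1 le_m fr I1.
  case E: (evb s1 b).
    by have [t [s2 [_ [_]]]] := body s1 fr I1 E; lia.
  by exists 0%N, s1; split; [apply: EWhileF; rewrite E | rewrite E].
case E: (evb s1 b); last first.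
  by exists 0%N, s1; split; [apply: EWhileF; rewrite E | rewrite E].
have [t1 [s2 [E1 [I2 lt]]]] := body s1 fr I1 E.
have fr2 : frame c s s2.
  have [n1 q1] := fr; have [n2 q2] := exec_frame E1.
  by split=> a ha; rewrite ?n2 ?n1 ?q2 ?q1.
have [|t2 [s3 [E2 [f3 I3 n3 le3]]]] := IH s2 _ fr2 I2; first lia.
exists (t1 + t2).+1, s3; split; first exact: EWhileT E E1 E2.
split=> //; lia.
Qed.

(** * Moving the input out of the way and the output back *)

Definition rwp (c : rcmd) (r : nat -> rat) (R : nat -> (nat -> rat) -> Prop) : Prop :=
  exists t r', rexec c r t r' /\ R t r'.

Lemma rwp_const i q r (R : nat -> (nat -> rat) -> Prop) :
  R 0%N (upd r i q) -> rwp (RConst i q) r R.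
Proof. by move=> h; eexists; eexists; split; last exact: h; constructor. Qed.

Lemma rwp_add i j l r (R : nat -> (nat -> rat) -> Prop) :
  R 0%N (upd r i (r j + r l)) -> rwp (RAdd i j l) r R.
Proof. by move=> h; eexists; eexists; split; last exact: h; constructor. Qed.

Lemma rwp_sub i j l r (R : nat -> (nat -> rat) -> Prop) :
  R 0%N (upd r i (r j - r l)) -> rwp (RSub i j l) r R.
Proof. by move=> h; eexists; eexists; split; last exact: h; constructor. Qed.

Lemma rwp_load i j x v r (R : nat -> (nat -> rat) -> Prop) :
  r j = x%:R -> r x = v -> R 0%N (upd r i v) -> rwp (RLoad i j) r R.
Proof.
move=> rj <- h; exists 0%N, (upd r i (r x)); split=> //.
by rewrite -[x in r x]addr_nat -rj; constructor.
Qed.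

Lemma rwp_store i j x v r (R : nat -> (nat -> rat) -> Prop) :
  r i = x%:R -> r j = v -> R 0%N (upd r x v) -> rwp (RStore i j) r R.
Proof.
move=> ri <- h; exists 0%N, (upd r x (r j)); split=> //.
by rewrite -[x in upd r x]addr_nat -ri; constructor.
Qed.

Lemma rwp_seq c1 c2 r (R : nat -> (nat -> rat) -> Prop) :
  rwp c1 r (fun t1 r1 => rwp c2 r1 (fun t2 r2 => R (t1 + t2)%N r2)) ->
  rwp (RSeq c1 c2) r R.
Proof.
move=> [t1 [r1 [E1 [t2 [r2 [E2 h]]]]]].
by exists (t1 + t2)%N, r2; split=> //; apply: ExSeq E1 E2.
Qed.

Lemma rwp_mono c r (R R' : nat -> (nat -> rat) -> Prop) :
  rwp c r R -> (forall t r', R t r' -> R' t r') -> rwp c r R'.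
Proof. by move=> [t [r' [E h]]] hR; exists t, r'; split=> //; apply: hR. Qed.

(* The register [z] only gives the loop test an (empty) preamble. *)
Lemma rwp_loop (I : nat -> (nat -> rat) -> Prop) z q i j c r n
    (R : nat -> (nat -> rat) -> Prop) :
  I n r ->
  (forall m r1, (m <= n)%N -> I m r1 -> upd r1 z q i <= upd r1 z q j -> exists2 m', (m = m'.+1)%N
      & rwp c (upd r1 z q) (fun t r2 => t = 0%N /\ I m' r2)) ->
  (forall t m r1, (m <= n)%N -> (t <= n)%N -> I m r1 -> upd r1 z q j < upd r1 z q i ->
     R t (upd r1 z q)) ->
  rwp (RLoop (RConst z q) i j c) r R.
Proof.
move=> In body post.
suff: forall k m r1, (m <= k)%N -> (m <= n)%N -> I m r1 ->
    rwp (RLoop (RConst z q) i j c) r1 (fun t r3 => exists m' r2, [/\ (t <= m)%N,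
      (m' <= m)%N, I m' r2, upd r2 z q j < upd r2 z q i & r3 = upd r2 z q]).
  move=> /(_ n n r (leqnn _) (leqnn _) In) [t [r' [E [m [r2 [le_t le_m I2 nle eqr]]]]]].
  by exists t, r'; split=> //; rewrite eqr; apply: post I2 nle.
elim=> [|k IH] m r1 le_mk le_mn I1; case E: (upd r1 z q i <= upd r1 z q j).
- by have [m' em _] := body m r1 le_mn I1 E; lia.
- exists 0%N, (upd r1 z q); split; last by exists m, r1; rewrite ltNge E.
  by apply: ExLoopF; [exact: ExConst | rewrite E].
- have [m' em [t1 [r2 [E1 [t0 I2]]]]] := body m r1 le_mn I1 E.
  have [||t2 [r3 [E2 [m2 [r4 [h1 h2 h3 h4 h5]]]]]] := IH m' r2 _ _ I2; try lia.
  exists (0 + t1 + t2).+1, r3; split.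
    by apply: (ExLoopT (t0 := 0) (ExConst _ _ _)) E1 E2.
  by exists m2, r4; split=> //; lia.
- exists 0%N, (upd r1 z q); split; last by exists m, r1; rewrite ltNge E.
  by apply: ExLoopF; [exact: ExConst | rewrite E].
Qed.

Lemma updE r i v x : upd r i v x = if x == i then v else r x.
Proof. by []. Qed.

Definition rseq (cs : seq rcmd) (c : rcmd) : rcmd := foldr RSeq c cs.

Definition start (s : seq rat) (T : rat) : store :=
  Store (put (fun _ _ => 0%N) 0 0 (size s))
      (put (fun a i => if a == 1%N then s`_i else 0) 0 0 T).

(** Register 0 itself becomes the pointer: seven doublings turn [n] into [128 n = B + 63], the cell
    of [T] for [B = 128 n - 63]. The items in registers 2 to 7 are moved one by one to make room for
    loops, which leaves the pointer at [B + 64 + 5 * 128 = B + 704]. Then [n] is recovered by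
    counting how often 128 goes into [B + 63], and the items from register 8 on follow, starting at
    [B + 64 + 6 * 128 = B + 832]. *)
Definition relocate : rcmd :=
  rseq [:: RAdd 0 0 0; RAdd 0 0 0; RAdd 0 0 0; RAdd 0 0 0; RAdd 0 0 0; RAdd 0 0 0;
    RAdd 0 0 0; RStore 0 1; RConst 1 1; RAdd 0 0 1; RConst 1 128;
    RStore 0 2; RAdd 0 0 1; RStore 0 3; RAdd 0 0 1; RStore 0 4; RAdd 0 0 1;
    RStore 0 5; RAdd 0 0 1; RStore 0 6; RAdd 0 0 1; RStore 0 7]
    (rseq [:: RConst 1 704; RSub 0 0 1; RConst 2 63; RAdd 3 0 2;
    RConst 4 0; RConst 5 1;
    RLoop (RConst 2 128) 2 3 (RSeq (RSub 3 3 2) (RAdd 4 4 5));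
    RStore 0 4; RConst 1 832; RAdd 1 1 0; RConst 3 8; RAdd 4 4 5]
    (RLoop (RConst 2 128) 3 4
      (rseq [:: RLoad 6 3; RStore 1 6; RAdd 1 1 2] (RAdd 3 3 5)))).

Lemma rwp_addn i j l a b r (R : nat -> (nat -> rat) -> Prop) :
  r j = a%:R -> r l = b%:R -> R 0%N (upd r i (a + b)%:R) -> rwp (RAdd i j l) r R.
Proof. by move=> rj rl h; apply: rwp_add; rewrite rj rl -natrD. Qed.

Lemma rwp_subn i j l a b r (R : nat -> (nat -> rat) -> Prop) :
  r j = a%:R -> r l = b%:R -> (b <= a)%N -> R 0%N (upd r i (a - b)%:R) ->
  rwp (RSub i j l) r R.
Proof. by move=> rj rl le h; apply: rwp_sub; rewrite rj rl -natrB. Qed.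

Ltac clear_rat := repeat match goal with
  | H : @eq ?U _ _ |- _ => lazymatch U with nat => fail | bool => fail | _ => clear H end
  end.
Ltac rnat := apply/eqP; rewrite eqr_nat; apply/eqP; clear_rat; lia.
Ltac rread := rewrite ?updE /=;
  repeat match goal with
  | |- context [if ?b then _ else _] =>
      first [ (have ->: b = true by clear_rat; rewrite ?eqxx)
            | (have ->: b = false by clear_rat; lia)
            | (have ->: b = true by clear_rat; lia)]
  end.

Ltac rauto := rread; lazymatch goal with |- (_ *+ _ = _ *+ _) => rnat | |- _ => first [assumption | done] end.

Lemma relocate_exec (s : seq rat) (T : rat) r :
  (0 < size s)%N -> r =1 regs (init_state s T) ->
  rwp relocate r (fun t r' => (t <= 2 * size s)%N /\
    represents (128 * size s - 63) (start s T) r').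
Proof.
move=> n0 r_init; set n := size s in n0 *.
have r0 : r 0%N = n%:R by rewrite r_init.
have r1 : r 1%N = T by rewrite r_init.
have rx x : (1 < x)%N -> r x = s`_(x - 2).
  by rewrite r_init /=; case: x => [|[|x]].
(* Registers beyond the input hold 0, the default of [nth]: for [n < 6] the six unconditional stores
   write zeros, which agrees with the start store. *)
have sx i : (n <= i)%N -> s`_i = 0 by move=> h; rewrite nth_default.
set B := (128 * n - 63)%N.
rewrite /relocate /rseq /foldr.
do 7! [apply: rwp_seq; apply: rwp_add; rewrite ?updE /=].
match goal with |- rwp _ ?r _ => set ra := r end.
have ra0 : ra 0%N = (128 * n)%:R by rewrite /ra updE /= r0 natrM; lra.
have rax x : x != 0%N -> ra x = r x by move=> h; rewrite /ra !updE (negbTE h).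
move: ra ra0 rax => ra ra0 rax; clear r_init.
apply: rwp_seq; apply: (rwp_store ra0 (rax 1%N isT)); rewrite r1.
apply: rwp_seq; apply: rwp_const.

apply: rwp_seq; apply: (rwp_addn (a := 128 * n) (b := 1)); [rauto|rauto|].
have eB : (B + 63 = 128 * n)%N by rewrite /B; lia.
have -> : (128 * n + 1 = B + 64)%N by rewrite /B; lia.
move: B eB => B eB.
apply: rwp_seq; apply: rwp_const.
apply: rwp_seq; apply: (rwp_store (x := B + 64) (v := s`_0)); [by rread|rread; rewrite rax // rx //|].
apply: rwp_seq; apply: (rwp_addn (a := B + 64) (b := 128)); [rauto|rauto|].
apply: rwp_seq; apply: (rwp_store (x := B + 64 + 128) (v := s`_1)); [by rread|rread; rewrite rax // rx //|].
apply: rwp_seq; apply: (rwp_addn (a := B + 64 + 128) (b := 128)); [rauto|rauto|].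
apply: rwp_seq; apply: (rwp_store (x := B + 64 + 128 + 128) (v := s`_2)); [by rread|rread; rewrite rax // rx //|].
apply: rwp_seq; apply: (rwp_addn (a := B + 64 + 128 + 128) (b := 128)); [rauto|rauto|].
apply: rwp_seq; apply: (rwp_store (x := B + 64 + 128 + 128 + 128) (v := s`_3)); [by rread|rread; rewrite rax // rx //|].
apply: rwp_seq; apply: (rwp_addn (a := B + 64 + 128 + 128 + 128) (b := 128)); [rauto|rauto|].
apply: rwp_seq; apply: (rwp_store (x := B + 64 + 128 + 128 + 128 + 128) (v := s`_4)); [by rread|rread; rewrite rax // rx //|].
apply: rwp_seq; apply: (rwp_addn (a := B + 64 + 128 + 128 + 128 + 128) (b := 128)); [rauto|rauto|].
apply: rwp_seq; apply: (rwp_store (x := B + 64 + 128 + 128 + 128 + 128 + 128) (v := s`_5)); [by rread|rread; rewrite rax // rx //|].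
match goal with |- rwp _ ?r _ => set rb := r end.
have rb0 : rb 0%N = (B + 704)%:R by rewrite /rb; rread; rnat.
have rbT : rb (B + 63)%N = T.
  by rewrite /rb; rread.
have rbS x : (x == B + 63)%N = false -> (B <= x)%N -> rb x =
    if ((x - B) %% 128 == 64)%N && ((x - B) %/ 128 < 6)%N then s`_((x - B) %/ 128) else 0.
  move=> xT xB; case: ifP => hx.
    have /orP[/orP[/orP[/orP[/orP[]|]|]|]|] : (x == B + 64)%N || (x == B + 64 + 128)%N ||
      (x == B + 64 + 128 + 128)%N || (x == B + 64 + 128 + 128 + 128)%N ||
      (x == B + 64 + 128 + 128 + 128 + 128)%N ||
      (x == B + 64 + 128 + 128 + 128 + 128 + 128)%N by lia.
    1-6: clear hx; move=> /eqP ex; rewrite /rb ex; rread; congr nth; lia.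
  rewrite /rb; rread; rewrite rax ?rx ?sx //; lia.
have rbx x : (7 < x <= n.+1)%N -> rb x = s`_(x - 2).
  by move=> hx; rewrite /rb; rread; rewrite rax ?rx //; lia.
move: rb rb0 rbT rbS rbx => rb rb0 rbT rbS rbx; clear ra ra0 rax rx r0 r1 r.
apply: rwp_seq; apply: rwp_const.
apply: rwp_seq; apply: (rwp_subn (a := B + 704) (b := 704)); [rauto|rauto|lia|].
rewrite addnK.
apply: rwp_seq; apply: rwp_const.
apply: rwp_seq; apply: (rwp_addn (a := B) (b := 63)); [rauto|rauto|].
apply: rwp_seq; apply: rwp_const.
apply: rwp_seq; apply: rwp_const.
apply: rwp_seq.
(* Division by repeated subtraction: [128 * m] is left in register 3, and the quotient so far is in
   register 4. *)
pose I m (r : nat -> rat) := (m <= n)%N /\ [/\ r 0%N = B%:R, r 3%N = (128 * m)%:R,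
  r 4%N = (n - m)%:R & r 5%N = 1 /\ forall x, (7 < x)%N -> r x = rb x].
apply: (rwp_loop (I := I) (n := n)).
- split; [exact: leqnn | split; last split].
  + by rread.
  + rread; rnat.
  + by rread; rewrite subnn.
  + by rread.
  + by move=> x hx; rread.
- move=> m r le_mn [_ [e0 e3 e4 [e5 ex]]]; rread; rewrite e3 ler_nat => le_m.
  exists m.-1; first lia.
  apply: rwp_seq; apply: (rwp_subn (a := 128 * m) (b := 128)); [rauto|rauto|lia|].
  apply: (rwp_addn (a := n - m) (b := 1)); [rauto|rauto|].
  split; [by [] | split; [lia | split; last split]].
  + rread. exact e0.
  + rread; rnat.
  + rread; rnat.
  + rread. exact e5.
  + move=> x hx. rread. exact (ex x hx).
- move=> t m r _ le_t [le_mn [e0 e3 e4 [e5 ex]]] nle.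
  have m0 : m = 0%N by move: nle; rread; rewrite e3 ltr_nat; clear_rat; lia.
  rewrite m0 subn0 in e4; clear e3.
  apply: rwp_seq; apply: (rwp_store (x := B) (v := n%:R)); [rauto|rauto|].
  apply: rwp_seq; apply: rwp_const.
  apply: rwp_seq; apply: (rwp_addn (a := 832) (b := B)); [rauto|rauto|].
  apply: rwp_seq; apply: rwp_const.
  apply: rwp_seq; apply: (rwp_addn (a := n) (b := 1)); [rauto|rauto|].
  pose J p (r : nat -> rat) := exists j, (p = n - j /\ 6 <= j)%N /\
    [/\ r 0%N = B%:R, r 1%N = (B + 64 + 128 * j)%:R, r 3%N = (j + 2)%:R &
      [/\ r 4%N = (n + 1)%:R, r 5%N = 1, forall x, (7 < x <= n.+1)%N -> r x = s`_(x - 2) &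
      forall x, (B <= x)%N -> r x = if x == (B + 63)%N then T else if x == B then n%:R else
      if ((x - B) %% 128 == 64)%N && ((x - B) %/ 128 < j)%N then s`_((x - B) %/ 128) else 0]].
  apply: (rwp_loop (I := J) (n := n - 6)).
  + exists 6%N; split; first lia; split; last split.
    * rread. exact e0.
    * rread; rnat.
    * rread; rnat.
    * by rread.
    * rread. exact e5.
    * by move=> x hx; rread; rewrite ex ?rbx //; lia.
    * move=> x hx; rread; case: (x =P B + 63)%N => [->|/eqP/negbTE nT].
        by rewrite ifF ?ex ?rbT //; lia.
      case: (x =P B) => [//|/eqP nB].
      by rewrite ex ?rbS //; lia.
  + move=> p r' le_p [j [[ep j6] [f0 f1 f3 [f4 f5 f6 f7]]]].
    rread; rewrite f3 f4 ler_nat => le_j.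
    exists (n - j.+1)%N; first lia.
    apply: rwp_seq; apply: (rwp_load (x := j + 2) (v := s`_j)); first by rread.
      rread; rewrite f6 ?addnK //; lia.
    apply: rwp_seq; apply: (rwp_store (x := B + 64 + 128 * j) (v := s`_j)); [rauto|rauto|].
    apply: rwp_seq; apply: (rwp_addn (a := B + 64 + 128 * j) (b := 128)); [rauto|rauto|].
    apply: (rwp_addn (a := j + 2) (b := 1)); [rauto|rauto|].
    split; [by []|]; exists j.+1; split; first lia; split; last split.
    * rread. exact f0.
    * rread; rnat.
    * rread; rnat.
    * rread. exact f4.
    * rread. exact f5.
    * by move=> x hx; rread; rewrite f6.
    * move=> x hx; rread; case: (x =P B + 64 + 128 * j)%N => [->|nx].
        by rread; congr nth; lia.
      rewrite f7 //; case: ifP => // _; case: ifP => // _.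
      case: ifP => h1; case: ifP => h2 //; lia.
  + move=> t2 p r' le_p le_t2 [j [[ep j6] [f0 f1 f3 [f4 f5 f6 f7]]]] nle2.
    have lt_j : (n + 1 < j + 2)%N by move: nle2; rread; rewrite f3 f4 ltr_nat.
    split; first lia.
    split; first by rread.
    * move=> a i a63; rread; rewrite f7; last lia.
      rewrite /start /= /put; case: (a =P 0%N) => [->|na].
        case: (i =P 0%N) => [->|ni]; first by rread.
        by rread.
      rread; by case: (a =P 0%N).
    * move=> a i a65; rread; rewrite f7; last lia.
      rewrite /start /= /put; case: (a =P 0%N) => [->|na].
        case: (i =P 0%N) => [->|ni]; first by rread.
        by rread; case: (i =P 0%N).
      rread; case: (a =P 0%N) => // _; case: (a =P 1%N) => [->|na1]; last by rread.
      case: ifP => h; first by congr nth; lia.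
      rewrite sx //; lia.
Qed.

(** Results are written from register [n + 1] downwards: as [B + 63 = 128 n], the address
    [B + B + 63 + out - 128] is that of cell [n - 1] of array [out]. The loop stops at register 8
    because it works in the registers below; cells 0 to 5 are then loaded directly into registers 2
    to 7, and register 0, the pointer until then, receives its result last. *)
Definition deliver (res out : nat) : rcmd :=
  rseq [:: RLoad 2 0; RConst 1 (63 + out)%:R; RAdd 3 0 0; RAdd 3 3 1; RConst 1 128;
    RSub 3 3 1; RConst 5 1; RAdd 2 2 5; RConst 6 8;
    RLoop (RConst 1 128) 6 2 (rseq [:: RLoad 7 3; RStore 2 7; RSub 3 3 1] (RSub 2 2 5));
    RConst 1 out%:R; RAdd 0 0 1; RConst 1 128; RLoad 2 0; RAdd 0 0 1; RLoad 3 0;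
    RAdd 0 0 1; RLoad 4 0]
    (rseq [:: RAdd 0 0 1; RLoad 5 0; RAdd 0 0 1; RLoad 6 0; RAdd 0 0 1;
    RLoad 7 0; RConst 1 (out + 640 - res)%:R; RSub 0 0 1] (RLoad 0 0)).

Lemma deliver_exec res out n s r : (0 < n)%N -> (res < 63)%N -> (out < 63)%N ->
  nats s 0%N 0%N = n -> represents (128 * n - 63) s r ->
  rwp (deliver res out) r (fun t r' => [/\ (t <= n)%N, r' 0%N = (nats s res 0%N)%:R &
    forall j, (j < n)%N -> r' (j + 2)%N = (nats s out j)%:R]).
Proof.
move=> n0 res63 out63 sn [r0 rN _].
have eB : (128 * n - 63 + 63 = 128 * n)%N by lia.
move: (128 * n - 63)%N eB r0 rN => B eB r0 rN.
have rB : r B = n%:R by rewrite -sn -rN // muln0 !addn0.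
have rout j : r (B + 128 * j + out)%N = (nats s out j)%:R by rewrite rN.
have rres : r (B + res)%N = (nats s res 0%N)%:R by rewrite -rN // muln0 addn0.
rewrite /deliver /rseq /foldr.
apply: rwp_seq; apply: (rwp_load (x := B) (v := n%:R)) => //.
apply: rwp_seq; apply: rwp_const.
apply: rwp_seq; apply: (rwp_addn (a := B) (b := B)); [rauto|rauto|].
apply: rwp_seq; apply: (rwp_addn (a := B + B) (b := 63 + out)); [rauto|rauto|].
apply: rwp_seq; apply: rwp_const.
apply: rwp_seq; apply: (rwp_subn (a := B + B + (63 + out)) (b := 128)); [rauto|rauto|lia|].
apply: rwp_seq; apply: rwp_const.
apply: rwp_seq; apply: (rwp_addn (a := n) (b := 1)); [rauto|rauto|].
apply: rwp_seq; apply: rwp_const.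
apply: rwp_seq.
pose I m (r' : nat -> rat) := exists x, (m = x - 7 /\ 0 < x <= n + 1)%N /\
  [/\ r' 0%N = B%:R, r' 2%N = x%:R,
      (7 < x)%N -> r' 3%N = (B + 128 * (x - 2) + out)%:R, r' 5%N = 1 &
  [/\ r' 6%N = 8%:R, forall y, (7 < y)%N -> (x < y <= n + 1)%N -> r' y = (nats s out (y - 2)%N)%:R &
      forall y, (B <= y)%N -> r' y = r y]].
apply: (rwp_loop (I := I) (n := n + 1 - 7)).
- exists (n + 1)%N; split; first lia; split; last split.
  + by rread.
  + by rread.
  + move=> n7; rread; rnat.
  + by rread.
  + by rread.
  + by move=> y y7 hy; lia.
  + by move=> y hy; rread.
- move=> m r' le_m [x [[em hx] [e0 e2 e3 e5 [e6 ex eB']]]].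
  rread; rewrite e6 e2 ler_nat => x7; have {}e3 := e3 x7.
  exists (x.-1 - 7)%N; first lia.
  apply: rwp_seq; apply: (rwp_load (x := B + 128 * (x - 2) + out) (v := (nats s out (x - 2)%N)%:R)).
  + by rread.
  + by rread; rewrite eB' ?rout //; lia.
  apply: rwp_seq; apply: (rwp_store (x := x) (v := (nats s out (x - 2)%N)%:R)).
  + by rread.
  + by rread.
  apply: rwp_seq; apply: (rwp_subn (a := B + 128 * (x - 2) + out) (b := 128)).
  + by rread.
  + rread; rnat.
  + lia.
  apply: (rwp_subn (a := x) (b := 1)).
  + by rread.
  + by rread.
  + lia.
  split; first by [].
  exists (x.-1); split; first lia; split; last split.
  + by rread.
  + rread; rnat.
  + move=> n7; rread; rnat.
  + by rread.
  + by rread.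
  + move=> y y7 hy; rread; case: (y =P x) => [->//|ne].
    by rewrite ex //; lia.
  + by move=> y hy; rread; apply: eB'.
move=> t m r' le_m le_t [x [[em hx] [e0 e2 _ e5 [e6 ex eB']]]] nle.
have x7 : (x < 8)%N by move: nle; rread; rewrite e6 e2 ltr_nat.
have {}ex y : (7 < y <= n + 1)%N -> r' y = (nats s out (y - 2)%N)%:R.
  by move=> hy; apply: ex; lia.
apply: rwp_seq; apply: rwp_const.
apply: rwp_seq; apply: (rwp_addn (a := B) (b := out)); [rauto|rauto|].
apply: rwp_seq; apply: rwp_const.
have {}rout j : r' (B + 128 * j + out)%N = (nats s out j)%:R by rewrite eB' ?rout //; lia.
have {}rres : r' (B + res)%N = (nats s res 0%N)%:R by rewrite eB' ?rres //; lia.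
apply: rwp_seq; apply: (rwp_load (x := B + 128 * 0 + out) (v := (nats s out 0%N)%:R)).
- rread; rnat.
- by rread; rewrite rout.
apply: rwp_seq; apply: (rwp_addn (a := B + out) (b := 128)); [rauto|rauto|].
apply: rwp_seq; apply: (rwp_load (x := B + 128 * 1 + out) (v := (nats s out 1%N)%:R)).
- rread; rnat.
- by rread; rewrite rout.
apply: rwp_seq; apply: (rwp_addn (a := B + out + 128) (b := 128)); [rauto|rauto|].
apply: rwp_seq; apply: (rwp_load (x := B + 128 * 2 + out) (v := (nats s out 2%N)%:R)).
- rread; rnat.
- by rread; rewrite rout.
apply: rwp_seq; apply: (rwp_addn (a := B + out + 128 + 128) (b := 128)); [rauto|rauto|].
apply: rwp_seq; apply: (rwp_load (x := B + 128 * 3 + out) (v := (nats s out 3%N)%:R)).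
- rread; rnat.
- by rread; rewrite rout.
apply: rwp_seq; apply: (rwp_addn (a := B + out + 128 + 128 + 128) (b := 128)); [rauto|rauto|].
apply: rwp_seq; apply: (rwp_load (x := B + 128 * 4 + out) (v := (nats s out 4%N)%:R)).
- rread; rnat.
- by rread; rewrite rout.
apply: rwp_seq; apply: (rwp_addn (a := B + out + 128 + 128 + 128 + 128) (b := 128)); [rauto|rauto|].
apply: rwp_seq; apply: (rwp_load (x := B + 128 * 5 + out) (v := (nats s out 5%N)%:R)).
- rread; rnat.
- by rread; rewrite rout.
apply: rwp_seq; apply: rwp_const.
apply: rwp_seq; apply: (rwp_subn (a := B + out + 640) (b := out + 640 - res)).
- rread; rnat.
- rauto.
- lia.
apply: (rwp_load (x := B + res) (v := (nats s res 0%N)%:R)).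
- rread; rnat.
- by rread; rewrite rres.
split; first lia.
- by rread.
- move=> j jn; case: (ltnP 5 j) => j5; first by rread; rewrite ex ?addnK //; lia.
  have : j \in iota 0 6 by rewrite mem_iota; lia.
  by rewrite !inE; do 5! [case/orP => [/eqP->|]; first by rread]; move/eqP->; rread.
Qed.

(** The test for an empty input must not overwrite a register that may hold an item, so no constant
    0 is at hand: [T + 2 n] is compared with [T + n] instead of [n] with 0. If [n] is positive, two
    subtractions restore [n] and [T]. *)
Definition whole (c : cmd) (res out : nat) : rcmd :=
  rseq [:: RAdd 1 1 0; RAdd 0 0 1]
    (RIf 0 1 (RSub 0 0 1)
      (rseq [:: RSub 0 0 1; RSub 1 1 0; relocate; cc c] (deliver res out))).

(** Array 0 must not be assigned because its cell 0 holds the input length, which [deliver] reads.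
    The term [3 * size s] pays for the loops of [relocate] and [deliver]. *)
Theorem cmd_program (c : cmd) (res out : nat) :
  okc c -> (0 \notin modn_ c) -> (res < 63)%N -> (out < 63)%N ->
  exists (P : program) (K : nat), forall (s : seq rat) (T : rat),
    (size s = 0%N -> exists t, [/\ (t <= K)%N, halted P (run P t (init_state s T)) &
      regs (run P t (init_state s T)) 0%N = 0]) /\
    ((0 < size s)%N -> forall t m, exec c (start s T) t m -> exists u,
      [/\ (u <= K * (t + 3 * size s).+1)%N, halted P (run P u (init_state s T)),
        regs (run P u (init_state s T)) 0%N = (nats m res 0%N)%:R &
        forall j, (j < size s)%N ->
          regs (run P u (init_state s T)) (j + 2)%N = (nats m out j)%:R]).
Proof.
move=> ok nmod res63 out63; pose w := whole c res out.
exists (code w 0), (csize w) => s T.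
have go t r' : rexec w (regs (init_state s T)) t r' -> exists u,
    [/\ (u <= csize w * t.+1)%N, halted (code w 0) (run (code w 0) u (init_state s T)) &
        regs (run (code w 0) u (init_state s T)) = r'].
  move=> /rexec_run/(_ (code w 0) [::] [::] 0%N); rewrite cats0 => /(_ erefl erefl).
  move=> [u [le_u E]]; exists u.
  have {}E : run (code w 0) u (init_state s T) = State (0 + csize w) r' by exact: E.
  by rewrite E /halted size_code /= add0n; split.
set r := regs _ in go.
have r0 : r 0%N = (size s)%:R by [].
have r1 : r 1%N = T by [].
split=> [s0|sp].
  have [t [r' [E [e0 et]]]] : rwp w r (fun t r' => r' 0%N = 0 /\ t = 0%N).
    do 2! [apply: rwp_seq; apply: rwp_add].
    set r2 := upd _ _ _; exists 0%N, (upd r2 0 (r2 0%N - r2 1%N)); split.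
      apply: ExIfT; last exact: ExSub.
      by rewrite /r2 !updE /= ?updE /= r0 r1 s0 add0r.
    by rewrite /r2 !updE /= ?updE /= r0 r1 s0; split=> //; rewrite addr0 addrN || rewrite add0r subrr.
  by have [u [le_u hu eu]] := go t r' E; exists u; split=> //; [rewrite et muln1 in le_u | rewrite eu].
move=> t m E.
have [t1 [r' [E1 [le_t1 e0 ex]]]] : rwp w r (fun t' r' => [/\ (t' <= t + 3 * size s)%N,
    r' 0%N = (nats m res 0%N)%:R &
    forall j, (j < size s)%N -> r' (j + 2)%N = (nats m out j)%:R]).
  do 2! [apply: rwp_seq; apply: rwp_add].
  set r2 := upd _ 0 _.
  have e20 : r2 0%N = (size s)%:R + (T + (size s)%:R).
    by rewrite /r2 !updE /= ?updE /= r0 r1.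
  have e21 : r2 1%N = T + (size s)%:R by rewrite /r2 !updE /= r0 r1.
  have e2x x : (1 < x)%N -> r2 x = r x.
    by move=> hx; rewrite /r2 !updE !ifF //; lia.
  move: r2 e20 e21 e2x => r2 e20 e21 e2x.
  suff [t' [r' [E' h]]] : rwp (rseq [:: RSub 0 0 1; RSub 1 1 0; relocate; cc c] (deliver res out)) r2
     (fun t' r' => [/\ (0 + (0 + t') <= t + 3 * size s)%N, r' 0%N = (nats m res 0%N)%:R &
      forall j, (j < size s)%N -> r' (j + 2)%N = (nats m out j)%:R]).
    exists t', r'; split=> //; apply: ExIfF => //.
    by rewrite e20 e21 -ltNge ltrDr ltr0n.
  rewrite /rseq /foldr.
  do 2! [apply: rwp_seq; apply: rwp_sub].
  apply: rwp_seq; apply: rwp_mono (relocate_exec (s := s) (T := T) sp _) _.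
    move=> x; rewrite !updE /= ?updE /= e20 e21.
    case: (x =P 1%N) => [->|n1]; first by rewrite /=; lra.
    case: (x =P 0%N) => [_|n0]; first lra.
    rewrite e2x; last lia.
    by rewrite /r /=; case: eqP n0 => // _; case: eqP n1.
  move=> t1 r3 [le_t1 rep3].
  have B64 : (64 < 128 * size s - 63)%N by lia.
  have [r4 [E4 rep4]] := cc_exec B64 E ok rep3.
  have eqn : nats m 0%N 0%N = size s by have [-> //] := exec_frame E.
  apply: rwp_seq; exists t, r4; split=> //.
  apply: rwp_mono (deliver_exec sp res63 out63 eqn rep4) _ => t4 r5 [le_t4 e50 e5x].
  by split=> //; lia.
have [u [le_u hu eu]] := go t1 r' E1; exists u; split=> //.
- by apply: leq_trans le_u _; rewrite leq_mul2l ltnS le_t1 orbT.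
- by rewrite eu.
- by move=> j hj; rewrite eu ex.
Qed.

(** * Pairing large items, with and without special bins *)

Definition cge (x : rat) (M : seq rat) : nat := count (fun y : rat => x <= y) M.
Definition cle (x : rat) (M : seq rat) : nat := count (fun y : rat => y <= x) M.

Lemma cge_cons x a M : cge x (a :: M) = ((x <= a)%R + cge x M)%N. Proof. by []. Qed.
Lemma cle_cons x a M : cle x (a :: M) = ((a <= x)%R + cle x M)%N. Proof. by []. Qed.
Lemma cge_cat x M M' : cge x (M ++ M') = (cge x M + cge x M')%N.
Proof. exact: count_cat. Qed.
Lemma cle_cat x M M' : cle x (M ++ M') = (cle x M + cle x M')%N.
Proof. exact: count_cat. Qed.
Lemma cge_perm x M M' : perm_eq M M' -> cge x M = cge x M'.
Proof. by move/permP; apply. Qed.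
Lemma cle_perm x M M' : perm_eq M M' -> cle x M = cle x M'.
Proof. by move/permP; apply. Qed.

(* Hall's condition for pairing up [M] within capacity [T]. *)
Definition fits (T : rat) (M : seq rat) : Prop :=
  forall x : rat, T < x + x -> (cge x M <= cle (T - x) M)%N.

Ltac bfalse := first [apply/negbTE; rewrite -?ltNge; lra | apply/eqP; lra
  | apply/negP => /eqP ?; lra].

Definition cand (T c : rat) (M : seq rat) (a b : rat) (M' : seq rat) : Prop :=
  [/\ perm_eq M [:: a, b & M'], b <= a, a + b <= c & fits T M'].

(** [b] is least among all candidates, but [a] is largest among all items that fit beside [b],
    whether or not Hall's condition would survive their removal. This makes the remainder unique and
    the exchange direct; that the scan meets this demand is the content of [scan_found]. *)
Definition greedy (T c : rat) (M : seq rat) (a b : rat) (M' : seq rat) : Prop :=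
  [/\ cand T c M a b M',
      forall a2 b2 M2, cand T c M a2 b2 M2 -> b <= b2 &
      forall a2, a2 \in a :: M' -> a2 + b <= c -> a2 <= a].

Definition items (ts : seq (rat * (rat * rat))) : seq rat :=
  flatten [seq [:: t.2.1; t.2.2] | t <- ts].

Definition valid (t : rat * (rat * rat)) : bool :=
  (t.2.2 <= t.2.1) && (t.2.1 + t.2.2 <= t.1).

(** An entry of [ts] is a special bin with its capacity and its two items, and [Q] is left to be
    paired within [T]. *)
Definition sol (T : rat) (cs M : seq rat) : Prop :=
  exists ts Q, [/\ perm_eq cs [seq t.1 | t <- ts], all valid ts,
    perm_eq M (items ts ++ Q) & fits T Q].

(** Success of the greedy strategy when the bins are served in the order [cs]. The last clause
    ranges over all greedy pairs, so that producing one is left to the scan. *)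
Fixpoint gsol (T : rat) (cs M : seq rat) : Prop :=
  if cs is c :: cs' then
    [/\ fits T M, exists a b M', cand T c M a b M' &
        forall a b M', greedy T c M a b M' -> gsol T cs' M']
  else fits T M.

Lemma fits_perm T M M' : perm_eq M M' -> fits T M -> fits T M'.
Proof.
by move=> p f x hx; rewrite -(cge_perm x p) -(cle_perm _ p); apply: f.
Qed.

(** For [x > T / 2] the smaller item is below [x]; and if [a] counts as large, then
    [b <= T - a <= T - x] counts as small and makes up for it. *)
Lemma fits_cons2 (T a b : rat) M : b <= a -> a + b <= T -> fits T M -> fits T [:: a, b & M].
Proof.
move=> le_ba le_T f x hx; have := f x hx; rewrite !cge_cons !cle_cons.
have -> : (x <= b) = false by bfalse.
case: (lerP x a) => [le_xa|_]; last lia.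
have -> : b <= T - x by lra.
lia.
Qed.

Lemma items_cons t ts : items (t :: ts) = [:: t.2.1, t.2.2 & items ts].
Proof. by []. Qed.

Lemma items_cat s t : items (s ++ t) = items s ++ items t.
Proof. by rewrite /items map_cat flatten_cat. Qed.

Lemma count_mid p t1 t t2 Q : count p (items (t1 ++ t :: t2) ++ Q) =
  (p t.2.1 + p t.2.2 + count p (items (t1 ++ t2) ++ Q))%N.
Proof. by rewrite !items_cat items_cons !count_cat /=; lia. Qed.

Lemma fits_items T ts Q : all valid ts -> all (fun t => t.1 <= T) ts ->
  fits T Q -> fits T (items ts ++ Q).
Proof.
elim: ts => //= t ts IH /andP[/andP[v1 v2] vs] /andP[le_T les] f.
by apply: fits_cons2 (IH vs les f); [| lra].
Qed.

(** In sorted order [Q'] is entrywise at most [Q], expressed by counts so that it combines directly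
    with [fits]. *)
Definition dominated (Q' Q : seq rat) : Prop :=
  forall y : rat, (cge y Q' <= cge y Q)%N /\ (cle y Q <= cle y Q')%N.

Lemma fits_dominated T Q Q' : dominated Q' Q -> fits T Q -> fits T Q'.
Proof.
move=> dom f x hx; have := f x hx.
by have [h _] := dom x; have [_ h'] := dom (T - x); lia.
Qed.

(** A smaller item can take the place of [x]: in a pair it fits all the more, the two items changing
    roles if necessary, and in [Q] it only eases Hall's condition. The bound [be] is carried along
    because the exchange needs the paired items to stay out of the small counts. *)
Lemma swap_down ts Q (x x' be : rat) : x \in items ts ++ Q -> x' <= x -> be <= x' ->
  all valid ts -> all (fun z => be <= z) (items ts) ->
  exists ts' Q', [/\ [seq t.1 | t <- ts'] = [seq t.1 | t <- ts], all valid ts',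
    perm_eq (x' :: items ts ++ Q) (x :: items ts' ++ Q'), dominated Q' Q &
    all (fun z => be <= z) (items ts')].
Proof.
move=> xin le_x le_be vs bes; case xQ: (x \in Q).
  exists ts, (x' :: rem x Q); have pQ := perm_to_rem xQ; split=> //.
    by apply/permP => p /=; rewrite ?count_cat (permP pQ) /=; clear; lia.
  move=> y; rewrite (cge_perm y pQ) (cle_perm y pQ) !cge_cons !cle_cons.
  rewrite !leq_add2r; split; last by case: (lerP x y) => // h; rewrite (le_trans le_x h).
  by case: (lerP y x') => // h; rewrite (le_trans h le_x).
rewrite mem_cat xQ orbF in xin.
have /flatten_mapP [t tin xt] := xin.
case/splitPr: tin vs bes {xin} => t1 t2 vs bes.
rewrite all_cat /= in vs; case/and3P: vs => v1 /andP[v3 v4] v2.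
rewrite items_cat items_cons all_cat /= in bes; case/and4P: bes => b1 b3 b4 b2.
have dd : dominated Q Q by move=> y; split.
move: xt; rewrite !inE => /orP[] /eqP ex.
- have bx : be <= x' by [].
  case: (lerP t.2.2 x') => h.
    exists (t1 ++ (t.1, (x', t.2.2)) :: t2), Q; split=> //.
    + by rewrite !map_cat /=.
    + by rewrite all_cat /= v1 v2 /valid /= h andbT /=; lra.
    + by apply/permP => p; rewrite /= !count_mid ex /=; clear; lia.
    + by rewrite items_cat items_cons all_cat /= b1 b2 b4 bx.
  exists (t1 ++ (t.1, (t.2.2, x')) :: t2), Q; split=> //.
  + by rewrite !map_cat /=.
  + by rewrite all_cat /= v1 v2 /valid /= (ltW h) andbT /=; lra.
  + by apply/permP => p; rewrite /= !count_mid ex /=; clear; lia.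
  + by rewrite items_cat items_cons all_cat /= b1 b2 b4 bx.
- exists (t1 ++ (t.1, (t.2.1, x')) :: t2), Q; split=> //.
  + by rewrite !map_cat /=.
  + by rewrite all_cat /= v1 v2 /valid /= andbT /=; lra.
  + by apply/permP => p; rewrite /= !count_mid ex /=; clear; lia.
  + by rewrite items_cat items_cons all_cat /= b1 b2 b3 le_be.
Qed.

Lemma min_tail (ts : seq (rat * (rat * rat))) : ts != [::] ->
  exists t t1 t2, ts = t1 ++ t :: t2 /\ all (fun u => t.2.2 <= u.2.2) ts.
Proof.
elim: ts => // u ts IH _; case: ts IH => [|v ts] IH.
  by exists u, [::], [::]; rewrite /= lexx.
have [t [t1 [t2 [et mn]]]] := IH isT.
case: (lerP t.2.2 u.2.2) => h.
  by exists t, (u :: t1), t2; split; [rewrite et | rewrite /= h].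
exists u, [::], (v :: ts); split=> //; rewrite /= lexx /=.
by apply: sub_all mn => z; lra.
Qed.

(* Among the special bins of a solution take the one whose smaller item is
   smallest: its pair can be replaced by the greedy one, because all the other
   special bins only use items that are at least as large, so that Hall's
   condition below that size is inherited from the greedy remainder. *)
Lemma exchange T cs M : sol T cs M -> cs != [::] -> all (fun c => c <= T) cs ->
  exists c cs', [/\ perm_eq cs (c :: cs'), exists a b M', cand T c M a b M' &
    forall a b M', greedy T c M a b M' -> sol T cs' M'].
Proof.
move=> [ts [Q [pcs vs pM fQ]]] cs0 csT.
have tsT : all (fun t => t.1 <= T) ts.
  by rewrite -[all _ ts](all_map fst (fun c => c <= T)) -(perm_all _ pcs).
have ts0 : ts != [::].
  by apply: contraNneq cs0 => ts0; move: (perm_size pcs); rewrite ts0; case: (cs).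
have [[c [a0 b0]] [t1 [t2 [ets /= mn]]]] := min_tail ts0.
set os := t1 ++ t2.
have vos : all valid os by move: vs; rewrite ets !all_cat /= => /and3P[-> _ ->].
have /andP[/= vt1 vt2] : valid (c, (a0, b0)) by move: vs; rewrite ets all_cat /= => /and3P[].
have osT : all (fun t => t.1 <= T) os.
  by move: tsT; rewrite ets !all_cat /= => /and3P[-> _ ->].
have mos : all (fun z => b0 <= z) (items os).
  apply/allP => z /flatten_mapP[u uin].
  have uts : u \in ts by move: uin; rewrite ets !mem_cat inE => /orP[->|->]; rewrite ?orbT.
  have := allP mn u uts; have /andP[h1 h2] := allP vs u uts.
  by rewrite /= !inE => h /orP[] /eqP ->; [apply: le_trans h h1 | apply: h].
have pM0 : perm_eq M [:: a0, b0 & items os ++ Q].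
  apply: perm_trans pM _; apply/permP => p.
  by rewrite ets count_mid -/os /= addnA.
have fW : fits T (items os ++ Q) by apply: fits_items.
have cand0 : cand T c M a0 b0 (items os ++ Q) by [].
exists c, [seq u.1 | u <- os]; split.
- apply: perm_trans pcs _; rewrite ets !map_cat /= perm_catC /= perm_cons.
  by rewrite perm_catC.
- by exists a0, b0, (items os ++ Q).
move=> a b M' [[pM' le_ba le_c fM'] minb maxa].
have le_b : b <= b0 := minb _ _ _ cand0.
have /permP pp : perm_eq [:: a, b & M'] [:: a0, b0 & items os ++ Q].
  by rewrite -(permPl pM').
(* The only way to lose [a0] would be [b = a0]; then [b0 = a0] too, since [b <= b0 <= a0], and a
   second copy remains. *)
have a0in : a0 \in a :: M'.
  rewrite -has_pred1 has_count; have := pp (pred1 a0).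
  rewrite /= eqxx; case: (b =P a0) => [eb|_]; last by clear; lia.
  have -> : b0 == a0 by rewrite eq_le vt1 -eb.
  by clear; lia.
(* [a0] still fits beside [b <= b0], so the maximality of [a] applies to it. *)
have le_a : a0 <= a by apply: maxa a0in _; lra.
case: (b =P b0) => [eb|/eqP nb].
- have pp1 : perm_eq (a :: M') (a0 :: items os ++ Q).
    by apply/permP => p; have := pp p; rewrite /= eb; clear; lia.
  have : a \in a0 :: items os ++ Q by rewrite -(perm_mem pp1) mem_head.
  rewrite inE => /orP[/eqP ea|ain].
    exists os, Q; split=> //; move: pp1; rewrite ea perm_cons //.
  have [ts' [Q' [e1 v1 p1 d1 _]]] := swap_down (be := b0) ain le_a vt1 vos mos.
  exists ts', Q'; split=> //; first by rewrite e1.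
    by move: (perm_trans pp1 p1); rewrite perm_cons.
  exact: fits_dominated d1 fQ.
(* Now [b] is smaller than every item of the special bins, so it comes from [Q]. Its place there is
   taken by the larger [b0], which domination does not cover. *)
have lt_b : b < b0 by rewrite lt_neqAle nb.
have bQ : b \in Q.
  rewrite -has_pred1 has_count; have := pp (pred1 b).
  have -> : count (pred1 b) [:: a0, b0 & items os ++ Q] = count (pred1 b) Q.
    rewrite /= count_cat (gt_eqF (lt_le_trans lt_b vt1)) (gt_eqF lt_b).
    rewrite (_ : count _ (items os) = 0%N) //; apply/eqP; rewrite -leqn0 leqNgt -has_count.
    by apply/hasPn => z /(allP mos) /= h; rewrite gt_eqF // (lt_le_trans lt_b h).
  by rewrite /= eqxx => <-; rewrite addnCA.
have eQ := perm_to_rem bQ; set Q1 := rem b Q in eQ.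
have pp1 : perm_eq (a :: M') (a0 :: items os ++ b0 :: Q1).
  by apply/permP => p; have := pp p; rewrite /= ?count_cat (permP eQ) /=; clear; lia.
have [ts' [Q' [e1 v1 p1 d1 m1]]] : exists ts' Q', [/\ [seq t.1 | t <- ts'] = [seq t.1 | t <- os],
    all valid ts', perm_eq M' (items ts' ++ Q'), dominated Q' (b0 :: Q1) &
    all (fun z => b0 <= z) (items ts')].
  have : a \in a0 :: items os ++ b0 :: Q1 by rewrite -(perm_mem pp1) mem_head.
  rewrite inE => /orP[/eqP ea|ain].
    by exists os, (b0 :: Q1); split=> //; move: pp1; rewrite ea perm_cons.
  have [ts' [Q' [e1 v1 p1 d1 m1]]] := swap_down (be := b0) ain le_a vt1 vos mos.
  by exists ts', Q'; split=> //; move: (perm_trans pp1 p1); rewrite perm_cons.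
exists ts', Q'; split=> //; first by rewrite e1.
(* If [b0 <= T - x], then [b] and [b0] both count as small and neither as large, so trading one for
   the other is invisible at this threshold. *)
move=> x hx; case: (lerP b0 (T - x)) => hb.
  have := fQ x hx; rewrite (cge_perm x eQ) (cle_perm _ eQ) cge_cons cle_cons.
  have [h1 _] := d1 x; have [_ h2] := d1 (T - x); move: h1 h2.
  rewrite cge_cons cle_cons hb.
  have -> : (x <= b0) = false by clear -hx hb; bfalse.
  have -> : b <= T - x by clear -hb lt_b; lra.
  by clear; lia.
(* Otherwise all items of the special bins exceed [T - x]: the small items of the greedy remainder
   all lie in [Q'], which inherits Hall's condition. *)
have := fM' x hx; rewrite (cge_perm x p1) (cle_perm _ p1) cge_cat cle_cat.
rewrite (_ : cle (T - x) (items ts') = 0%N); first by clear; lia.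
apply/eqP; rewrite -leqn0 leqNgt -has_count.
by apply/hasPn => z /(allP m1) /= h; rewrite -ltNge (lt_le_trans hb h).
Qed.

Lemma cand_perm T c M M2 a b M' : perm_eq M M2 -> cand T c M a b M' -> cand T c M2 a b M'.
Proof. by move=> pM [p1 p2 p3 p4]; split=> //; rewrite -(permPl pM). Qed.

Lemma greedy_perm T c M M2 a b M' :
  perm_eq M M2 -> greedy T c M a b M' -> greedy T c M2 a b M'.
Proof.
move=> pM [h1 h2 h3]; split=> //; first exact: cand_perm h1.
by move=> a2 b2 M3 h; apply: h2 (cand_perm _ h); rewrite perm_sym.
Qed.

Lemma greedy_uniq T c M a b M' a2 b2 M2 :
  greedy T c M a b M' -> greedy T c M a2 b2 M2 -> perm_eq M' M2.
Proof.
move=> [c1 m1 x1] [c2 m2 x2].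
have eb : b = b2 by apply/eqP; rewrite eq_le (m1 _ _ _ c2) (m2 _ _ _ c1).
have [p1 _ le1 _] := c1; have [p2 _ le2 _] := c2.
have /permP p12 : perm_eq [:: a, b & M'] [:: a2, b2 & M2] by rewrite -(permPl p1).
have p3 : perm_eq (a :: M') (a2 :: M2).
  by apply/permP => p; have := p12 p; rewrite /= eb; clear; lia.
have ea : a = a2.
  apply/eqP; rewrite eq_le x2 ?x1 //; first by rewrite (perm_mem p3) mem_head.
    by rewrite eb.
    by rewrite -(perm_mem p3) mem_head.
  by rewrite -eb.
by move: p3; rewrite ea perm_cons.
Qed.

Lemma gsol_perm T cs M M2 : perm_eq M M2 -> gsol T cs M -> gsol T cs M2.
Proof.
case: cs => [|c cs] pM /=; first exact: fits_perm.
move=> [h1 [a [b [M' h2]]] h3]; split; first exact: fits_perm h1.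
  by exists a, b, M'; apply: cand_perm h2.
by move=> a2 b2 M3 h; apply: h3 (greedy_perm _ h); rewrite perm_sym.
Qed.

Lemma gsol_fits T cs M : gsol T cs M -> fits T M.
Proof. by case: cs => [|c cs] //= [h _]. Qed.

Lemma sol_fits T cs M : all (fun c => c <= T) cs -> sol T cs M -> fits T M.
Proof.
move=> csT [ts [Q [pcs vs pM fQ]]]; rewrite perm_sym in pM.
apply: fits_perm pM _; apply: fits_items => //.
by rewrite -[all _ ts](all_map fst (fun c => c <= T)) -(perm_all _ pcs).
Qed.

(** [exchange] names the bin to serve first, and induction orders the others. Where no greedy pair
    exists, the last clause of [gsol] is vacuous, hence the classical case distinction. *)
Lemma sol_gsol T cs M : sol T cs M -> all (fun c => c <= T) cs ->
  exists2 cs', perm_eq cs cs' & gsol T cs' M.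
Proof.
have [n] := ubnP (size cs); elim: n cs M => // n IH cs M le_n sl csT.
have fM := sol_fits csT sl.
case: (eqVneq cs [::]) => [e|cs0]; first by exists cs; rewrite // e.
have [c [cs' [pcs cd ex]]] := exchange sl cs0 csT.
have cs'T : all (fun c => c <= T) cs'.
  by move: csT; rewrite (perm_all _ pcs) /= => /andP[].
have szc : (size cs' < n)%N by move: le_n; rewrite (perm_size pcs).
case: (classic (exists a b M', greedy T c M a b M')) => [[a [b [M' g]]]|ng].
  have [cs2 p2 g2] := IH cs' M' szc (ex _ _ _ g) cs'T.
  exists (c :: cs2); first by apply: perm_trans pcs _; rewrite perm_cons.
  split=> // a2 b2 M2 gr2; apply: gsol_perm g2.
  exact: greedy_uniq g gr2.
exists (c :: cs') => //; split=> // a b M' g; case: ng.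
by exists a, b, M'.
Qed.

(** * Hall's condition on sorted arrays *)

Definition desc (L : nat) (y : nat -> rat) : Prop :=
  forall i j, (i <= j)%N -> (j < L)%N -> y j <= y i.

Definition nested (T : rat) (h : nat) (y : nat -> rat) : Prop :=
  forall i, (i < h)%N -> y i + y (2 * h - 1 - i)%N <= T.

Section Counts.
Variables (L : nat) (y : nat -> rat).
Hypothesis yd : desc L y.

Lemma count_mkseq (p : pred rat) k : (k <= L)%N ->
  count p (mkseq y L) =
  (count (p \o y) (iota 0 k) + count (p \o y) (iota k (L - k)))%N.
Proof.
by move=> le_k; rewrite /mkseq count_map -{1}(subnKC le_k) iotaD count_cat.
Qed.

Lemma count_all_iota (p : pred rat) j k :
  (forall i, (j <= i < j + k)%N -> p (y i)) -> count (p \o y) (iota j k) = k.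
Proof.
move=> h; rewrite -{2}(size_iota j k); apply/eqP; rewrite -all_count.
by apply/allP => i; rewrite mem_iota => /h.
Qed.

Lemma count_none_iota (p : pred rat) j k :
  (forall i, (j <= i < j + k)%N -> ~~ p (y i)) -> count (p \o y) (iota j k) = 0%N.
Proof.
move=> h; apply/eqP; rewrite -leqn0 leqNgt -has_count -all_predC.
by apply/allP => i; rewrite mem_iota => /h.
Qed.

Lemma cle_cge (z w : rat) M : z < w -> (cle z M + cge w M <= size M)%N.
Proof.
move=> lt_zw; rewrite -(count_predC (fun u : rat => u <= z) M) leq_add2l.
apply: sub_count => u /= le_u; rewrite -ltNge; exact: lt_le_trans le_u.
Qed.

Lemma cge_gt p x : (p < L)%N -> x <= y p -> (p < cge x (mkseq y L))%N.
Proof.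
move=> ltp le_x; rewrite /cge (count_mkseq _ ltp) count_all_iota ?leq_addr //.
by move=> i /andP[_ hi]; apply: le_trans le_x _; apply: yd.
Qed.

Lemma cge_le p x : (p < L)%N -> y p < x -> (cge x (mkseq y L) <= p)%N.
Proof.
move=> ltp lt_x; rewrite /cge (count_mkseq _ (ltnW ltp)).
rewrite (count_none_iota (j := p)).
  by rewrite addn0 -{2}(size_iota 0 p) count_size.
move=> i /andP[hi hi2]; rewrite -ltNge; apply: le_lt_trans lt_x.
by apply: yd => //; lia.
Qed.

Lemma cle_ge p x : (p < L)%N -> y p <= x -> (L - p <= cle x (mkseq y L))%N.
Proof.
move=> ltp le_x; rewrite /cle (count_mkseq _ (ltnW ltp)).
rewrite (count_all_iota (j := p)) ?leq_addl //.
by move=> i /andP[hi hi2]; apply: le_trans le_x; apply: yd => //; lia.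
Qed.

Lemma cle_lt p x : (p < L)%N -> x < y p -> (cle x (mkseq y L) < L - p)%N.
Proof.
move=> ltp lt_x; rewrite /cle (count_mkseq _ ltp).
rewrite (count_none_iota (j := 0)).
  apply: leq_ltn_trans (count_size _ _) _; rewrite size_iota; lia.
move=> i /andP[hi hi2]; rewrite -ltNge; apply: lt_le_trans lt_x _.
by apply: yd => //; lia.
Qed.

Lemma cge_leL x : (cge x (mkseq y L) <= L)%N.
Proof. by rewrite -{2}(size_mkseq y L) count_size. Qed.

Lemma cge_index p x : (p < cge x (mkseq y L))%N -> (p < L)%N /\ x <= y p.
Proof.
move=> ltp; have ltL : (p < L)%N := leq_trans ltp (cge_leL x); split=> //.
by rewrite leNgt; apply/negP => /(cge_le ltL); rewrite leqNgt ltp.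
Qed.

Lemma mkseq_index v : v \in mkseq y L -> exists2 p, (p < L)%N & v = y p.
Proof. by move=> /mapP[p]; rewrite mem_iota => /andP[_ hp] ->; exists p. Qed.

End Counts.

(** Let [p + 1] entries be at least [x]. If [p < h], the partner of [y p] and the entries after it,
    again [p + 1] in number, are at most [T - x]. If [p >= h], both entries of the middle pair are
    at least [x], so that their sum exceeds [T]. *)
Lemma nested_fits T h y : desc (2 * h) y -> nested T h y -> fits T (mkseq y (2 * h)).
Proof.
move=> yd nst x hx; case E: (cge _ _) => [|p] //.
have [|ltp le_x] := cge_index yd (p := p) (x := x); first by rewrite E.
have [lt_ph|le_hp] := ltnP p h.
  have := nst p lt_ph => hn.
  have le_y : y (2 * h - 1 - p)%N <= T - x by lra.
  have := cle_ge yd (p := (2 * h - 1 - p)%N) _ le_y; clear - ltp lt_ph; lia.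
have h0 : (0 < h)%N by clear -ltp; lia.
have := nst (h - 1)%N ltac:(clear -h0; lia).
have -> : (2 * h - 1 - (h - 1) = h)%N by clear -h0; lia.
have y1 : y p <= y h by apply: yd.
have y2 : y p <= y (h - 1)%N by apply: yd => //; clear -le_hp; lia.
by move=> h3; exfalso; lra.
Qed.

(** A nested pair exceeding [T] violates Hall's condition at [x = y i]: at least [i + 1] entries
    reach [x], but at most [i] are at most [T - x]. *)
Lemma fits_nested T h y : desc (2 * h) y -> fits T (mkseq y (2 * h)) -> nested T h y.
Proof.
move=> yd f i hi; rewrite leNgt; apply/negP => hT.
have le_y : y (2 * h - 1 - i)%N <= y i by apply: yd; clear -hi; lia.
have hx : T < y i + y i by lra.
have h1 := cge_gt yd (p := i) (x := y i) ltac:(clear -hi; lia) (lexx _).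
have hlt : T - y i < y (2 * h - 1 - i)%N by lra.
have h2 := cle_lt yd (p := (2 * h - 1 - i)%N) ltac:(clear -hi; lia) hlt.
have := f _ hx; move: h1 h2; clear -hi; lia.
Qed.

(** * The linear scan for the greedy pair *)

Section Scan.
Variables (T c : rat) (h : nat) (y : nat -> rat).
Hypothesis yd : desc (2 * h) y.
Let M := mkseq y (2 * h).

(** Two pointers: [i] seeks the first item from the large end, and [t] counts the second items given
    up at the small end. The last clause makes passed items safe: when positions [i' + 1] and
    [2 h - 1 - t] are taken away, the nested pairing of the rest matches [i'] with [2 h - 2 - i'],
    one place later than without the gap before it, or, once [i'] is past the middle, with
    [2 h - 3 - i'], which precedes both. *)
Definition scan_inv (t i : nat) : Prop :=
  [/\ [/\ (t <= i)%N, (t < h)%N & (i + t + 1 <= 2 * h)%N],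
   forall t', (t' < t)%N -> forall a M', ~ cand T c M a (y (2 * h - 1 - t')%N) M',
   forall i', (i' < i)%N -> c < y i' + y (2 * h - 1 - t)%N &
   forall i', (t <= i' < i)%N ->
     y i' + y (if (i' + 2 <= h)%N then 2 * h - 2 - i' else 2 * h - 3 - i')%N <= T].

Lemma scan_start : (0 < h)%N -> scan_inv 0 0.
Proof.
move=> h0; split; [by split=> //; lia | by [] | by [] |].
by move=> i'; rewrite ltn0 andbF.
Qed.

Lemma scan_next t i : scan_inv t i -> (i + t + 2 <= 2 * h)%N ->
  c < y i + y (2 * h - 1 - t)%N ->
  y i + y (if (i + 2 <= h)%N then 2 * h - 2 - i else 2 * h - 3 - i)%N <= T ->
  scan_inv t i.+1.
Proof.
move=> [[h1 h2 h3] ha hb hc] hi hci hTi; split=> //.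
- by clear -h1 h2 hi; split; lia.
- move=> i'; rewrite ltnS leq_eqVlt => /orP[/eqP->//|]; exact: hb.
- move=> i' /andP[h4]; rewrite ltnS leq_eqVlt => /orP[/eqP->//|h5].
  by apply: hc; rewrite h4.
Qed.

Lemma cand_counts (a b x : rat) M' : cand T c M a b M' -> T < x + x ->
  (cge x M + (a <= T - x)%R + (b <= T - x)%R
   <= cle (T - x) M + (x <= a)%R + (x <= b)%R)%N.
Proof.
move=> [pM _ _ f] hx; have := f x hx.
rewrite (cge_perm x pM) (cle_perm _ pM) !cge_cons !cle_cons.
clear; lia.
Qed.

(** Neither item of such a candidate reaches [y i], so the rest keeps [i + 1] items of at least
    [y i] and needs as many of at most [T - y i]. There are at most [i + 1] of these in all. If the
    second item is among them, at most [i] remain; if not, they all lie behind it, so there are at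
    most [t' <= i]. *)
Lemma scan_blocked t i : scan_inv t i -> (i + 2 <= h)%N ->
  c < y i + y (2 * h - 1 - t)%N -> T < y i + y (2 * h - 2 - i)%N ->
  forall t', (t' < i.+1)%N -> forall a M', ~ cand T c M a (y (2 * h - 1 - t')%N) M'.
Proof.
move=> [[h1 h2 h3] ha hb hc] hi hci hTi t' lt_t' a M' cd.
have [lt_t|le_t] := ltnP t' t; first exact: ha lt_t _ _ cd.
have [_ le_b le_c _] := cd.
set b := y (2 * h - 1 - t')%N in cd le_b le_c.
have le_bt : y (2 * h - 1 - t)%N <= b by apply: yd; clear -le_t lt_t' hi; lia.
have le_y : y (2 * h - 2 - i)%N <= y i by apply: yd; clear -hi; lia.
have hx : T < y i + y i by clear -hTi le_y; lra.
have := cand_counts cd hx.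
have -> : (y i <= a) = false by clear -hci le_c le_bt; bfalse.
have -> : (y i <= b) = false by clear -hci le_c le_bt le_b; bfalse.
have h4 := cge_gt yd (p := i) (x := y i) ltac:(clear -hi; lia) (lexx _).
have hlt : T - y i < y (2 * h - 2 - i)%N by clear -hTi; lra.
have h5 := cle_lt yd (p := (2 * h - 2 - i)%N) ltac:(clear -hi; lia) hlt.
have [hbT|hbT] := lerP b (T - y i).
  by move: h4 h5; clear -hi; rewrite -/M; lia.
have h6 := cle_lt yd (p := (2 * h - 1 - t')%N) ltac:(clear -hi; lia) hbT.
by move: h4 h6; clear -hi lt_t'; rewrite -/M; lia.
Qed.

Lemma scan_skip t i : scan_inv t i -> (i + 2 <= h)%N ->
  c < y i + y (2 * h - 1 - t)%N -> T < y i + y (2 * h - 2 - i)%N ->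
  scan_inv i.+1 i.+1.
Proof.
move=> inv hi hci hTi; have bl := scan_blocked inv hi hci hTi.
have [[h1 h2 h3] ha hb hc] := inv; split=> //.
- by clear -h1 h2 hi; split; lia.
- move=> i' lt_i'; have := yd (i := (2 * h - 1 - i.+1)%N) (j := (2 * h - 1 - t)%N)
    ltac:(clear -h1 h2 hi; lia) ltac:(clear -h1 h2 hi; lia).
  suff : c < y i' + y (2 * h - 1 - t)%N by clear; lra.
  by move: lt_i'; rewrite ltnS leq_eqVlt => /orP[/eqP->//|]; apply: hb.
- by move=> i' hi'; exfalso; clear -hi'; lia.
Qed.

Lemma cand_index t i : scan_inv t i -> forall a b M', cand T c M a b M' ->
  y (2 * h - 1 - t)%N <= b.
Proof.
move=> [[h1 h2 h3] ha hb hc] a b M' cd; have [pM _ _ _] := cd.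
have [p ltp eb] : exists2 p, (p < 2 * h)%N & b = y p.
  by apply: mkseq_index; rewrite (perm_mem pM) !inE eqxx orbT.
have [le_p|lt_p] := leqP p (2 * h - 1 - t).
  by rewrite eb; apply: yd => //; clear -h2; lia.
exfalso; apply: (ha (2 * h - 1 - p)%N); first by clear -lt_p ltp; lia.
have -> : (2 * h - 1 - (2 * h - 1 - p) = p)%N by clear -lt_p ltp; lia.
by rewrite eb in cd; apply: cd.
Qed.

(** Both items of a candidate would be below [y i]. With [x = y (2 h - 3 - i)], the [2 h - 2]
    remaining items include [2 h - 2 - i] of at least [x] and [i + 1] of at least [y i > T - x]; at
    most [2 h - 3 - i] small ones are left, one too few. *)
Lemma scan_fail t i : scan_inv t i -> (i + t + 2 <= 2 * h)%N -> (h < i + 2)%N ->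
  c < y i + y (2 * h - 1 - t)%N -> T < y i + y (2 * h - 3 - i)%N ->
  forall a b M', ~ cand T c M a b M'.
Proof.
move=> inv hit hi hci hTi a b M' cd; have le_bt := cand_index inv cd.
have [[h1 h2 h3] ha hb hc] := inv.
have [pM le_b le_c f] := cd.
set x := y (2 * h - 3 - i)%N in hTi.
have le_y : y i <= x by apply: yd; clear -hi hit; lia.
have hx : T < x + x by clear -hTi le_y; lra.
have ay : a < y i by clear -hci le_c le_bt; lra.
have hlt : T - x < y i by clear -hTi; lra.
have := f x hx; have := cle_cge M' hlt; have := perm_size pM.
have := cge_gt yd (p := (2 * h - 3 - i)%N) (x := x) ltac:(clear -hit hi; lia) (lexx _).
have := cge_gt yd (p := i) (x := y i) ltac:(clear -hit; lia) (lexx _).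
rewrite -/M !(cge_perm _ pM) !cge_cons size_mkseq /=.
have -> : (x <= a) = false by clear -ay le_y; bfalse.
have -> : (x <= b) = false by clear -ay le_y le_b; bfalse.
rewrite (lt_geF ay) (lt_geF (le_lt_trans le_b ay)).
by clear -hit hi; lia.
Qed.

(** Once the pointers meet, no first item lies before [i], so a candidate consists of two copies of
    one value. One of them is among the last [t] positions, which have been ruled out. *)
Lemma scan_exhausted t i : scan_inv t i -> (2 * h < i + t + 2)%N ->
  forall a b M', ~ cand T c M a b M'.
Proof.
move=> inv hit a b M' cd; have le_bt := cand_index inv cd.
have [[h1 h2 h3] ha hb hc] := inv.
have [pM le_b le_c f] := cd.
set bt := y (2 * h - 1 - t)%N in le_bt hb.
have ei : (i = 2 * h - 1 - t)%N by clear -hit h3; lia.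
have [p ltp ea] : exists2 p, (p < 2 * h)%N & a = y p.
  by apply: mkseq_index; rewrite (perm_mem pM) mem_head.
have abt : a <= bt.
  rewrite /bt -ei ea; have [lt_p|le_p] := ltnP p i; last exact: yd.
  by have := hb p lt_p; clear -le_bt le_c ea; lra.
have eab : a = bt by apply/le_anti; rewrite abt (le_trans le_bt le_b).
have ebb : b = bt by apply/le_anti; rewrite le_bt (le_trans le_b abt).
have i0 : (0 < i)%N by clear -ei h2; lia.
(* [bt] occurs twice, but no entry before the last [t + 1] equals it *)
have lt_i : bt < y (i - 1)%N.
  have := hb (i - 1)%N ltac:(clear -i0; lia); clear -le_c eab ebb; lra.
have t0 : (0 < t)%N.
  rewrite lt0n; apply/negP => /eqP t0.
  have := cle_lt yd (p := (i - 1)%N) (x := bt) ltac:(clear -i0 h3; lia) lt_i.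
  rewrite -/M (cle_perm _ pM) !cle_cons eab ebb lexx; clear -ei t0 h2; lia.
apply: (ha (t - 1)%N _ a M'); first by clear -t0; lia.
suff <- : b = y (2 * h - 1 - (t - 1))%N by [].
have le_y : y (2 * h - 1 - (t - 1))%N <= bt by apply: yd; clear -h2 t0; lia.
apply/eqP; rewrite ebb eq_le le_y andbT leNgt; apply/negP => lt_y.
have lt2 : (2 * h - 1 - (t - 1) < 2 * h)%N by clear -h2; lia.
have := cge_le yd lt2 lt_y.
have := cge_gt yd (p := (i - 1)%N) (x := y (i - 1)%N) ltac:(clear -i0 h3; lia) (lexx _).
rewrite -/M !(cge_perm _ pM) !cge_cons eab ebb lexx [_ <= bt]leNgt lt_i.
have : (cge (y (i - 1)%N) M' <= cge bt M')%N.
  by apply: sub_count => u /=; apply: le_trans (ltW lt_i).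
clear -ei i0 t0 h2; lia.
Qed.

(** Only thresholds with [b] small and [a] not large cost slack: one unit, or two if [a] is small as
    well. The slack comes from the last clause of the invariant, taken at the last entry of at least
    [x] in the first case and at the position whose partner is that entry in the second. *)
Lemma scan_found t i M' : scan_inv t i -> fits T M -> (i + t + 2 <= 2 * h)%N ->
  y i + y (2 * h - 1 - t)%N <= c ->
  perm_eq M [:: y i, y (2 * h - 1 - t)%N & M'] ->
  greedy T c M (y i) (y (2 * h - 1 - t)%N) M'.
Proof.
move=> inv fM hit le_c pM; have [[h1 h2 h3] ha hb hc] := inv.
have le_b : y (2 * h - 1 - t)%N <= y i by apply: yd; clear -hit h2; lia.
split; [| by move=> a2 b2 M2 cd; apply: (cand_index inv cd) |]; last first.
- move=> a2 a2in le2.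
  have [p ltp ea] : exists2 p, (p < 2 * h)%N & a2 = y p.
    apply: mkseq_index; rewrite (perm_mem pM).
    by move: a2in; rewrite !inE => /orP[->//|->]; rewrite !orbT.
  rewrite ea; have [lt_p|le_p] := ltnP p i; last exact: yd.
  by have := hb p lt_p; rewrite -ea => /(le_lt_trans le2); rewrite ltxx.
split=> // x hx; have := fM x hx.
set a := y i in le_c le_b pM *; set b := y _ in le_c le_b pM *.
rewrite (cge_perm _ pM) (cle_perm _ pM) !cge_cons !cle_cons.
have gM := cge_perm x pM; have lM := cle_perm (T - x) pM.
rewrite !cge_cons in gM; rewrite !cle_cons in lM.
have szM : (cge x M + cle (T - x) M <= 2 * h)%N.
  by rewrite addnC -[leqRHS](size_mkseq y); apply: cle_cge; rewrite ltrBlDr.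
have [bT|bT] := lerP b (T - x); last first.
  have aT : (a <= T - x) = false by clear -bT le_b; bfalse.
  by rewrite aT; clear; lia.
have bx : (x <= b) = false by bfalse.
have [xa|ax] := lerP x a.
  have aT : (a <= T - x) = false by bfalse.
  by rewrite bx aT; clear; lia.
rewrite bT bx in gM lM *; rewrite leNgt ax /= in gM.
have gi : (cge x M <= i)%N by apply: cge_le => //; clear -hit; lia.
have lt1 : (t < cle (T - x) M)%N.
  have := cle_ge yd (p := (2 * h - 1 - t)%N) ltac:(clear -h2; lia) bT.
  by rewrite -/M; clear -h2; lia.
have yg p : (p < cge x M)%N -> (p < 2 * h)%N /\ x <= y p by apply: cge_index.
have [aT|aT] := lerP a (T - x).
  (* both items are small: two units of slack are needed *)
  rewrite aT in lM; move=> le_gl.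
  have li : (2 * h - i <= cle (T - x) M)%N.
    by apply: cle_ge => //; clear -hit; lia.
  suff : (cge x M + 2 <= cle (T - x) M)%N by move: gM lM; clear; lia.
  have gl : (cge x M <= cle (T - x) M)%N := fM x hx.
  have [gs|gs] := leqP (cge x M) (2 * h - 2 - i); first by move: li gs hit; clear; lia.
  (* The position [2 h - 2 - cge x M] has the last large entry [cge x M - 1] as its partner, so it
     is small, and [cge x M + 2] entries lie from there on. *)
  have [gh|gh] := ltnP (cge x M) h.
    have := hc (2 * h - 2 - cge x M)%N ltac:(move: gs gi gh h1 h2; clear -hit; lia).
    have -> : (2 * h - 2 - cge x M + 2 <= h)%N = false by move: gh; clear; lia.
    have -> : (2 * h - 3 - (2 * h - 2 - cge x M) = cge x M - 1)%N by move: gh gs hit; clear; lia.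
    have [_ xg] := yg (cge x M - 1)%N ltac:(move: gs hit; clear; lia).
    move=> hcc; have hz : y (2 * h - 2 - cge x M)%N <= T - x by lra.
    have := cle_ge yd (p := (2 * h - 2 - cge x M)%N) ltac:(move: gs gh; clear -h2; lia) hz.
    rewrite -/M; move: gh gs; clear; lia.
  (* With [h] large entries, positions [h - 1] and [h - 2] both hold at least [x], although the
     invariant bounds their sum by [T]. *)
  have eg : (cge x M = h)%N by move: gl gh szM; clear; lia.
  have [h0 xh] := yg (h - 1)%N ltac:(rewrite eg; clear -h2; lia).
  have hi : (h <= i)%N by move: gi; rewrite eg.
  have := hc (h - 1)%N ltac:(clear -hi h1 h2 hit; lia).
  have -> : (h - 1 + 2 <= h)%N = false by clear -h2; lia.
  have [_ xh2] := yg (2 * h - 3 - (h - 1))%N ltac:(rewrite eg; clear -h2 hit hi; lia).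
  by move=> hcc; exfalso; lra.
rewrite leNgt aT /= in lM; move=> le_gl.
suff : (cge x M + 1 <= cle (T - x) M)%N by move: gM lM; clear; lia.
have [gt|gt] := leqP (cge x M) t; first by move: gt lt1; clear; lia.
have [_ xg] := yg (cge x M - 1)%N ltac:(move: gt; clear; lia).
have := hc (cge x M - 1)%N ltac:(move: gt gi; clear; lia).
case: ifP => hh hcc.
  have hz : y (2 * h - 2 - (cge x M - 1))%N <= T - x by lra.
  have := cle_ge yd (p := (2 * h - 2 - (cge x M - 1))%N) ltac:(clear -h2; lia) hz.
  rewrite -/M; move: gt hh; clear; lia.
have [_ xg2] := yg (2 * h - 3 - (cge x M - 1))%N ltac:(move: gt hh; clear -h2 hit; lia).
by exfalso; lra.
Qed.
End Scan.

(** * Enumeration and counting *)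

(** The placement [F] read as a [k]-digit number in base [q], least significant digit first;
    placements are enumerated in this order. *)
Fixpoint dval (q k : nat) (F : nat -> nat) : nat :=
  if k is k'.+1 then (F 0 + q * dval q k' (fun i => F i.+1))%N else 0%N.

Lemma dval_ext q k F G : (forall i, (i < k)%N -> F i = G i) -> dval q k F = dval q k G.
Proof.
elim: k F G => //= k IH F G e; rewrite e // (IH _ (fun i => G i.+1)) // => i hi.
exact: e.
Qed.

Lemma dval_inj q k F G : (forall i, (i < k)%N -> (F i < q)%N) ->
  (forall i, (i < k)%N -> (G i < q)%N) -> dval q k F = dval q k G ->
  forall i, (i < k)%N -> F i = G i.
Proof.
elim: k F G => //= k IH F G hF hG e.
have F0 := hF 0%N isT; have G0 := hG 0%N isT.
have e0 : F 0%N = G 0%N.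
  have := congr1 (modn^~ q) e; rewrite /= ![(_ + q * _)%N]addnC ![(q * _)%N]mulnC.
  by rewrite !modnMDl !modn_small.
have e1 : dval q k (fun i => F i.+1) = dval q k (fun i => G i.+1).
  by move: e; rewrite e0 => /addnI/eqP; rewrite eqn_pmul2l ?(leq_trans _ F0) // => /eqP.
case=> [_ //|i hi]; apply: (IH (fun i => F i.+1) (fun i => G i.+1)) => // j hj.
  exact: hF.
exact: hG.
Qed.

Lemma dval_lt q k F : (forall i, (i < k)%N -> (F i < q)%N) -> (dval q k F < q ^ k)%N.
Proof.
elim: k F => //= k IH F hF; have := hF 0%N isT.
have := IH (fun i => F i.+1) (fun i hi => hF i.+1 hi).
by rewrite expnS; nia.
Qed.

Lemma dval_zero q k F : (forall i, (i < k)%N -> F i = 0%N) -> dval q k F = 0%N.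
Proof.
elim: k F => //= k IH F h; rewrite h // IH ?muln0 // => i hi; exact: h.
Qed.

Lemma dval_carry q k F G i : (i < k)%N ->
  (forall x, (x < i)%N -> F x = q.-1 /\ G x = 0%N) -> G i = (F i).+1 ->
  (forall x, (i < x < k)%N -> G x = F x) -> (0 < q)%N ->
  dval q k G = (dval q k F).+1.
Proof.
elim: k F G i => //= k IH F G [|i] hi lo e up q0.
  rewrite e (@dval_ext q k _ (fun i => F i.+1)) // => j hj; exact: up.
have [-> ->] := lo 0%N isT.
rewrite (IH (fun i => F i.+1) (fun i => G i.+1) i) //; first nia.
  by move=> x hx; apply: lo.
by move=> x hx; apply: up.
Qed.

Lemma dval_top q k F : (forall x, (x < k)%N -> F x = q.-1) -> (0 < q)%N ->
  (dval q k F).+1 = (q ^ k)%N.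
Proof.
elim: k F => //= k IH F h q0; rewrite h // expnS -(IH (fun i => F i.+1)) //; first nia.
by move=> x hx; apply: h.
Qed.

Lemma prod_rev_fact k : (\prod_(i < k) (k - i) = k`!)%N.
Proof. by rewrite (reindex_inj rev_ord_inj) /= fact_prod big_add1 /= big_mkord;
  apply: eq_bigr => i _; rewrite subKn. Qed.

(** The square is the product of [(i + 1) * (k - i)] over [i < k], and each of these factors is at
    least [k]. *)
Lemma expnn_fact k : (k ^ k <= k`! ^ 2)%N.
Proof.
rewrite -mulnn -{1}prod_rev_fact fact_prod big_add1 /= big_mkord -big_split /=.
rewrite -[X in (_ ^ X)%N](card_ord k) -prod_nat_const; apply: leq_prod => i _.
by have := ltn_ord i; nia.
Qed.

(** One factor [k.+1], from the number of bin counts tried, is absorbed by [2 ^ k]; the other, from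
    the cost of a placement, stays. *)
Lemma search_bound k n : (k.+1 * (k.+1 * k ^ k) * n <= k`! ^ 2 * k.+1 * 2 ^ k * n)%N.
Proof.
rewrite leq_mul2r; apply/orP; right.
have -> : (k`! ^ 2 * k.+1 * 2 ^ k = k`! ^ 2 * 2 ^ k * k.+1)%N by rewrite mulnAC.
rewrite mulnC [(k.+1 * k ^ k)%N]mulnC.
have := expnn_fact k; have := @ltn_expl 2 k isT.
move: (k ^ k)%N (k`! ^ 2)%N (2 ^ k)%N => X Y Z hZ hX.
by apply: leq_mul (leqnn _); apply: leq_mul.
Qed.

Lemma perm_fibers (I : eqType) (s : seq I) (g : I -> nat) N :
  all (fun x => g x < N)%N s ->
  perm_eq (flatten [seq [seq x <- s | g x == c] | c <- iota 0 N]) s.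
Proof.
move=> hs; apply/permP => p.
rewrite count_flatten -map_comp sumnE big_map.
rewrite (eq_bigr (fun c => \sum_(x <- s) (p x && (g x == c)))%N); last first.
  by move=> c _ /=; rewrite count_filter -sum1_count big_mkcond; apply: eq_bigr => x _ /=; case: (p x && _).
rewrite exchange_big /= -sum1_count [RHS]big_mkcond /=.
apply: eq_big_seq => x xs; have hx := allP hs x xs.
rewrite (bigD1_seq (g x)) ?iota_uniq ?mem_iota //= eqxx andbT.
rewrite big1 ?addn0; first by case: (p x).
by move=> c /negbTE; rewrite eq_sym => ->; rewrite andbF.
Qed.

(** * Packings and pairings *)

Lemma perm_mkseq_lt (A : nat -> nat) n i : perm_eq (mkseq A n) (iota 0 n) -> (i < n)%N -> (A i < n)%N.
Proof.
move=> pA hi; have : A i \in iota 0 n.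
  by rewrite -(perm_mem pA); apply/mapP; exists i; rewrite // mem_iota.
by rewrite mem_iota.
Qed.

Section Packing.
Variables (s : seq rat) (T : rat) (sz : nat -> rat) (A : nat -> nat) (m : nat).
Let n := size s.
Let k := (n - m)%N.
Hypothesis T0 : 0 <= T.
Hypothesis s_bound : forall j, (j < n)%N -> 0 <= s`_j <= T.
Hypothesis sz_s : forall j, (j < n)%N -> sz j = s`_j.
Hypothesis sz_n : sz n = 0.
Hypothesis A_perm : perm_eq (mkseq A n) (iota 0 n).
Hypothesis A_desc : desc n (sz \o A).
Hypothesis m_le : (m <= n)%N.
Hypothesis m_incomp : (2 < m)%N ->
  T < sz (A (m - 1)%N) + sz (A (m - 2)%N) + sz (A (m - 3)%N).

Definition large_ids (i : nat) : nat := if (i < m)%N then A i else n.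
(** The load that the first [i] small items put into bin [c]. Partial sums are needed because the
    program subtracts the items one at a time. *)
Definition group (f : nat -> nat) (c i : nat) : rat :=
  \sum_(0 <= x < i) (if f x == c then sz (A (m + x)%N) else 0).
Definition caps (f : nat -> nat) (q : nat) : seq rat :=
  mkseq (fun c => T - group f c k) q.
Let xs := sz \o large_ids.

Let A_lt i : (i < n)%N -> (A i < n)%N := perm_mkseq_lt A_perm (i:=i).

Lemma sz_bound j : (j <= n)%N -> 0 <= sz j <= T.
Proof.
rewrite leq_eqVlt => /orP[/eqP->|hj]; first by rewrite sz_n lexx.
by rewrite sz_s // s_bound.
Qed.

Lemma xs_bound i : 0 <= xs i <= T.
Proof.
rewrite /xs /= /large_ids; case: ifP => hi; last by rewrite sz_n lexx.
by apply: sz_bound; apply/ltnW/A_lt; apply: leq_trans m_le.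
Qed.

Lemma xs_desc L : desc L xs.
Proof.
move=> i j hij _; rewrite {1}/xs /= {1}/large_ids; case: ifP => hj.
  by rewrite /xs /= /large_ids (leq_ltn_trans hij hj); apply: A_desc => //; apply: leq_trans m_le.
by rewrite sz_n; case/andP: (xs_bound i).
Qed.

Lemma group_ge0 f c i : (i <= k)%N -> 0 <= group f c i.
Proof.
move=> hi; rewrite /group big_seq; apply: sumr_ge0 => x.
rewrite mem_index_iota => hx; case: ifP => // _.
by case/andP: (sz_bound (ltnW (A_lt (i := (m + x)%N) ltac:(move: hx hi; rewrite /k; lia)))).
Qed.

Lemma caps_le f q : all (fun c => c <= T) (caps f q).
Proof.
apply/allP => c /mapP[x _ ->]; rewrite gerBl; exact: group_ge0.
Qed.

Lemma load_split (b : nat -> nat) (c : nat) :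
  \sum_(j < size s | b j == c) s`_j =
  \sum_(0 <= p < m) (if b (A p) == c then sz (A p) else 0)
  + group (fun x => b (A (m + x)%N)) c k.
Proof.
rewrite big_mkcond -(big_mkord xpredT (fun j => if b j == c then s`_j else 0)).
rewrite -/n /index_iota subn0 big_seq.
rewrite (eq_bigr (fun j => if b j == c then sz j else 0)); last first.
  by move=> j; rewrite mem_iota => /andP[_ hj]; rewrite sz_s.
rewrite -big_seq -(perm_big _ A_perm) /= big_map.
rewrite -{1}(subnKC m_le) iotaD big_cat /= add0n -/k; congr (_ + _).
  by rewrite /index_iota subn0.
by rewrite /group /index_iota subn0 -[X in iota X k]addn0 iotaDl big_map.
Qed.

(** * From a packing to pairs for the special bins *)

Section Complete.
Variables (b : nat -> nat) (N : nat).
Hypothesis b_lt : forall j, (j < n)%N -> (b j < N)%N.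
Hypothesis b_ok : feasible_assignment s T b.

Let bin c := [seq p <- iota 0 m | b (A p) == c].
Let pr c : rat * rat :=
  (nth 0 [seq sz (A p) | p <- bin c] 0, nth 0 [seq sz (A p) | p <- bin c] 1).

Lemma bin_sum c : \sum_(p <- bin c) sz (A p) = \sum_(0 <= p < m) (if b (A p) == c then sz (A p) else 0).
Proof. by rewrite big_filter big_mkcond /index_iota subn0. Qed.

(** Three large items weigh at least as much as the last three in the sorted order, which exceed [T]
    by [m_incomp]. *)
Lemma bin_size c : (size (bin c) <= 2)%N.
Proof.
rewrite leqNgt; apply/negP => hs.
have := b_ok c; rewrite load_split -bin_sum.
have so : sorted ltn (bin c) by apply: sorted_filter; [exact: ltn_trans | exact: iota_ltn_sorted].
have bm p : p \in bin c -> (p < m)%N by rewrite mem_filter mem_iota => /andP[_ /andP[]].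
move: hs so bm; case: (bin c) => [|p1 [|p2 [|p3 r]]] //= _ /and3P[h12 h23 _] bm.
have h1 := bm p1 ltac:(by rewrite !inE eqxx).
have h2 := bm p2 ltac:(by rewrite !inE eqxx orbT).
have h3 := bm p3 ltac:(by rewrite !inE eqxx !orbT).
have m2 : (2 < m)%N by move: h1 h2 h3 h12 h23; clear; lia.
have := m_incomp m2.
have d1 := A_desc (i := p1) (j := (m - 3)%N) ltac:(move: h1 h2 h3 h12 h23; clear; lia)
  ltac:(move: m2 m_le; clear; lia).
have d2 := A_desc (i := p2) (j := (m - 2)%N) ltac:(move: h1 h2 h3 h12 h23; clear; lia)
  ltac:(move: m2 m_le; clear; lia).
have d3 := A_desc (i := p3) (j := (m - 1)%N) ltac:(move: h1 h2 h3 h12 h23; clear; lia)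
  ltac:(move: m2 m_le; clear; lia).
rewrite !big_cons.
have : 0 <= \sum_(j <- r) sz (A j).
  rewrite big_seq; apply: sumr_ge0 => j jr.
  have hj := bm j ltac:(by rewrite !inE jr !orbT).
  by case/andP: (sz_bound (ltnW (A_lt (leq_trans hj m_le)))).
have := group_ge0 (fun x => b (A (m + x)%N)) c (leqnn k).
move: d1 d2 d3 => /=; lra.
Qed.

Lemma pr_perm c : perm_eq ([seq sz (A p) | p <- bin c] ++ nseq (2 - size (bin c)) 0)
  [:: (pr c).1; (pr c).2].
Proof.
by rewrite /pr; move: (bin_size c); case: (bin c) => [|p1 [|p2 [|p3 r]]].
Qed.

Lemma pr_sum c : (pr c).1 + (pr c).2 =
  \sum_(0 <= p < m) (if b (A p) == c then sz (A p) else 0).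
Proof.
rewrite -bin_sum /pr; move: (bin_size c); case: (bin c) => [|p1 [|p2 [|p3 r]]] //= _.
- by rewrite big_nil addr0.
- by rewrite big_seq1 addr0.
- by rewrite big_cons big_seq1.
Qed.

Lemma pr_le c : (pr c).2 <= (pr c).1.
Proof.
have so : sorted ltn (bin c) by apply: sorted_filter; [exact: ltn_trans | exact: iota_ltn_sorted].
have bm p : p \in bin c -> (p < m)%N by rewrite mem_filter mem_iota => /andP[_ /andP[]].
rewrite /pr; move: (bin_size c) so bm; case: (bin c) => [|p1 [|p2 [|p3 r]]] //= _ so bm.
  have hj := bm p1 ltac:(by rewrite !inE).
  by case/andP: (sz_bound (ltnW (A_lt (leq_trans hj m_le)))).
have hj := bm p2 ltac:(by rewrite !inE eqxx orbT).
apply: A_desc; first by move: so; rewrite andbT => /ltnW.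
exact: leq_trans m_le.
Qed.

Lemma pr_load c : (pr c).1 + (pr c).2 <= T - group (fun x => b (A (m + x)%N)) c k.
Proof. by rewrite pr_sum lerBrDr -load_split. Qed.

Lemma fibers_large : perm_eq (flatten [seq bin c | c <- iota 0 N]) (iota 0 m).
Proof.
apply: (perm_fibers (g := fun p => b (A p))); apply/allP => p.
by rewrite mem_iota => /andP[_ hp]; apply/b_lt/A_lt; apply: leq_trans m_le.
Qed.

Lemma sum_bin_size : (\sum_(c <- iota 0 N) size (bin c))%N = m.
Proof.
by rewrite -[RHS](size_iota 0) -(perm_size fibers_large) size_flatten sumnE !big_map.
Qed.

Lemma sum_two : (\sum_(c <- iota 0 N) 2)%N = (2 * N)%N.
Proof. by rewrite big_const_seq count_predT size_iota iter_addn_0. Qed.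

Lemma complete_size : (m <= 2 * N)%N.
Proof. by rewrite -sum_bin_size -sum_two; apply: leq_sum => c _; apply: bin_size. Qed.

Lemma xs_cat : (m <= 2 * N)%N ->
  mkseq xs (2 * N) = [seq sz (A p) | p <- iota 0 m] ++ nseq (2 * N - m) 0.
Proof.
move=> le_m; rewrite /mkseq -{1}(subnKC le_m) iotaD map_cat add0n; congr (_ ++ _).
  by apply/eq_in_map => p; rewrite mem_iota add0n /xs /= /large_ids => ->.
set r := map _ _; suff /all_pred1P -> : all (pred1 (0 : rat)) r by rewrite size_map size_iota.
apply/allP => v /mapP[p]; rewrite mem_iota /xs /= /large_ids => /andP[hp _] ->.
by rewrite ltnNge hp /= sz_n.
Qed.

Lemma pairs_perm :
  perm_eq (mkseq xs (2 * N)) (flatten [seq [:: (pr c).1; (pr c).2] | c <- iota 0 N]).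
Proof.
rewrite (xs_cat complete_size); apply/permP => p.
rewrite count_flatten -map_comp sumnE big_map /=.
have -> : \sum_(c <- iota 0 N) (p (pr c).1 + (p (pr c).2 + 0))%N =
    (\sum_(c <- iota 0 N) (count p [seq sz (A x) | x <- bin c] + p 0%R * (2 - size (bin c))))%N.
  by apply: eq_bigr => c _; have := permP (pr_perm c) p; rewrite count_cat count_nseq /= => <-.
rewrite big_split /= -big_distrr /= count_cat count_nseq.
rewrite sumnB; last by move=> c _; exact: bin_size.
rewrite sum_bin_size sum_two; congr (_ + _)%N.
rewrite count_map -(permP fibers_large) count_flatten -map_comp sumnE big_map.
by apply: eq_bigr => c _; rewrite /= count_map.
Qed.

Let tsof (l : seq nat) := [seq (T - group (fun x => b (A (m + x)%N)) c k, pr c) | c <- l].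

Lemma items_tsof l : items (tsof l) = flatten [seq [:: (pr c).1; (pr c).2] | c <- l].
Proof. by rewrite /items /tsof -map_comp. Qed.

Lemma valid_tsof l : all valid (tsof l).
Proof. by apply/allP => t /mapP[c _ ->]; rewrite /valid /= pr_le pr_load. Qed.

Lemma tsof_le l : all (fun t => t.1 <= T) (tsof l).
Proof. by apply/allP => t /mapP[c _ ->] /=; rewrite gerBl group_ge0. Qed.

Lemma complete_fits : fits T (mkseq xs (2 * N)).
Proof.
have p := pairs_perm; rewrite -items_tsof perm_sym in p; apply: fits_perm p _.
by rewrite -[items _]cats0; apply: fits_items (valid_tsof _) (tsof_le _) _.
Qed.

(** The bins that hold a small item come first and are filled up to exactly [min (k, N)] bins [J]; a
    small item is placed at the position of its bin in [J]. The pairs of the other bins witness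
    Hall's condition for the rest. *)
Lemma complete_sol : exists f, (forall i, (i < k)%N -> (f i < minn k N)%N) /\
  sol T (caps f (minn k N)) (mkseq xs (2 * N)).
Proof.
pose g x := b (A (m + x)%N); set q := minn k N.
have g_lt x : (x < k)%N -> (g x < N)%N.
  by move=> hx; apply/b_lt/A_lt; move: hx; rewrite /k; lia.
pose J0 := undup [seq g i | i <- iota 0 k].
have J0_lt c : c \in J0 -> (c < N)%N.
  by rewrite mem_undup => /mapP[i]; rewrite mem_iota => /andP[_ hi] ->; apply: g_lt.
pose FJ := J0 ++ [seq c <- iota 0 N | c \notin J0].
have pFJ : perm_eq FJ (iota 0 N).
  apply: uniq_perm; last 1 first.
  - move=> c; rewrite mem_cat mem_filter mem_iota add0n leq0n /=.
    by case: (boolP (c \in J0)) => //= /J0_lt ->.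
  - rewrite cat_uniq undup_uniq filter_uniq ?iota_uniq // andbT /=.
    by apply/hasPn => c; rewrite mem_filter => /andP[].
  - exact: iota_uniq.
have uFJ : uniq FJ by rewrite (perm_uniq pFJ) iota_uniq.
have sFJ : size FJ = N by rewrite (perm_size pFJ) size_iota.
have sJ0k : (size J0 <= k)%N.
  by apply: leq_trans (size_undup _) _; rewrite size_map size_iota.
have sJ0 : (size J0 <= q)%N by rewrite leq_min sJ0k -sFJ size_cat leq_addr.
pose J := take q FJ.
have sJ : size J = q by rewrite size_takel // sFJ geq_minr.
have gJ x : (x < k)%N -> g x \in J.
  move=> hx; rewrite /J take_cat ltnNge sJ0 /= mem_cat mem_undup.
  by rewrite map_f // mem_iota.
have uJ : uniq J by rewrite take_uniq.
exists (fun x => index (g x) J); split=> [i hi|]; first by rewrite -sJ index_mem gJ.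
exists (tsof J), (items (tsof (drop q FJ))); split.
- rewrite (_ : caps _ _ = [seq t.1 | t <- tsof J]) //.
  rewrite /tsof -map_comp; apply: (@eq_from_nth _ 0).
    by rewrite size_mkseq size_map sJ.
  rewrite size_mkseq => i hi; rewrite nth_mkseq // (nth_map 0%N) ?sJ //=.
  congr (T - _); rewrite /group big_seq [RHS]big_seq; apply: eq_bigr => x.
  rewrite mem_index_iota => /andP[_ hx].
  congr (if _ then _ else _); apply/eqP/eqP => [<-|e]; first by rewrite nth_index // gJ.
  by rewrite /g e index_uniq // sJ.
- exact: valid_tsof.
- rewrite -items_cat /tsof -map_cat cat_take_drop -/(tsof FJ) items_tsof.
  apply: perm_trans pairs_perm _; apply: perm_flatten; apply: perm_map.
  by rewrite perm_sym.
- by rewrite -[items _]cats0; apply: fits_items (valid_tsof _) (tsof_le _) _.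
Qed.
End Complete.

(** One bin per small item, with two dummies of size 0, besides [N] bins for the large items. The
    search therefore ends at [N0 + k] bins at the latest. *)
Lemma singleton_sol N : (m <= 2 * N)%N -> nested T N xs ->
  exists f, (forall i, (i < k)%N -> (f i < minn k (N + k))%N) /\
  sol T (caps f (minn k (N + k))) (mkseq xs (2 * (N + k))).
Proof.
move=> le_m nst; have -> : minn k (N + k) = k by apply/minn_idPl; rewrite leq_addl.
exists id; split=> //.
exists [seq (T - group id c k, (0, 0)) | c <- iota 0 k], (mkseq xs (2 * N)); split.
- by rewrite -map_comp.
- apply/allP => t /mapP[c]; rewrite mem_iota => /andP[_ hc] ->.
  apply/andP; split; first exact: lexx.
  rewrite [leLHS]addr0 subr_ge0 /group.
  rewrite (bigD1_seq c) ?mem_index_iota ?iota_uniq //= eqxx big1 ?addr0; last first.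
    by move=> i /negbTE ->.
  case/andP: (sz_bound (ltnW (A_lt (i := (m + c)%N) ltac:(move: hc; rewrite /k; lia)))) => //.
- have le_m2 : (m <= 2 * (N + k))%N by apply: leq_trans le_m _; rewrite leq_mul2l leq_addr.
  rewrite !xs_cat //; apply/permP => p; rewrite !count_cat !count_nseq.
  rewrite /items -map_comp count_flatten -map_comp sumnE big_map /=.
  rewrite big_const_seq count_predT size_iota iter_addn_0.
  move: le_m; rewrite -/k; clear; nia.
- by apply: nested_fits => //; apply: xs_desc.
Qed.

(** Renumbering the bins permutes the capacities, so every order of service is realised by some
    placement. *)
Lemma reorder_sol f q M : (forall i, (i < k)%N -> (f i < q)%N) -> sol T (caps f q) M ->
  exists f', (forall i, (i < k)%N -> (f' i < q)%N) /\ gsol T (caps f' q) M.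
Proof.
move=> f_lt sl; have [cs' pcs gs] := sol_gsol sl (caps_le f q).
rewrite perm_sym in pcs; have [Is pIs eIs] := perm_iotaP 0 pcs.
rewrite size_mkseq in pIs.
have sIs : size Is = q by rewrite (perm_size pIs) size_iota.
have uIs : uniq Is by rewrite (perm_uniq pIs) iota_uniq.
have mIs c : (c \in Is) = (c < q)%N by rewrite (perm_mem pIs) mem_iota.
exists (fun x => index (f x) Is); split=> [i hi|].
  by rewrite -sIs index_mem mIs f_lt.
suff -> : caps (fun x => index (f x) Is) q = cs' by [].
rewrite eIs; apply: (@eq_from_nth _ 0); first by rewrite size_mkseq size_map sIs.
rewrite size_mkseq => i hi; rewrite nth_mkseq // (nth_map 0%N) ?sIs //.
have hIs : (nth 0%N Is i < q)%N by rewrite -mIs mem_nth // sIs.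
rewrite nth_mkseq //; congr (T - _).
rewrite /group big_seq [RHS]big_seq; apply: eq_bigr => x.
rewrite mem_index_iota => /andP[_ hx].
congr (if _ then _ else _); apply/eqP/eqP => [<-|->]; last by rewrite index_uniq ?sIs.
by rewrite nth_index // mIs f_lt.
Qed.

(** The dummy id [n] may occur in many pairs, so [OUT] is constrained at real ids only, and the load
    of a bin is computed with the dummies masked by [x < n]. *)
Lemma sound (PA PB F OUT : nat -> nat) q N : (m <= 2 * N)%N -> (q <= N)%N ->
  (forall i, (i < k)%N -> (F i < q)%N) ->
  perm_eq (mkseq large_ids (2 * N)) (flatten [seq [:: PA c; PB c] | c <- iota 0 N]) ->
  (forall c, (c < N)%N -> sz (PA c) + sz (PB c) <= T - (if (c < q)%N then group F c k else 0)) ->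
  (forall c, (c < N)%N -> ((PA c < n)%N -> OUT (PA c) = c) /\ ((PB c < n)%N -> OUT (PB c) = c)) ->
  (forall i, (i < k)%N -> OUT (A (m + i)%N) = F i) ->
  (forall j, (j < n)%N -> (OUT j < N)%N) /\ feasible_assignment s T OUT.
Proof.
move=> le_m le_q F_lt pX le_T outP outF.
have large_out p : (p < m)%N -> exists2 c, (c < N)%N & (A p = PA c \/ A p = PB c) /\ OUT (A p) = c.
  move=> hp; have hA : (A p < n)%N by apply: A_lt; apply: leq_trans m_le.
  have : A p \in mkseq large_ids (2 * N).
    apply/mapP; exists p; first by rewrite mem_iota; move: hp le_m; clear; lia.
    by rewrite /large_ids hp.
  rewrite (perm_mem pX) => /flatten_mapP[c]; rewrite mem_iota => /andP[_ hc].
  have [o1 o2] := outP c hc; rewrite !inE => /orP[]/eqP e; exists c => //; rewrite e in hA *.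
    by split; [left | apply: o1].
  by split; [right | apply: o2].
split.
  move=> j hj; have : j \in mkseq A n by rewrite (perm_mem A_perm) mem_iota.
  move=> /mapP[p]; rewrite mem_iota => /andP[_ hp] ->.
  have [lt_p|le_p] := ltnP p m; first by have [c hc [_ ->]] := large_out p lt_p.
  rewrite -(subnKC le_p) outF; last by move: hp le_p; rewrite /k; clear; lia.
  by apply: leq_trans le_q; apply: F_lt; move: hp le_p; rewrite /k; clear; lia.
move=> c; rewrite load_split.
have grpE : group (fun x => OUT (A (m + x)%N)) c k = group F c k.
  rewrite /group big_seq [RHS]big_seq; apply: eq_bigr => x.
  by rewrite mem_index_iota => /andP[_ hx]; rewrite outF.
rewrite grpE.
have [hc|hc] := ltnP c N; last first.
  rewrite big_seq big1; last first.
    move=> p; rewrite mem_index_iota => /andP[_ hp]; have [c' hc' [_ ->]] := large_out p hp.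
    by case: eqP => // e; move: hc hc'; rewrite e; clear; lia.
  rewrite add0r /group big_seq big1 // => x; rewrite mem_index_iota => /andP[_ hx].
  have := F_lt x hx; case: eqP => // ->; move: hc le_q; clear; lia.
have e1 : \sum_(0 <= p < m) (if OUT (A p) == c then sz (A p) else 0) =
    \sum_(x <- mkseq large_ids (2 * N)) (if (x < n)%N && (OUT x == c) then sz x else 0).
  rewrite /mkseq -(subnKC le_m) iotaD map_cat big_cat /= !big_map add0n.
  rewrite [X in _ = _ + X]big_seq [X in _ = _ + X]big1 ?addr0; last first.
    by move=> i; rewrite mem_iota /large_ids => /andP[hi _]; rewrite [(i < m)%N]ltnNge hi /= ltnn.
  rewrite /index_iota subn0 big_seq [RHS]big_seq; apply: eq_bigr => p.
  rewrite mem_iota /large_ids => /andP[_ hp]; rewrite hp A_lt //.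
  exact: leq_trans m_le.
rewrite e1 (perm_big _ pX) /= big_flatten /= big_map (bigD1_seq c) ?mem_iota ?iota_uniq //=.
rewrite [X in _ + X + _]big_seq_cond [X in _ + X + _]big1 ?addr0; last first.
  move=> c' /andP[]; rewrite mem_iota => /andP[_ hc'] /negbTE ne.
  have [o1 o2] := outP c' hc'; rewrite !big_cons big_nil addr0.
  case: ifP => [/andP[/o1 -> ]|_]; first by rewrite ne.
  by case: ifP => [/andP[/o2 -> ]|_]; rewrite ?addr0 ?ne.
rewrite !big_cons big_nil addr0.
have pos x : x \in [:: PA c; PB c] -> (if (x < n)%N && (OUT x == c) then sz x else 0) <= sz x.
  move=> hx; case: ifP => // _.
  suff : (x <= n)%N by move=> /sz_bound/andP[].
  have : x \in flatten [seq [:: PA c; PB c] | c <- iota 0 N].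
    by apply/flatten_mapP; exists c => //; rewrite mem_iota.
  rewrite -(perm_mem pX) => /mapP[p _ ->]; rewrite /large_ids; case: ifP => // hp.
  by apply/ltnW/A_lt; apply: leq_trans m_le.
have pA := pos (PA c) ltac:(by rewrite !inE eqxx).
have pB := pos (PB c) ltac:(by rewrite !inE eqxx orbT).
have -> : group F c k = (if (c < q)%N then group F c k else 0).
  case: ltnP => // le_qc; rewrite /group big_seq big1 // => x.
  rewrite mem_index_iota => /andP[_ hx]; case: eqP => // e.
  by have := F_lt x hx; rewrite e ltnNge le_qc.
have := le_T c hc; rewrite lerBrDr => h; apply: (le_trans _ h).
apply: lerD; last exact: lexx.
exact: lerD pA pB.
Qed.
End Packing.

(** * The number of large items *)

Lemma ltn_sorted_nth (P : seq nat) i : sorted ltn P -> (i < size P)%N -> (i <= nth 0%N P i)%N.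
Proof.
move=> sP; elim: i => // i IH hi; apply: leq_ltn_trans (IH (ltnW hi)) _.
by apply: (sorted_ltn_nth ltn_trans 0%N sP); rewrite ?inE // ltnW.
Qed.

(** In an incompatible set with more than [m] members, those ranked [m - 2], [m - 1] and [m] by
    decreasing size are no larger than the items at these positions of the whole order, which fit
    into [T] together. Hence [n - m], the number of items that the program treats as small, is at
    most [num_small s T]. *)
Lemma num_large_le (s : seq rat) (T : rat) (sz : nat -> rat) (A : nat -> nat) (m : nat) :
  (forall j, (j < size s)%N -> sz j = s`_j) ->
  perm_eq (mkseq A (size s)) (iota 0 (size s)) -> desc (size s) (sz \o A) ->
  (m <= size s)%N ->
  ((m < size s)%N -> (1 < m)%N /\
     sz (A m) + sz (A (m - 1)%N) + sz (A (m - 2)%N) <= T) ->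
  (num_large s T <= m)%N.
Proof.
move=> sz_s A_perm A_desc m_le m_max; apply/bigmax_leqP => S incS.
move: m_le; rewrite leq_eqVlt => /orP[/eqP->|m_lt].
  by apply: leq_trans (max_card _) _; rewrite card_ord.
have [m2 leT] := m_max m_lt; rewrite leqNgt; apply/negP => ltS.
pose inS j := has (fun i : 'I_(size s) => (i \in S) && (val i == j)) (enum 'I_(size s)).
have inSP j : inS j -> exists2 i : 'I_(size s), i \in S & val i = j.
  by move=> /hasP[i _ /andP[iS /eqP e]]; exists i.
have inSv (i : 'I_(size s)) : inS i = (i \in S).
  apply/hasP/idP => [[i' _ /andP[iS /eqP/val_inj <-]] //|iS].
  by exists i; rewrite ?mem_enum // iS /=.
pose P := [seq p <- iota 0 (size s) | inS (A p)].
have sP : size P = #|S|.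
  rewrite size_filter -(count_map A inS) -[map A _]/(mkseq A (size s)) (permP A_perm).
  rewrite -val_enum_ord count_map enumT cardE /enum_mem size_filter.
  by apply: eq_count => i /=; rewrite inSv.
have soP : sorted ltn P by apply: sorted_filter; [exact: ltn_trans | exact: iota_ltn_sorted].
have Pp i : (i <= m)%N -> exists2 a : 'I_(size s), a \in S & val a = A (nth 0%N P i).
  move=> hi; have : nth 0%N P i \in P by rewrite mem_nth // sP; apply: leq_ltn_trans ltS.
  by rewrite mem_filter => /andP[/inSP].
have Plt i : (i <= m)%N -> (nth 0%N P i < size s)%N.
  move=> hi; have : nth 0%N P i \in P by rewrite mem_nth // sP; apply: leq_ltn_trans ltS.
  by rewrite mem_filter mem_iota => /andP[_].
have Pge i : (i <= m)%N -> sz (A (nth 0%N P i)) <= sz (A i).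
  move=> hi; apply: A_desc; last exact: Plt.
  by apply: ltn_sorted_nth => //; rewrite sP; apply: leq_ltn_trans ltS.
have Aneq i j : (i < j <= m)%N -> A (nth 0%N P i) <> A (nth 0%N P j).
  move=> /andP[hij hj] eA; have uA : uniq (mkseq A (size s)).
    by rewrite (perm_uniq A_perm) iota_uniq.
  have := nth_uniq 0%N _ _ uA; rewrite size_mkseq.
  move=> /(_ _ _ (Plt i (ltnW (leq_trans hij hj))) (Plt j hj)).
  rewrite !nth_mkseq ?Plt //; last by exact: ltnW (leq_trans hij hj).
  rewrite eA eqxx => /esym/eqP e.
  have uP : uniq P by rewrite filter_uniq ?iota_uniq.
  have : i == j by rewrite -(nth_uniq 0%N _ _ uP) ?e ?sP //; clear -hij hj ltS; lia.
  by clear -hij; lia.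
have h0 : (m - 2 <= m)%N by clear; lia.
have h1 : (m - 1 <= m)%N by clear; lia.
have [a aS ea] := Pp _ h0; have [b bS eb] := Pp _ h1; have [c cS ec] := Pp m (leqnn _).
have nab : a != b.
  apply/eqP => e; apply: (Aneq (m - 2)%N (m - 1)%N); first by clear -m2; lia.
  by rewrite -ea -eb e.
have nac : a != c.
  apply/eqP => e; apply: (Aneq (m - 2)%N m); first by clear -m2; lia.
  by rewrite -ea -ec e.
have nbc : b != c.
  apply/eqP => e; apply: (Aneq (m - 1)%N m); first by clear -m2; lia.
  by rewrite -eb -ec e.
move/forallP: incS => /(_ a)/implyP/(_ aS)/forallP/(_ b)/implyP/(_ bS).
move=> /forallP/(_ c)/implyP/(_ cS)/implyP; rewrite nab nac nbc => /(_ isT).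
rewrite -!sz_s // ea eb ec; move: (Pge _ h0) (Pge _ h1) (Pge m (leqnn _)) leT.
clear; lra.
Qed.

(** * The packing program: sorting *)

(* Array numbers; a scalar is cell 0 of its array. [a_A] holds the ids of the items by decreasing
   size; [a_X] the large ones, padded with the dummy id [n] of size 0; [a_Y] those still unpaired;
   [a_F] the bins of the small items; [a_PA] and [a_PB] the pairs of large items. *)
Notation i_n := 0%N (only parsing).
Notation i_L := 1%N (only parsing).
Notation i_w := 2%N (only parsing).
Notation i_lo := 3%N (only parsing).
Notation i_p := 4%N (only parsing).
Notation i_q := 5%N (only parsing).
Notation i_o := 6%N (only parsing).
Notation i_m := 7%N (only parsing).
Notation i_k := 8%N (only parsing).
Notation i_bins := 9%N (only parsing).
Notation i_sp := 10%N (only parsing).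
Notation i_i := 11%N (only parsing).
Notation i_j := 12%N (only parsing).
Notation i_t := 13%N (only parsing).
Notation i_h := 14%N (only parsing).
Notation i_ok := 15%N (only parsing).
Notation i_found := 16%N (only parsing).
Notation i_more := 17%N (only parsing).
Notation i_len := 18%N (only parsing).
Notation i_a := 19%N (only parsing).
Notation i_b := 20%N (only parsing).
Notation a_A := 21%N (only parsing).
Notation a_B := 22%N (only parsing).
Notation a_X := 23%N (only parsing).
Notation a_Y := 24%N (only parsing).
Notation a_F := 25%N (only parsing).
Notation a_PA := 26%N (only parsing).
Notation a_PB := 27%N (only parsing).
Notation a_OUT := 28%N (only parsing).
Notation r_T := 0%N (only parsing).
Notation r_SZ := 1%N (only parsing).
Notation r_CAP := 2%N (only parsing).

Notation V x := (NA x (NC 0)).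
Notation "x <~ e" := (NPut x (NC 0) e) (at level 60).
Notation "c1 ;; c2" := (Seq c1 c2) (at level 63, right associativity).
Notation "e1 +: e2" := (NPlus e1 e2) (at level 50, left associativity).
Notation "e1 -: e2" := (NMinus e1 e2) (at level 50, left associativity).
Notation SZof e := (QA r_SZ e).
Notation Tcap := (QA r_T (NC 0)).
Notation incr x := (x <~ V x +: NC 1).

Lemma putE (V : Type) (f : nat -> nat -> V) a i v a' :
  put f a i v a' = if a' == a then fun i' => if i' == i then v else f a i' else f a'.
Proof. by []. Qed.

Ltac wps := repeat (lazymatch goal with
  | |- wp (Seq _ _) _ _ => apply: wp_seq
  | |- wp (NPut _ _ _) _ _ => apply: wp_nput
  | |- wp (QPut _ _ _) _ _ => apply: wp_qput
  | |- wp Skip _ _ => apply: wp_skip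
  end; cbv beta); rewrite /put /=.

(** The sort is a bottom-up merge sort; padding to a power of two keeps all its blocks full. *)
Definition c_pow : cmd :=
  i_L <~ NC 1 ;; While (NLe (V i_L +: NC 1) (V i_n)) (i_L <~ V i_L +: V i_L).

Lemma pow_spec s n : nats s i_n 0%N = n -> (0 < n)%N ->
  wp c_pow s (fun t s' => exists e, [/\ nats s' i_L 0%N = (2 ^ e)%N, (n <= 2 ^ e)%N,
    (2 ^ e <= 2 * n)%N, (e <= (trunc_log 2 n).+1)%N & (t <= n)%N]).
Proof.
move=> sn n0; rewrite /c_pow; wps.
apply: (wp_while (I := fun s1 => nats s1 i_n 0%N = n /\ exists e, [/\ nats s1 i_L 0%N = (2 ^ e)%N,
    (2 ^ e <= 2 * n)%N & (e <= (trunc_log 2 n).+1)%N])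
  (F := fun s1 => (n - nats s1 i_L 0%N)%N)).
- by split=> //=; exists 0%N; split=> //; lia.
- move=> s1 fr [n1 [e [e1 e2 e3]]] /=; rewrite n1 e1 => lt; wps.
  rewrite e1; split; last by have := expn_gt0 2 e; lia.
  split=> //; exists e.+1; split; first by rewrite expnS; lia.
  + by rewrite expnS; lia.
  + by apply: trunc_log_max; [|lia].
- move=> t s1 fr [n1 [e [e1 e2 e3]]] /=; rewrite n1 e1 => lt le_t.
  by exists e; split=> //; lia.
Qed.

(** Padding ids get size -1, below every item, so that sorting moves them to the end. *)
Definition c_ids : cmd :=
  i_i <~ NC 0 ;; While (NLe (V i_i +: NC 1) (V i_L))
    (NPut a_A (V i_i) (V i_i) ;;
     If (NLe (V i_n) (V i_i)) (QPut r_SZ (V i_i) (QC (-1))) Skip ;; incr i_i).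

Lemma ids_spec s n L : nats s i_n 0%N = n -> nats s i_L 0%N = L ->
  wp c_ids s (fun t s' => [/\ (t <= L)%N, forall i, (i < L)%N -> nats s' a_A i = i,
    forall i, (i < n)%N -> rats s' r_SZ i = rats s r_SZ i,
    forall i, (n <= i < L)%N -> rats s' r_SZ i = -1 & rats s' r_T = rats s r_T]).
Proof.
move=> sn sL; rewrite /c_ids; wps.
apply: (wp_while (I := fun s1 => [/\ nats s1 i_n 0%N = n, nats s1 i_L 0%N = L,
    (nats s1 i_i 0%N <= L)%N, forall i, (i < nats s1 i_i 0%N)%N -> nats s1 a_A i = i &
    [/\ forall i, (i < n)%N -> rats s1 r_SZ i = rats s r_SZ i,
    forall i, (n <= i < nats s1 i_i 0%N)%N -> rats s1 r_SZ i = -1 & rats s1 r_T = rats s r_T]])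
  (F := fun s1 => (L - nats s1 i_i 0%N)%N)).
- split=> //=; split=> // i; lia.
- move=> s1 fr [n1 L1 le1 A1 [S1 D1 T1]] /=; rewrite L1 => lt; wps.
  apply: wp_if => /=; rewrite n1 => hn; wps; (split; last lia); split=> //=; try lia.
  + move=> i hi; case: eqP => // ne; apply: A1; lia.
  + split=> // i hi; case: eqP => // e; first by lia.
      by apply: S1.
    by apply: D1; lia.
  + by move=> i hi; case: eqP => // ne; apply: A1; lia.
  + by split=> // i hi; apply: D1; lia.
- move=> t s1 fr [n1 L1 le1 A1 [S1 D1 T1]] /=; rewrite L1 => lt le_t.
  by split=> //; [lia|move=> i hi; apply: A1; lia|move=> i hi; apply: D1; lia].
Qed.

Definition seg (f : nat -> nat) (lo l : nat) : seq nat := [seq f i | i <- iota lo l].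

Lemma segS f lo l : seg f lo l.+1 = f lo :: seg f lo.+1 l.
Proof. by []. Qed.

Lemma seg_rcons f lo l : seg f lo l.+1 = rcons (seg f lo l) (f (lo + l)%N).
Proof. by rewrite /seg -addn1 iotaD map_cat /= cats1. Qed.

Lemma seg_cat f lo l1 l2 : seg f lo (l1 + l2) = seg f lo l1 ++ seg f (lo + l1) l2.
Proof. by rewrite /seg iotaD map_cat. Qed.

Lemma eq_seg f g lo l : (forall i, (lo <= i < lo + l)%N -> f i = g i) -> seg f lo l = seg g lo l.
Proof. by move=> h; apply/eq_in_map => i; rewrite mem_iota => /h. Qed.

Definition by_size (SZ : nat -> rat) : rel nat := fun i j => SZ j <= SZ i.

Definition take_p : cmd := NPut a_B (V i_o) (NA a_A (V i_p)) ;; incr i_p.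
Definition take_q : cmd := NPut a_B (V i_o) (NA a_A (V i_q)) ;; incr i_q.

Definition c_merge : cmd :=
  i_p <~ V i_lo ;; i_q <~ V i_lo +: V i_w ;; i_o <~ V i_lo ;;
  While (NLe (V i_o +: NC 1) (V i_lo +: V i_w +: V i_w))
    (If (NLe (V i_p +: NC 1) (V i_lo +: V i_w))
       (If (NLe (V i_lo +: V i_w +: V i_w) (V i_q)) take_p
          (If (QLe (SZof (NA a_A (V i_q))) (SZof (NA a_A (V i_p)))) take_p take_q))
       take_q ;;
     incr i_o).

Lemma merge_spec s lo w : nats s i_lo 0%N = lo -> nats s i_w 0%N = w ->
  wp c_merge s (fun t s' => [/\ (t <= 2 * w)%N,
    seg (nats s' a_B) lo (w + w) =
      merge (by_size (rats s r_SZ)) (seg (nats s a_A) lo w) (seg (nats s a_A) (lo + w) w) &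
    forall i, (i < lo)%N -> nats s' a_B i = nats s a_B i]).
Proof.
move=> slo sw; rewrite /c_merge; wps; rewrite slo sw.
set A := nats s a_A; set SZ := rats s r_SZ; set mrg := merge (by_size SZ).
pose I (s1 : store) := exists x y, [/\ [/\ (x <= w)%N & (y <= w)%N],
  [/\ nats s1 i_lo 0%N = lo, nats s1 i_w 0%N = w, nats s1 a_A = A & rats s1 r_SZ = SZ],
  [/\ nats s1 i_p 0%N = lo + x, nats s1 i_q 0%N = lo + w + y & nats s1 i_o 0%N = lo + (x + y)]%N,
  seg (nats s1 a_B) lo (x + y) ++ mrg (seg A (lo + x) (w - x)) (seg A (lo + w + y) (w - y)) =
    mrg (seg A lo w) (seg A (lo + w) w) &
  forall i, (i < lo)%N -> nats s1 a_B i = nats s a_B i].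
apply: (wp_while (I := I) (F := fun s1 => (lo + w + w - nats s1 i_o 0%N)%N)).
- by exists 0%N, 0%N; rewrite !addn0 !subn0.
- move=> s1 fr [x [y [[hx hy] [e1 e2 e3 e4] [e5 e6 e7] eI eB]]] /=; rewrite e1 e2 e7 => lt.
  have stepP : (x < w)%N -> ((y < w)%N -> SZ (A (lo + w + y)%N) <= SZ (A (lo + x)%N)) ->
    seg (put (nats s1) a_B (lo + (x + y))%N (A (lo + x)%N) a_B) lo (x.+1 + y) ++
     mrg (seg A (lo + x.+1) (w - x.+1)) (seg A (lo + w + y) (w - y)) =
    mrg (seg A lo w) (seg A (lo + w) w).
    move=> lx hle; rewrite -eI addSn seg_rcons putE eqxx /= eqxx cat_rcons.
    congr (_ ++ _).
      by apply: eq_seg => i hi; rewrite ifF //; lia.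
    rewrite -[(w - x)%N]prednK; last lia.
    rewrite segS -subnS addnS; case: (ltnP y w) => hy'; last first.
      by have -> : (w - y = 0)%N by [lia]; rewrite /mrg /=; case: (w - x.+1)%N.
    rewrite -[(w - y)%N]prednK; last lia.
    by rewrite segS /mrg /= /by_size hle.
  have stepQ : (y < w)%N -> ((x < w)%N -> SZ (A (lo + x)%N) < SZ (A (lo + w + y)%N)) ->
    seg (put (nats s1) a_B (lo + (x + y))%N (A (lo + w + y)%N) a_B) lo (x + y.+1) ++
     mrg (seg A (lo + x) (w - x)) (seg A (lo + w + y.+1) (w - y.+1)) =
    mrg (seg A lo w) (seg A (lo + w) w).
    move=> ly hle; rewrite -eI addnS seg_rcons putE eqxx /= eqxx cat_rcons.
    congr (_ ++ _).
      by apply: eq_seg => i hi; rewrite ifF //; lia.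
    rewrite -[in RHS](prednK (n := w - y)); last lia.
    rewrite segS -subnS addnS; case: (ltnP x w) => hx'; last first.
      by have -> : (w - x = 0)%N by lia.
    rewrite -[in RHS](prednK (n := w - x)); last lia.
    rewrite -[in LHS](prednK (n := w - x)); last lia.
    by rewrite segS /mrg /= /by_size [_ <= _]leNgt (hle hx').
  have doP : (x < w)%N -> ((y < w)%N -> SZ (A (lo + w + y)%N) <= SZ (A (lo + x)%N)) ->
      wp take_p s1 (fun t1 s2 => wp (incr i_o) s2 (fun t2 s3 => I s3 /\
        (t1 + t2 + (lo + w + w - nats s3 i_o 0) < lo + w + w - (lo + (x + y)))%N)).
    move=> lx hle; rewrite /take_p; wps; rewrite e3 e5 e7; split; last lia.
    exists x.+1, y; split=> //=.
    + by split=> //; lia.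
    + exact: (stepP lx hle).
    + by move=> i hi; rewrite ifF ?eB //; lia.
  have doQ : (y < w)%N -> ((x < w)%N -> SZ (A (lo + x)%N) < SZ (A (lo + w + y)%N)) ->
      wp take_q s1 (fun t1 s2 => wp (incr i_o) s2 (fun t2 s3 => I s3 /\
        (t1 + t2 + (lo + w + w - nats s3 i_o 0) < lo + w + w - (lo + (x + y)))%N)).
    move=> ly hle; rewrite /take_q; wps; rewrite e3 e6 e7; split; last lia.
    exists x, y.+1; split=> //=.
    + by split=> //; lia.
    + exact: (stepQ ly hle).
    + by move=> i hi; rewrite ifF ?eB //; lia.
  apply: wp_seq; apply: wp_if => /=; rewrite e1 e2 e5 => hp; last first.
    by apply: doQ => [|hx']; [lia | exfalso; lia].
  apply: wp_if => /=; rewrite e1 e2 e6 => hq.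
    by apply: doP => [|hy']; [lia | exfalso; lia].
  apply: wp_if => /=; rewrite e3 e4 e5 e6 => hle.
    by apply: doP => //; lia.
  by apply: doQ => [|_]; [lia | rewrite ltNge].
- move=> t s1 fr [x [y [[hx hy] [e1 e2 e3 e4] [e5 e6 e7] eI eB]]] /=; rewrite e1 e2 e7 => lt le_t.
  have ex : x = w by lia.
  have ey : y = w by lia.
  split=> //; first lia.
  by rewrite -eI ex ey subnn /mrg /= cats0.
Qed.

Lemma by_size_total SZ : total (by_size SZ).
Proof. by move=> i j; apply: le_total. Qed.

Definition c_pass : cmd :=
  i_lo <~ NC 0 ;; While (NLe (V i_lo +: NC 1) (V i_L)) (c_merge ;; i_lo <~ V i_lo +: V i_w +: V i_w).

Lemma pass_spec s L w r : nats s i_L 0%N = L -> nats s i_w 0%N = w -> (0 < w)%N ->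
  L = (r * (w + w))%N ->
  (forall j, (j.+1 * w <= L)%N ->
     sorted (by_size (rats s r_SZ)) (seg (nats s a_A) (j * w) w)) ->
  wp c_pass s (fun t s' => [/\ (t <= 2 * L)%N,
    perm_eq (seg (nats s' a_B) 0 L) (seg (nats s a_A) 0 L) &
    forall j, (j.+1 * (w + w) <= L)%N ->
      sorted (by_size (rats s r_SZ)) (seg (nats s' a_B) (j * (w + w)) (w + w))]).
Proof.
move=> sL sw w0 Lr; set SZ := rats s r_SZ; set A := nats s a_A => blk; rewrite /c_pass; wps.
pose I (s1 : store) := exists j0, [/\ (j0 <= r)%N /\ nats s1 i_lo 0%N = (j0 * (w + w))%N,
  [/\ nats s1 i_L 0%N = L, nats s1 i_w 0%N = w, nats s1 a_A = A & rats s1 r_SZ = SZ],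
  perm_eq (seg (nats s1 a_B) 0 (j0 * (w + w))) (seg A 0 (j0 * (w + w))) &
  forall j, (j < j0)%N ->
      sorted (by_size SZ) (seg (nats s1 a_B) (j * (w + w)) (w + w))].
(* Merging two blocks of width [w] takes [2 w] iterations, plus one for the step itself; the
   potential drops by [4 w]. *)
apply: (wp_while (I := I) (F := fun s1 => (2 * (L - nats s1 i_lo 0%N))%N)).
- by exists 0%N.
- move=> s1 fr [j0 [[hj e0] [e1 e2 e3 e4] pm so]] /=; rewrite e0 e1 => lt.
  have lt_j : (j0 < r)%N by move: lt; rewrite Lr; clear; nia.
  apply: wp_seq; apply: wp_mono (merge_spec e0 e2) _ => t s2 [fn fq].
  rewrite e3 e4 => -[le_t mg lowB]; wps.
  rewrite (fn i_lo) // (fn i_w) // e0 e2; split; last by move: le_t w0 lt_j; rewrite Lr; clear; nia.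
  exists j0.+1; split=> /=.
  + by split=> //; clear; lia.
  + by split; rewrite ?fq // fn.
  + rewrite mulSn addnC seg_cat [X in perm_eq _ X]seg_cat !add0n mg; apply: perm_cat.
      by rewrite (eq_seg (g := nats s1 a_B)) // => i hi; apply: lowB; move: hi; clear; lia.
    by rewrite perm_merge -seg_cat.
  + move=> j; rewrite ltnS leq_eqVlt => /orP[/eqP->|lt_jj].
      rewrite mg; apply: merge_sorted; first exact: by_size_total.
        have := blk (2 * j0)%N; rewrite (_ : (2 * j0 * w = j0 * (w + w))%N); last by clear; lia.
        by apply; move: lt_j; rewrite Lr; clear; nia.
      have := blk (2 * j0).+1; rewrite (_ : ((2 * j0).+1 * w = j0 * (w + w) + w)%N); last by clear; lia.
      by apply; move: lt_j; rewrite Lr; clear; nia.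
    rewrite (eq_seg (g := nats s1 a_B)); first exact: so.
    by move=> i hi; apply: lowB; move: hi lt_jj; clear; nia.
- move=> t s1 fr [j0 [[hj e0] [e1 e2 e3 e4] pm so]] /=; rewrite e0 e1 => lt le_t.
  have ej : j0 = r by move: lt hj; rewrite Lr; clear -w0; nia.
  split.
  + by move: le_t; clear; lia.
  + by move: pm; rewrite ej -Lr.
  + by move=> j hjL; apply: so; move: hjL; rewrite ej Lr; clear -w0; nia.
Qed.

Definition c_copy : cmd :=
  i_i <~ NC 0 ;; While (NLe (V i_i +: NC 1) (V i_L)) (NPut a_A (V i_i) (NA a_B (V i_i)) ;; incr i_i).

Lemma copy_spec s L : nats s i_L 0%N = L ->
  wp c_copy s (fun t s' => (t <= L)%N /\
    forall i, (i < L)%N -> nats s' a_A i = nats s a_B i).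
Proof.
move=> sL; rewrite /c_copy; wps; set B := nats s a_B.
apply: (wp_while (I := fun s1 => [/\ nats s1 i_L 0%N = L, nats s1 a_B = B,
    (nats s1 i_i 0%N <= L)%N & forall i, (i < nats s1 i_i 0%N)%N -> nats s1 a_A i = B i])
  (F := fun s1 => (L - nats s1 i_i 0%N)%N)).
- by split.
- move=> s1 fr [e1 e2 le1 h] /=; rewrite e1 => lt; wps; split; last by move: lt; clear; lia.
  split=> //=.
  move=> i hi; rewrite e2; case: eqP => [->//|ne]; apply: h; move: hi ne; clear; lia.
- move=> t s1 fr [e1 e2 le1 h] /=; rewrite e1 => lt le_t.
  by split=> [|i hi]; [move: le_t; clear; lia | apply: h; move: hi lt; clear; lia].
Qed.

Definition c_sort : cmd :=
  i_w <~ NC 1 ;; While (NLe (V i_w +: NC 1) (V i_L)) (c_pass ;; c_copy ;; i_w <~ V i_w +: V i_w).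

Lemma sort_spec s e : nats s i_L 0%N = (2 ^ e)%N ->
  (forall i, (i < 2 ^ e)%N -> nats s a_A i = i) ->
  wp c_sort s (fun t s' => [/\ (t <= 4 * 2 ^ e * e)%N,
    perm_eq (mkseq (nats s' a_A) (2 ^ e)) (iota 0 (2 ^ e)) &
    desc (2 ^ e) (rats s r_SZ \o nats s' a_A)]).
Proof.
move=> sL Ai; rewrite /c_sort; wps; set SZ := rats s r_SZ.
set L := (2 ^ e)%N in sL Ai *.
pose I (s1 : store) := exists e1, [/\ (e1 <= e)%N /\ nats s1 i_w 0%N = (2 ^ e1)%N,
  nats s1 i_L 0%N = L, rats s1 r_SZ = SZ,
  perm_eq (seg (nats s1 a_A) 0 L) (iota 0 L) &
  forall j, (j.+1 * 2 ^ e1 <= L)%N ->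
     sorted (by_size SZ) (seg (nats s1 a_A) (j * 2 ^ e1) (2 ^ e1))].
(* A round costs at most [2 L] for the pass, [L] for the copy and one for itself, within [4 L]. *)
apply: (wp_while (I := I) (F := fun s1 => (4 * L * (e - trunc_log 2 (nats s1 i_w 0%N)))%N)).
- exists 0%N; split=> //=.
  rewrite (eq_seg (g := id)) => [|i hi]; first by rewrite /seg map_id.
  by apply: Ai; move: hi; clear; lia.
- move=> s1 fr [e1 [[he ew] eL eS pm so]] /=; rewrite ew eL => lt.
  have lt_e : (e1 < e)%N by rewrite -(ltn_exp2l _ _ (isT : (1 < 2)%N)) -addn1.
  have eLr : L = (2 ^ (e - e1.+1) * (2 ^ e1 + 2 ^ e1))%N.
    by rewrite addnn -mul2n -expnS -expnD subnK.
  have so' j : (j.+1 * 2 ^ e1 <= L)%N ->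
     sorted (by_size (rats s1 r_SZ)) (seg (nats s1 a_A) (j * 2 ^ e1) (2 ^ e1)).
    by rewrite eS; apply: so.
  apply: wp_seq; apply: wp_mono (pass_spec eL ew _ eLr so') _; first by rewrite expn_gt0.
  move=> t1 s2 fr2 [le_t1 pm2 so2]; have [fn2 fq2] := fr2.
  apply: wp_seq; have eL2 : nats s2 i_L 0%N = L by rewrite fn2.
  apply: wp_mono (copy_spec eL2) _ => t2 s3 [fn3 fq3] [le_t2 cp]; wps.
  have ew3 : nats s3 i_w 0%N = (2 ^ e1)%N by rewrite fn3 // fn2.
  have sgE lo l : (lo + l <= L)%N -> seg (nats s3 a_A) lo l = seg (nats s2 a_B) lo l.
    by move=> hl; apply: eq_seg => i hi; apply: cp; move: hi hl; clear; lia.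
  rewrite ew3 addnn -mul2n -expnS !trunc_expnK //; split; last first.
    have L0 : (0 < L)%N by rewrite expn_gt0.
    by move: le_t1 le_t2 lt_e L0; clear; nia.
  exists e1.+1; split=> //=.
  + by rewrite fn3 // fn2.
  + by rewrite fq3 // fq2.
  + by rewrite sgE ?leqnn // (perm_trans pm2 pm).
  + move=> j hj; rewrite sgE; last by move: hj; clear; lia.
    have := so2 j; rewrite addnn -mul2n -expnS eS; exact.
- move=> t s1 fr [e1 [[he ew] eL eS pm so]] /=; rewrite ew eL => lt.
  rewrite (_ : trunc_log 2 1 = 0%N) // subn0 => le_t.
  have ee : e1 = e.
    apply/eqP; rewrite eqn_leq he -(leq_exp2l _ _ (isT : (1 < 2)%N)) -/L.
    by move: lt; clear; lia.
  split=> //; first by move: le_t; clear; lia.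
  have := so 0%N; rewrite ee mul1n mul0n => /(_ (leqnn _)) srt.
  move=> i j hij hj; have hi : (i < L)%N := leq_ltn_trans hij hj.
  have tr : transitive (by_size SZ) by move=> a b c; rewrite /by_size => h1 h2; apply: le_trans h2 h1.
  have rf : reflexive (by_size SZ) by move=> a; rewrite /by_size lexx.
  have := sorted_leq_nth tr rf 0%N srt; rewrite size_map size_iota => /(_ i j hi hj hij).
  by rewrite !(nth_map 0%N) ?size_iota // !nth_iota.
Qed.

(** * Large items and the lower bound *)

(** With truncated subtraction [n - (n - 2)] is [min (n, 2)]: fewer than three items are always
    3-incompatible. By the decreasing order, only the three smallest items of the extended prefix
    need testing. At the end the dummy id [n] receives size 0. *)
Definition c_mk : cmd :=
  i_m <~ V i_n -: (V i_n -: NC 2) ;; i_ok <~ NC 1 ;;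
  While (NLe (NC 1) (V i_ok))
    (If (NLe (V i_m +: NC 1) (V i_n))
       (If (QLe (QPlus (QPlus (SZof (NA a_A (V i_m))) (SZof (NA a_A (V i_m -: NC 1))))
                  (SZof (NA a_A (V i_m -: NC 2)))) Tcap)
          (i_ok <~ NC 0) (incr i_m))
       (i_ok <~ NC 0)) ;;
  i_k <~ V i_n -: V i_m ;; QPut r_SZ (V i_n) (QC 0).

Lemma mk_spec s n T A sz : nats s i_n 0%N = n -> rats s r_T 0%N = T -> nats s a_A = A ->
  rats s r_SZ = sz ->
  wp c_mk s (fun t s' => exists m, [/\ (t <= n.+1)%N,
    nats s' i_m 0%N = m /\ nats s' i_k 0%N = (n - m)%N, (m <= n)%N,
    ((2 < m)%N -> T < sz (A (m - 1)%N) + sz (A (m - 2)%N) + sz (A (m - 3)%N)) /\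
    ((m < n)%N -> (1 < m)%N /\ sz (A m) + sz (A (m - 1)%N) + sz (A (m - 2)%N) <= T) &
    rats s' r_SZ n = 0 /\ forall i, i <> n -> rats s' r_SZ i = sz i]).
Proof.
move=> sn sT sA sS; rewrite /c_mk; wps.
pose I (s1 : store) := exists m o, [/\ [/\ nats s1 i_n 0%N = n, rats s1 r_T 0%N = T,
    nats s1 a_A = A & rats s1 r_SZ = sz],
  [/\ nats s1 i_m 0%N = m, nats s1 i_ok 0%N = o, (o <= 1)%N, (n - (n - 2) <= m)%N & (m <= n)%N],
  ((2 < m)%N -> T < sz (A (m - 1)%N) + sz (A (m - 2)%N) + sz (A (m - 3)%N)) &
  o = 0%N -> (m < n)%N -> sz (A m) + sz (A (m - 1)%N) + sz (A (m - 2)%N) <= T].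
apply: (wp_while (I := I) (F := fun s1 => (n - nats s1 i_m 0%N + nats s1 i_ok 0%N)%N)).
- exists (n - (n - 2))%N, 1%N; rewrite /= sn; split=> //.
  + by split=> //; clear; lia.
  + by move=> h; exfalso; move: h; clear; lia.
- move=> s1 fr [m [o [[e1 e2 e3 e4] [e5 e6 o1 m2 mn] hi ho]]] /=; rewrite e6 => lt.
  have eo : o = 1%N by move: lt o1; clear; lia.
  apply: wp_if => /=; rewrite e5 e1 => hm; last first.
    wps; rewrite e5; split; last by rewrite eo; clear; lia.
    exists m, 0%N; split=> //= _ h; exfalso; move: hm h; clear; lia.
  apply: wp_if => /=; rewrite e5 e2 e3 e4 => hs; wps; rewrite e5 ?e6; (split; last by rewrite eo; move: hm; clear; lia).
    by exists m, 0%N; split.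
  exists (m + 1)%N, o; split=> //=.
  + by split=> //; move: m2 hm; clear; lia.
  + move=> h2; rewrite addnK ltNge (_ : m + 1 - 2 = m - 1)%N; last by clear; lia.
    by rewrite (_ : m + 1 - 3 = m - 2)%N //; clear; lia.
  + by rewrite eo.
- move=> t s1 fr [m [o [[e1 e2 e3 e4] [e5 e6 o1 m2 mn] hi ho]]] /=; rewrite e6 e5 => lt le_t.
  have eo : o = 0%N by move: lt o1; clear; lia.
  wps; rewrite e1 e5 e4 /= eqxx; exists m; split=> //.
  + by move: le_t; rewrite sn; clear; lia.
  + split=> // h; split; last exact: ho.
    by move: h m2; clear; lia.
  + by split=> // i ne; case: eqP.
Qed.

Definition c_X : cmd :=
  i_i <~ NC 0 ;; While (NLe (V i_i +: NC 1) (V i_n +: V i_n))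
    (If (NLe (V i_i +: NC 1) (V i_m)) (NPut a_X (V i_i) (NA a_A (V i_i)))
        (NPut a_X (V i_i) (V i_n)) ;; incr i_i).

Lemma X_spec s n m : nats s i_n 0%N = n -> nats s i_m 0%N = m ->
  wp c_X s (fun t s' => (t <= 2 * n)%N /\ forall i, (i < 2 * n)%N ->
    nats s' a_X i = if (i < m)%N then nats s a_A i else n).
Proof.
move=> sn sm; rewrite /c_X; wps; set A := nats s a_A.
apply: (wp_while (I := fun s1 => [/\ nats s1 i_n 0%N = n, nats s1 i_m 0%N = m, nats s1 a_A = A,
    (nats s1 i_i 0%N <= 2 * n)%N & forall i, (i < nats s1 i_i 0%N)%N ->
      nats s1 a_X i = if (i < m)%N then A i else n])
  (F := fun s1 => (2 * n - nats s1 i_i 0%N)%N)).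
- by split.
- move=> s1 fr [e1 e2 e3 le1 h] /=; rewrite e1 => lt.
  apply: wp_seq; apply: wp_if => /=; rewrite e2 => hm; wps;
    (split; last by move: lt; clear; lia); split=> //=; try by move: lt; clear; lia.
  + move=> i hi; rewrite e3; case: eqP => [->|ne]; last by apply: h; move: hi ne; clear; lia.
    by move: hm; rewrite addn1 => ->.
  + move=> i hi; rewrite e1; case: eqP => [->|ne]; last by apply: h; move: hi ne; clear; lia.
    by move: hm; rewrite addn1 => /negbTE ->.
- move=> t s1 fr [e1 e2 e3 le1 h] /=; rewrite e1 => lt le_t.
  by split=> [|i hi]; [move: le_t; clear; lia | apply: h; move: hi lt; clear; lia].
Qed.

(** When a nested pair fails, a bin is added without starting over: the partners of the pairs
    already checked only move to smaller entries. This keeps the search for the lower bound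
    linear. *)
Definition c_low : cmd :=
  i_bins <~ NC 0 ;; While (NLe (V i_bins +: V i_bins +: NC 1) (V i_m)) (incr i_bins) ;;
  i_i <~ NC 0 ;; While (NLe (V i_i +: NC 1) (V i_bins))
    (If (QLe (QPlus (SZof (NA a_X (V i_i)))
                    (SZof (NA a_X (V i_bins +: V i_bins -: NC 1 -: V i_i)))) Tcap)
       (incr i_i) (incr i_bins)).

Lemma low_spec s n m T x : nats s i_m 0%N = m -> rats s r_T 0%N = T -> (m <= n)%N ->
  (forall i, (i < 2 * n)%N -> rats s r_SZ (nats s a_X i) = x i) ->
  (forall L, desc L x) -> (forall i, 0 <= x i <= T) -> (forall i, (m <= i)%N -> x i = 0) ->
  wp c_low s (fun t s' => exists N, [/\ (t <= 3 * n)%N, nats s' i_bins 0%N = N, (N <= m)%N,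
    (m <= 2 * N)%N /\ nested T N x &
    forall N', (N' < N)%N -> ~ ((m <= 2 * N')%N /\ nested T N' x)]).
Proof.
move=> sm sT mn xE xd xb x0; rewrite /c_low; wps.
pose I1 (s1 : store) := [/\ nats s1 i_m 0%N = m, rats s1 r_T 0%N = T,
  (forall i, (i < 2 * n)%N -> rats s1 r_SZ (nats s1 a_X i) = x i) &
  forall N', (N' < nats s1 i_bins 0%N)%N -> (2 * N' < m)%N].
apply: (wp_while (I := fun s1 => I1 s1 /\ (nats s1 i_bins 0%N <= m)%N)
  (F := fun s1 => (m - nats s1 i_bins 0%N)%N)).
- by [].
- move=> s1 fr [[e1 e2 e3 e4] e5] /=; rewrite e1 => lt; wps.
  split; last by move: lt; clear; lia.
  split; last by move: lt; clear; lia.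
  split=> //= N' hN; move: lt hN; clear; lia.
- move=> t s1 fr [[e1 e2 e3 e4] e5] /=; rewrite e1 subn0 => lt le_t; wps.
  pose I2 (s2 : store) := exists i N, [/\ [/\ nats s2 i_m 0%N = m, rats s2 r_T 0%N = T,
      nats s2 i_i 0%N = i & nats s2 i_bins 0%N = N],
    (forall i, (i < 2 * n)%N -> rats s2 r_SZ (nats s2 a_X i) = x i),
    [/\ (i <= N)%N, (N <= m)%N & (m <= 2 * N)%N],
    (forall i', (i' < i)%N -> x i' + x (2 * N - 1 - i')%N <= T) &
    forall N', (N' < N)%N -> ~ ((m <= 2 * N')%N /\ nested T N' x)].
  apply: (wp_while (I := I2) (F := fun s1 => (2 * m - nats s1 i_i 0%N - nats s1 i_bins 0%N)%N)).
  + exists 0%N, (nats s1 i_bins 0%N); split=> //.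
    * by split=> //; move: lt; clear; lia.
    * by move=> N' /e4 h [h2 _]; move: h h2; clear; lia.
  + move=> s2 fr2 [i [N [[f1 f2 f3 f4] fx [le1 le2 le3] hi hN]]] /=; rewrite f3 f4 => lt2.
    apply: wp_if => /=; rewrite f3 f4 f2 addnn -mul2n.
      rewrite fx ?fx; [|by move: lt2 le2 mn; clear; lia|by move: lt2 le2 mn; clear; lia].
      move=> hT; wps; rewrite f3 f4; split; last by move: lt2 le2; clear; lia.
      exists (i + 1)%N, N; split=> //=.
      move=> i' hi'; have [->//|ne] := eqVneq i' i; apply: hi; move: hi' ne; clear; lia.
    rewrite fx ?fx; [|by move: lt2 le2 mn; clear; lia|by move: lt2 le2 mn; clear; lia].
    move=> hT.
    (* With [N = m] the partner would be a dummy of size 0, and the test could not fail. *)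
    have lt_N : (N < m)%N.
      rewrite ltn_neqAle le2 andbT; apply: contraNneq hT => eN.
      rewrite [x (2 * N - _ - _)%N]x0 ?addr0; first by case/andP: (xb i).
      by move: lt2; rewrite -eN; clear; lia.
    wps; rewrite f3 f4; split; last by move: lt2 lt_N; clear; lia.
    exists i, (N + 1)%N; split=> //=.
    * by split=> //; move: lt2 lt_N le3; clear; lia.
    * move=> i' hi'; apply: le_trans (hi i' hi'); rewrite lerD2l; apply: (xd (2 * (N + 1))%N).
        by clear; lia.
      by move: hi' le1; clear; lia.
    * move=> N' hN'; have [->|ne] := eqVneq N' N; last by apply: hN; move: hN' ne; clear; lia.
      by move=> [_ /(_ i)]; rewrite -addn1 => /(_ lt2); apply/negP.
  + move=> t2 s2 fr2 [i [N [[f1 f2 f3 f4] fx [le1 le2 le3] hi hN]]] /=; rewrite f3 f4 => lt2 le_t2.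
    have ei : i = N by move: lt2 le1; clear; lia.
    exists N; split=> //; first by move: le_t le_t2 mn; clear; lia.
    by split=> // i' hi'; apply: hi; rewrite ei.
Qed.

(** * The greedy pair of a special bin *)

Definition c_copyY : cmd :=
  i_i <~ NC 0 ;; While (NLe (V i_i +: NC 1) (V i_bins +: V i_bins))
    (NPut a_Y (V i_i) (NA a_X (V i_i)) ;; incr i_i) ;; i_h <~ V i_bins.

Lemma copyY_spec s N : nats s i_bins 0%N = N ->
  wp c_copyY s (fun t s' => [/\ (t <= 2 * N)%N, nats s' i_h 0%N = N &
    forall i, (i < 2 * N)%N -> nats s' a_Y i = nats s a_X i]).
Proof.
move=> sN; rewrite /c_copyY; wps; set X := nats s a_X.
apply: (wp_while (I := fun s1 => [/\ nats s1 i_bins 0%N = N, nats s1 a_X = X,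
    (nats s1 i_i 0%N <= 2 * N)%N & forall i, (i < nats s1 i_i 0%N)%N -> nats s1 a_Y i = X i])
  (F := fun s1 => (2 * N - nats s1 i_i 0%N)%N)).
- by split.
- move=> s1 fr [e1 e2 le1 h] /=; rewrite e1 => lt; wps; split; last by move: lt; clear; lia.
  split=> //=; first by move: lt; clear; lia.
  move=> i hi; rewrite e2; case: eqP => [->//|ne]; apply: h; move: hi ne; clear; lia.
- move=> t s1 fr [e1 e2 le1 h] /=; rewrite e1 => lt le_t; wps; rewrite e1; split=> //.
  + by move: le_t; clear; lia.
  + by move=> i hi; apply: h; move: hi lt; clear; lia.
Qed.

(** Setting [t] to [2 h] leaves the loop, after success as well as after failure. The tests against
    [T] are those of [scan_next]; when one fails, [scan_skip] applies before the middle and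
    [scan_fail] after it. *)
Definition c_scan : cmd :=
  i_i <~ NC 0 ;; i_t <~ NC 0 ;; i_ok <~ NC 0 ;;
  While (NLe (V i_i +: V i_t +: NC 2) (V i_h +: V i_h))
    (If (QLe (QPlus (SZof (NA a_Y (V i_i)))
                    (SZof (NA a_Y (V i_h +: V i_h -: NC 1 -: V i_t)))) (QA r_CAP (V i_j)))
       (i_ok <~ NC 1 ;; i_a <~ V i_i ;; i_b <~ V i_h +: V i_h -: NC 1 -: V i_t ;;
        i_t <~ V i_h +: V i_h)
       (If (NLe (V i_i +: NC 2) (V i_h))
          (If (QLe (QPlus (SZof (NA a_Y (V i_i)))
                          (SZof (NA a_Y (V i_h +: V i_h -: NC 2 -: V i_i)))) Tcap)
             (incr i_i)
             (incr i_i ;; i_t <~ V i_i))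
          (If (QLe (QPlus (SZof (NA a_Y (V i_i)))
                          (SZof (NA a_Y (V i_h +: V i_h -: NC 3 -: V i_i)))) Tcap)
             (incr i_i)
             (i_t <~ V i_h +: V i_h)))).

Definition scan_post (T c : rat) (h : nat) (y : nat -> rat) (s' : store) : Prop :=
  (nats s' i_ok 0%N = 1%N /\ exists a b, [/\ (a < b < 2 * h)%N, nats s' i_a 0%N = a,
      nats s' i_b 0%N = b, y a + y b <= c & fits T (mkseq y (2 * h)) ->
      forall M', perm_eq (mkseq y (2 * h)) [:: y a, y b & M'] ->
        greedy T c (mkseq y (2 * h)) (y a) (y b) M'])
  \/ (nats s' i_ok 0%N = 0%N /\ forall a b M', ~ cand T c (mkseq y (2 * h)) a b M').

Lemma scan_spec s h j c T y : nats s i_h 0%N = h -> nats s i_j 0%N = j -> (0 < h)%N ->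
  rats s r_CAP j = c -> rats s r_T 0%N = T ->
  (forall i, (i < 2 * h)%N -> rats s r_SZ (nats s a_Y i) = y i) -> desc (2 * h) y ->
  wp c_scan s (fun t s' => (t <= 2 * h)%N /\ scan_post T c h y s').
Proof.
move=> sh sj h0 sc sT sY yd; rewrite /c_scan; wps.
pose I (s1 : store) := exists i t, [/\ [/\ nats s1 i_h 0%N = h, nats s1 i_j 0%N = j,
    rats s1 r_CAP j = c & rats s1 r_T 0%N = T],
  forall i, (i < 2 * h)%N -> rats s1 r_SZ (nats s1 a_Y i) = y i,
  nats s1 i_i 0%N = i, nats s1 i_t 0%N = t &
  (nats s1 i_ok 0%N = 0%N /\ scan_inv T c h y t i) \/
  (t = (2 * h)%N /\ scan_post T c h y s1)].
apply: (wp_while (I := I) (F := fun s1 => (2 * h - nats s1 i_i 0%N - nats s1 i_t 0%N)%N)).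
- by exists 0%N, 0%N; split=> //=; left; split=> //; apply: scan_start.
- move=> s1 fr [i [t [[e1 e2 e3 e4] e5 ei et dj]]] /=; rewrite e1 ei et => lt.
  have {lt} lt : (i + t + 2 <= 2 * h)%N by move: lt; clear; lia.
  case: dj => [[eok inv]|[e _]]; last by exfalso; move: lt; rewrite e; clear; lia.
  have [[h1 h2 h3] _ _ _] := inv.
  have hi : (i < 2 * h)%N by move: lt; clear; lia.
  have hb : (2 * h - 1 - t < 2 * h)%N by move: lt; clear; lia.
  apply: wp_if => /=; rewrite e1 e2 e3 ei et addnn -mul2n e5 // e5 // => hc.
    wps; rewrite e1 ei et ?eok addnn -mul2n; split; last by move: lt; clear; lia.
    exists i, (2 * h)%N; split=> //=; right; split=> //; left; split=> //.
    exists i, (2 * h - 1 - t)%N; split=> //; first by move: lt; clear; lia.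
    by move=> fM M' pM; apply: (scan_found yd inv fM _ _ pM).
  have {hc} hc : c < y i + y (2 * h - 1 - t)%N by rewrite ltNge.
  have hb2 : (2 * h - 2 - i < 2 * h)%N by move: h0; clear; lia.
  have hb3 : (2 * h - 3 - i < 2 * h)%N by move: h0; clear; lia.
  apply: wp_if => /=; rewrite e1 ei => hh.
    have := scan_next inv lt hc; rewrite hh => nxt.
    have skp := scan_skip yd inv hh hc.
    apply: wp_if => /=; rewrite e1 e4 ei addnn -mul2n e5 // e5 // => hT.
      wps; rewrite ei et; split; last by move: lt; clear; lia.
      exists i.+1, t; split=> //=; first by rewrite addn1.
      by left; split=> //; apply: nxt.
    wps; rewrite ei; split; last by move: lt h1; clear; lia.
    exists i.+1, i.+1; rewrite addn1; split=> //=.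
    by left; split=> //; apply: skp; rewrite ltNge.
  have := scan_next inv lt hc; rewrite (negbTE hh) => nxt.
  apply: wp_if => /=; rewrite e1 e4 ei addnn -mul2n e5 // e5 // => hT.
    wps; rewrite ei et; split; last by move: lt; clear; lia.
    exists i.+1, t; split=> //=; first by rewrite addn1.
    by left; split=> //; apply: nxt.
  wps; rewrite ei e1; split; last by move: lt; clear; lia.
  exists i, (2 * h)%N; split=> //=; first by clear; lia.
  right; split=> //; right; split=> //=.
  by apply: (scan_fail yd inv lt _ hc); [rewrite ltnNge | rewrite ltNge].
- move=> t0 s1 fr [i [t [[e1 e2 e3 e4] e5 ei et dj]]] /=; rewrite e1 ei et => lt le_t.
  split; first by move: le_t; clear; lia.
  case: dj => [[eok inv]|[_]] //.
  right; split=> //; apply: (scan_exhausted yd inv); move: lt; clear; lia.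
Qed.

Definition c_delete (v : nat) : cmd :=
  i_i <~ V v ;; While (NLe (V i_i +: NC 2) (V i_len))
    (NPut a_Y (V i_i) (NA a_Y (V i_i +: NC 1)) ;; incr i_i) ;;
  i_len <~ V i_len -: NC 1.

Definition del (p : nat) (Y : nat -> nat) (x : nat) : nat :=
  if (x < p)%N then Y x else Y x.+1.

Lemma delete_spec v s p len : (v == i_a) || (v == i_b) -> nats s v 0%N = p ->
  nats s i_len 0%N = len -> (p < len)%N ->
  wp (c_delete v) s (fun t s' => [/\ (t <= len)%N, nats s' i_len 0%N = len.-1 &
    forall x, (x < len.-1)%N -> nats s' a_Y x = del p (nats s a_Y) x]).
Proof.
move=> hv sp sl hp; rewrite /c_delete; wps; rewrite sp; set Y := nats s a_Y.
apply: (wp_while (I := fun s1 => [/\ nats s1 i_len 0%N = len,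
    (p <= nats s1 i_i 0%N <= len.-1)%N,
    forall x, (x < nats s1 i_i 0%N)%N -> nats s1 a_Y x = del p Y x &
    forall x, (nats s1 i_i 0%N <= x)%N -> nats s1 a_Y x = Y x])
  (F := fun s1 => (len - nats s1 i_i 0%N)%N)).
- split=> //=; first by move: hp; clear; lia.
  by move=> x hx; rewrite /del hx.
- move=> s1 fr [e1 le1 h1 h2] /=; rewrite e1 => lt; wps; split; last by move: lt; clear; lia.
  split=> //=; first by move: lt le1; clear; lia.
    move=> x hx; case: eqP => [->|ne]; last by apply: h1; move: hx ne; clear; lia.
    rewrite h2; last by clear; lia.
    have lt_p : (nats s1 i_i 0 < p)%N = false by move: le1; clear; lia.
    by rewrite /del lt_p; congr Y; clear; lia.
  move=> x hx; case: eqP => [ex|ne]; first by exfalso; move: hx; rewrite ex; clear; lia.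
  by apply: h2; move: hx; clear; lia.
- move=> t s1 fr [e1 le1 h1 h2] /=; rewrite e1 => lt le_t; wps; rewrite e1; split=> //.
  + by move: le_t; clear; lia.
  + by clear; lia.
  + by move=> x hx; apply: h1; move: hx lt; clear; lia.
Qed.

Lemma perm_del (Y Y' : nat -> nat) p len : (p < len)%N ->
  (forall x, (x < len.-1)%N -> Y' x = del p Y x) ->
  perm_eq (mkseq Y len) (Y p :: mkseq Y' len.-1).
Proof.
move=> hp eY.
have -> : mkseq Y len = seg Y 0 p ++ Y p :: seg Y p.+1 (len.-1 - p).
  rewrite -segS -[p in seg Y p _]add0n -seg_cat; congr seg; move: hp; clear; lia.
have -> : mkseq Y' len.-1 = seg Y 0 p ++ seg Y p.+1 (len.-1 - p).
  rewrite -[mkseq _ _]/(seg Y' 0 len.-1) -{1}[len.-1](subnKC (m := p)); last by move: hp; clear; lia.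
  rewrite seg_cat add0n; congr (_ ++ _).
    by apply: eq_seg => i hi; rewrite eY /del; [rewrite ifT //; move: hi; clear; lia | move: hi hp; clear; lia].
  rewrite /seg -[p.+1]add1n iotaDl -map_comp; apply/eq_in_map => i; rewrite mem_iota => hi.
  by rewrite eY /del /= ?ifF //; move: hi hp; clear; lia.
by rewrite -[Y p :: _ in X in perm_eq X _]cat1s perm_catCA.
Qed.

Lemma desc_del (x : nat -> rat) (Y Y' : nat -> nat) (sz : nat -> rat) p len : (p < len)%N ->
  (forall i, (i < len.-1)%N -> Y' i = del p Y i) -> desc len (sz \o Y) -> desc len.-1 (sz \o Y').
Proof.
move=> hp eY yd i j hij hj; rewrite /= !eY //; last by move: hij hj; clear; lia.
rewrite /del; case: ifP => h1; case: ifP => h2; apply: yd; move: h1 h2 hij hj; clear; lia.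
Qed.

(** * One placement of the small items *)

Definition c_caps : cmd :=
  i_j <~ NC 0 ;; While (NLe (V i_j +: NC 1) (V i_sp)) (QPut r_CAP (V i_j) Tcap ;; incr i_j) ;;
  i_i <~ NC 0 ;; While (NLe (V i_i +: NC 1) (V i_k))
    (QPut r_CAP (NA a_F (V i_i))
       (QMinus (QA r_CAP (NA a_F (V i_i))) (SZof (NA a_A (V i_m +: V i_i)))) ;;
     incr i_i).

(** Position [b] is deleted before [a]: as [a < b], position [a] stays valid. On failure [j] is set
    to [sp + 1], which ends the loop. *)
Definition c_specials : cmd :=
  i_j <~ NC 0 ;; i_ok <~ NC 1 ;;
  While (NLe (V i_j +: NC 1) (V i_sp))
    (c_scan ;;
     If (NLe (NC 1) (V i_ok))
       (NPut a_PA (V i_j) (NA a_Y (V i_a)) ;; NPut a_PB (V i_j) (NA a_Y (V i_b)) ;;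
        i_len <~ V i_h +: V i_h ;; c_delete i_b ;; c_delete i_a ;;
        i_h <~ V i_h -: NC 1 ;; incr i_j)
       (i_j <~ V i_sp +: NC 1)).

Definition c_rest : cmd :=
  i_i <~ NC 0 ;; While (NLe (V i_i +: NC 1) (V i_h))
    (If (QLe (QPlus (SZof (NA a_Y (V i_i)))
                    (SZof (NA a_Y (V i_h +: V i_h -: NC 1 -: V i_i)))) Tcap)
       (NPut a_PA (V i_sp +: V i_i) (NA a_Y (V i_i)) ;;
        NPut a_PB (V i_sp +: V i_i) (NA a_Y (V i_h +: V i_h -: NC 1 -: V i_i)) ;;
        incr i_i)
       (i_ok <~ NC 0 ;; i_i <~ V i_h +: NC 1)).

Section Search.
Variables (T : rat) (sz : nat -> rat) (A X : nat -> nat) (n m k : nat).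

Definition ctx (s : store) : Prop :=
  [/\ nats s i_n 0%N = n, nats s i_m 0%N = m & nats s i_k 0%N = k] /\
  [/\ rats s r_T 0%N = T, rats s r_SZ = sz, nats s a_A = A & nats s a_X = X].

Lemma ctx_frame c s s' : frame c s s' ->
  ~~ has (fun a => a \in modn_ c) [:: i_n; i_m; i_k; a_A; a_X] ->
  ~~ has (fun a => a \in modq c) [:: r_T; r_SZ] -> ctx s -> ctx s'.
Proof.
move=> [fn fq] /=; rewrite !orbF !negb_or => /and5P[h1 h2 h3 h4 h5] /andP[h6 h7].
by move=> [[e1 e2 e3] [e4 e5 e6 e7]]; split; split; rewrite ?fn ?fq.
Qed.

Lemma caps_spec s q : ctx s -> nats s i_sp 0%N = q ->
  wp c_caps s (fun t s' => (t <= q + k)%N /\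
    forall c, (c < q)%N -> rats s' r_CAP c = T - group sz A m (nats s a_F) c k).
Proof.
move=> [[e1 e2 e3] [e4 e5 e6 e7]] sq; rewrite /c_caps; wps; set F := nats s a_F.
apply: (wp_while (I := fun s1 => [/\ [/\ nats s1 i_sp 0%N = q, nats s1 i_m 0%N = m & nats s1 i_k 0%N = k],
    [/\ rats s1 r_T 0%N = T, rats s1 r_SZ = sz, nats s1 a_A = A & nats s1 a_F = F] &
    forall c, (c < nats s1 i_j 0%N)%N -> rats s1 r_CAP c = T])
  (F := fun s1 => (q - nats s1 i_j 0%N)%N)).
- by split.
- move=> s1 fr [[f1 f2 f3] [f4 f5 f6 f7] h] /=; rewrite f1 => lt; wps; split; last by move: lt; clear; lia.
  split=> //= c hc; case: eqP => [//|ne]; apply: h; move: hc ne; clear; lia.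
- move=> t s1 fr [[f1 f2 f3] [f4 f5 f6 f7] h] /=; rewrite f1 => lt le_t; wps.
  apply: (wp_while (I := fun s2 => [/\ [/\ nats s2 i_sp 0%N = q, nats s2 i_m 0%N = m & nats s2 i_k 0%N = k],
      [/\ rats s2 r_T 0%N = T, rats s2 r_SZ = sz, nats s2 a_A = A & nats s2 a_F = F],
      (nats s2 i_i 0%N <= k)%N &
      forall c, (c < q)%N -> rats s2 r_CAP c = T - group sz A m F c (nats s2 i_i 0%N)])
    (F := fun s2 => (k - nats s2 i_i 0%N)%N)).
  + split=> //= c hc; rewrite h; last by move: hc lt; clear; lia.
    by rewrite /group big_geq // subr0.
  + move=> s2 fr2 [[g1 g2 g3] [g4 g5 g6 g7] gi gh] /=; rewrite g3 => lt2; wps.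
    split; last by move: lt2; clear; lia.
    split=> //= c hc; rewrite g2 g5 g6 g7 /group addn1 big_nat_recr //=.
    rewrite [F _ == c]eq_sym; case: eqP => [ec|ne]; last by rewrite addr0 gh.
    by rewrite -ec gh // opprD addrA.
  + move=> t2 s2 fr2 [[g1 g2 g3] [g4 g5 g6 g7] gi gh] /=; rewrite g3 => lt2 le_t2.
    split; first by move: le_t le_t2; clear; lia.
    move=> c hc; rewrite gh //; congr (T - group _ _ _ _ _ _); move: lt2 gi; clear; lia.
Qed.

Lemma perm_nest (f : nat -> nat) h :
  perm_eq (mkseq f (2 * h)) (flatten [seq [:: f i; f (2 * h - 1 - i)%N] | i <- iota 0 h]).
Proof.
have -> : mkseq f (2 * h) = seg f 0 h ++ seg f h h.
  by rewrite -[h in seg f h h]add0n -seg_cat addnn -mul2n.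
have -> : seg f h h = [seq f (2 * h - 1 - i)%N | i <- rev (iota 0 h)].
  apply: (@eq_from_nth _ 0%N); first by rewrite !size_map size_rev !size_iota.
  rewrite size_map size_iota => i hi; rewrite !(nth_map 0%N) ?size_rev ?size_iota //.
  rewrite nth_rev ?size_iota // !nth_iota //; last by move: hi; clear; lia.
  by congr f; move: hi; clear; lia.
rewrite map_rev /seg; apply/permP => p; rewrite count_cat count_rev.
elim: (iota 0 h) => //= x r IH; move: IH; clear; lia.
Qed.

Lemma map_perm_cons2 (Y : nat -> nat) l a b R : perm_eq (mkseq Y l) [:: a, b & R] ->
  perm_eq (mkseq (sz \o Y) l) [:: sz a, sz b & map sz R].
Proof. by move=> /(perm_map sz); rewrite /mkseq -map_comp. Qed.

(** A failure refutes [gsol]. After a success the pairs found respect the capacities in any case,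
    and [gsol] yields Hall's condition for the rest. A bin costs one scan and two deletions of at
    most [2 N] each, and one iteration, whence [6 N + 1]. *)
Lemma specials_spec s q N Y0 : ctx s -> nats s i_sp 0%N = q -> nats s i_h 0%N = N -> (q <= N)%N ->
  nats s a_Y = Y0 -> desc (2 * N) (sz \o Y0) ->
  wp c_specials s (fun t s' => [/\ (t <= q * (6 * N + 1))%N, ctx s',
    nats s' i_sp 0%N = q, nats s' i_bins = nats s i_bins &
   let cs := mkseq (rats s r_CAP) q in
   let M0 := mkseq (sz \o Y0) (2 * N) in
   (nats s' i_ok 0%N = 0%N /\ ~ gsol T cs M0) \/
   (nats s' i_ok 0%N = 1%N /\ [/\ nats s' i_h 0%N = (N - q)%N,
     desc (2 * (N - q)) (sz \o nats s' a_Y),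
     perm_eq (mkseq Y0 (2 * N)) (flatten [seq [:: nats s' a_PA c; nats s' a_PB c] | c <- iota 0 q]
        ++ mkseq (nats s' a_Y) (2 * (N - q))),
     forall c, (c < q)%N -> sz (nats s' a_PA c) + sz (nats s' a_PB c) <= rats s r_CAP c &
     gsol T cs M0 -> fits T (mkseq (sz \o nats s' a_Y) (2 * (N - q)))])]).
Proof.
move=> cx sq sN le_q sY yd; rewrite /c_specials.
set CAP := rats s r_CAP; set cs := mkseq CAP q; set M0 := mkseq (sz \o Y0) (2 * N).
pose pairs (s1 : store) j := flatten [seq [:: nats s1 a_PA c; nats s1 a_PB c] | c <- iota 0 j].
pose I (s1 : store) := [/\ ctx s1, nats s1 i_sp 0%N = q, nats s1 i_bins = nats s i_bins,
  rats s1 r_CAP = CAP &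
  (nats s1 i_ok 0%N = 0%N /\ nats s1 i_j 0%N = q.+1 /\ ~ gsol T cs M0) \/
  exists j, [/\ (j <= q)%N /\ nats s1 i_ok 0%N = 1%N, nats s1 i_j 0%N = j /\ nats s1 i_h 0%N = (N - j)%N,
    desc (2 * (N - j)) (sz \o nats s1 a_Y),
    perm_eq (mkseq Y0 (2 * N)) (pairs s1 j ++ mkseq (nats s1 a_Y) (2 * (N - j))) &
    (forall c, (c < j)%N -> sz (nats s1 a_PA c) + sz (nats s1 a_PB c) <= CAP c) /\
    (gsol T cs M0 -> gsol T (drop j cs) (mkseq (sz \o nats s1 a_Y) (2 * (N - j))))]].
wps.
apply: (wp_while (I := I) (F := fun s1 => ((q - nats s1 i_j 0%N) * (6 * N + 1))%N)).
- split=> //=; right; exists 0%N; rewrite subn0 drop0 sY; split=> //.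
- move=> s1 fr [cx1 e1 e2 e3 [[_ [ej _]]|[j [[le_j eok] [ej eh] yd1 pm [hc hg]]]]] /=.
    by rewrite e1 ej => lt; exfalso; move: lt; clear; lia.
  rewrite e1 ej => lt; have {}lt : (j < q)%N by move: lt; clear; lia.
  have h0 : (0 < N - j)%N by move: lt le_q; clear; lia.
  have [[c1 c2 c3] [c4 c5 c6 c7]] := cx1.
  set h := (N - j)%N in eh yd1 pm hg h0.
  set Y := nats s1 a_Y in yd1 pm hg.
  have esz i : (i < 2 * h)%N -> rats s1 r_SZ (nats s1 a_Y i) = (sz \o Y) i by rewrite c5.
  have drE : drop j cs = CAP j :: drop j.+1 cs.
    by rewrite (drop_nth 0) ?size_mkseq // nth_mkseq.
  rewrite drE in hg.
  apply: wp_seq; apply: wp_mono (scan_spec eh ej h0 (erefl _) c4 esz yd1) _.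
  rewrite e3 => t2 s2 fr2 [le_t2 post]; have cx2 := ctx_frame fr2 isT isT cx1.
  have [fn2 fq2] := fr2.
  have [Y2 PA2 PB2] : [/\ nats s2 a_Y = Y, nats s2 a_PA = nats s1 a_PA & nats s2 a_PB = nats s1 a_PB].
    by split; rewrite fn2.
  have [h2 j2 sp2] : [/\ nats s2 i_h 0%N = h, nats s2 i_j 0%N = j & nats s2 i_sp 0%N = q].
    by split; rewrite fn2.
  apply: wp_if => /=; last first.
    case: post => [[-> _]|[ok0 nc]] // _; wps; rewrite sp2 ?h2; split; last by move: le_t2 lt; rewrite /h; clear; nia.
    split=> //=; [by rewrite fn2 | by rewrite fq2 |].
    left; split=> //; split; first by rewrite addn1.
    by move=> /hg /= [_ [a [b [M' cd]]] _]; apply: nc cd.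
  case: post => [[ok1 [a [b [hab ea eb le_c gr]]]]|[->]] // _.
  have hb : (b < 2 * h)%N by case/andP: hab.
  have ha : (a < (2 * h).-1)%N by move: hab; clear; lia.
  wps; rewrite Y2 ea eb h2 j2.
  match goal with |- wp _ ?s0 _ => set s3 := s0 end.
  have b3 : nats s3 i_b 0%N = b by rewrite /s3 /= eb.
  have l3 : nats s3 i_len 0%N = (2 * h)%N by rewrite /s3 /= addnn -mul2n.
  apply: wp_mono (delete_spec (v := i_b) isT b3 l3 hb) _ => t4 s4 [fn4 fq4] [le_t4 l4 y4].
  apply: wp_seq.
  have a4 : nats s4 i_a 0%N = a by rewrite fn4.
  apply: wp_mono (delete_spec (v := i_a) isT a4 l4 ha) _ => t5 s5 [fn5 fq5] [le_t5 l5 y5].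
  have Y3 : nats s3 a_Y = Y by rewrite /s3 /= Y2.
  rewrite Y3 in y4.
  have h5 : nats s5 i_h 0%N = h by rewrite fn5 // fn4.
  have j5 : nats s5 i_j 0%N = j by rewrite fn5 // fn4.
  have PA5 c : nats s5 a_PA c = if c == j then Y a else nats s1 a_PA c.
    by rewrite fn5 // fn4 // /s3 /= PA2.
  have PB5 c : nats s5 a_PB c = if c == j then Y b else nats s1 a_PB c.
    by rewrite fn5 // fn4 // /s3 /= PB2.
  have cx5 : ctx s5.
    have [[d1 d2 d3] [d4 d5 d6 d7]] := cx2.
    by split; split; rewrite ?fn5 ?fq5 // ?fn4 ?fq4.
  set Y5 := nats s5 a_Y.
  have e22 : (2 * h).-1.-1 = (2 * (N - j.+1))%N by rewrite /h; clear; lia.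
  have pY : perm_eq (mkseq Y (2 * h)) [:: Y a, Y b & mkseq Y5 (2 * (N - j.+1))].
    apply: perm_trans (perm_del hb y4) _; rewrite -e22.
    have p2 := perm_del ha y5.
    have Y4a : nats s4 a_Y a = Y a by rewrite y4 // /del ifT //; case/andP: hab.
    rewrite Y4a in p2.
    have -> : [:: Y a, Y b & mkseq Y5 (2 * h).-1.-1] = [:: Y a] ++ [:: Y b] ++ mkseq Y5 (2 * h).-1.-1 by [].
    by rewrite perm_sym perm_catCA /= perm_cons perm_sym.
  wps; rewrite h5 j5; split; last by move: le_t2 le_t4 le_t5 lt; rewrite /h; clear; nia.
  split=> //=.
  + by rewrite fn5 // fn4.
  + by rewrite fn5 // fn4 // /s3 /= fn2.
  + by rewrite fq5 // fq4 // /s3 /= fq2.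
  right; exists j.+1; split.
  + by split=> //=; rewrite fn5 // fn4 // /s3 /=.
  + by rewrite /= addn1 /h; split=> //; clear; lia.
  + rewrite -e22; have y4d := desc_del (sz \o Y) hb y4 yd1.
    exact: (desc_del (sz \o Y) ha y5 y4d).
  + have prE : pairs s5 j = pairs s1 j.
      rewrite /pairs; congr flatten; apply/eq_in_map => c; rewrite mem_iota => hcj.
      have ncj : (c == j) = false by move: hcj; clear; lia.
      by rewrite PA5 PB5 ncj.
    have prS : pairs s5 j.+1 = pairs s1 j ++ [:: Y a; Y b].
      rewrite -prE /pairs -[j.+1]addn1 iotaD map_cat flatten_cat add0n.
      by congr (_ ++ _); rewrite /= PA5 PB5 eqxx.
    suff : perm_eq (mkseq Y0 (2 * N)) (pairs s5 j.+1 ++ mkseq Y5 (2 * (N - j.+1))) by [].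
    by apply: perm_trans pm _; rewrite prS -catA perm_cat2l.
  + split=> [c|hgs] /=.
      rewrite PA5 PB5 ltnS leq_eqVlt => /orP[/eqP->|lt_c]; first by rewrite eqxx.
      have ncj : (c == j) = false by move: lt_c; clear; lia.
      by rewrite ncj hc.
    have /= [fM _ grd] := hg hgs.
    have pM := map_perm_cons2 pY.
    have := grd _ _ _ (gr fM _ pM).
    by rewrite /mkseq -map_comp.
- move=> t s1 fr [cx1 e1 e2 e3 dj] /=; rewrite e1 => lt le_t; split=> //.
    by move: le_t; rewrite subn0; apply: leq_trans; rewrite !add0n leq_addr.
  case: dj => [[ok [_ ng]]|[j [[le_j eok] [ej eh] yd1 pm [hc hg]]]]; first by left.
  have ejq : j = q by move: lt; rewrite ej; move: le_j; clear; lia.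
  rewrite ejq in eh yd1 pm hc hg; right; split=> //; split=> // /hg.
  by apply: gsol_fits.
Qed.

Lemma rest_spec s q h T0 : nats s i_sp 0%N = q -> nats s i_h 0%N = h -> nats s i_ok 0%N = 1%N ->
  rats s r_T 0%N = T0 -> rats s r_SZ = sz ->
  wp c_rest s (fun t s' => [/\ (t <= h)%N, forall c, (c < q)%N ->
     nats s' a_PA c = nats s a_PA c /\ nats s' a_PB c = nats s a_PB c &
   (nats s' i_ok 0%N = 0%N /\ ~ nested T0 h (sz \o nats s a_Y)) \/
   (nats s' i_ok 0%N = 1%N /\ nested T0 h (sz \o nats s a_Y) /\ forall c, (c < h)%N ->
     nats s' a_PA (q + c)%N = nats s a_Y c /\ nats s' a_PB (q + c)%N = nats s a_Y (2 * h - 1 - c)%N)]).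
Proof.
move=> sq sh sok sT sS; rewrite /c_rest; wps; set Y := nats s a_Y.
pose I (s1 : store) := [/\ [/\ nats s1 i_sp 0%N = q, nats s1 i_h 0%N = h & nats s1 a_Y = Y],
  rats s1 r_T 0%N = T0 /\ rats s1 r_SZ = sz,
  forall c, (c < q)%N -> nats s1 a_PA c = nats s a_PA c /\ nats s1 a_PB c = nats s a_PB c &
  (nats s1 i_ok 0%N = 0%N /\ nats s1 i_i 0%N = h.+1 /\ ~ nested T0 h (sz \o Y)) \/
  exists i, [/\ nats s1 i_ok 0%N = 1%N, nats s1 i_i 0%N = i, (i <= h)%N,
    (forall c, (c < i)%N -> sz (Y c) + sz (Y (2 * h - 1 - c)%N) <= T0) &
    forall c, (c < i)%N ->
     nats s1 a_PA (q + c)%N = Y c /\ nats s1 a_PB (q + c)%N = Y (2 * h - 1 - c)%N]].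
apply: (wp_while (I := I) (F := fun s1 => (h - nats s1 i_i 0%N)%N)).
- by split=> //=; right; exists 0%N.
- move=> s1 fr [[e1 e2 e3] [e4 e5] eP [[_ [ei _]]|[i [eok ei le_i hi hP]]]] /=.
    by rewrite e2 ei => lt; exfalso; move: lt; clear; lia.
  rewrite e2 ei => lt; have {}lt : (i < h)%N by move: lt; clear; lia.
  apply: wp_if => /=; rewrite e2 e3 e4 e5 ei addnn -mul2n => hT; wps.
    rewrite ei e1 e2 e3 addnn -mul2n; split; last by move: lt; clear; lia.
    split=> //=.
      move=> c hc; have ncq : (c == q + i)%N = false by move: hc; clear; lia.
      by rewrite ncq; apply: eP.
    right; exists i.+1; split=> //=; first by rewrite addn1.
      by move=> c; rewrite ltnS leq_eqVlt => /orP[/eqP->//|]; apply: hi.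
    move=> c; rewrite ltnS eqn_add2l leq_eqVlt; case: (c =P i) => [->//|_ /=]; exact: hP.
  rewrite ?ei e2; split; last by move: lt; clear; lia.
  split=> //=; left; split=> //; split; first by rewrite addn1.
  by move=> /(_ i lt); apply/negP.
- move=> t s1 fr [[e1 e2 e3] [e4 e5] eP dj] /=; rewrite e2 => lt le_t; split=> //.
    by move: le_t; clear; lia.
  case: dj => [[ok [_ nn]]|[i [eok ei le_i hi hP]]]; first by left.
  have eih : i = h by move: lt; rewrite ei; move: le_i; clear; lia.
  by rewrite eih in hi hP; right; split=> //; split=> // i' hi'; apply: hi.
Qed.
End Search.

(** * Enumerating placements and numbers of bins *)

(* The conjunction of the two loop tests is one test on truncated differences. *)
Definition c_inc : cmd :=
  i_i <~ NC 0 ;;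
  While (NLe ((V i_i +: NC 1 -: V i_k) +: (V i_sp -: (NA a_F (V i_i) +: NC 1))) (NC 0))
    (NPut a_F (V i_i) (NC 0) ;; incr i_i) ;;
  If (NLe (V i_i +: NC 1) (V i_k))
    (NPut a_F (V i_i) (NA a_F (V i_i) +: NC 1)) (i_more <~ NC 0).

Definition c_try : cmd :=
  i_i <~ NC 0 ;; While (NLe (V i_i +: NC 1) (V i_k)) (NPut a_F (V i_i) (NC 0) ;; incr i_i) ;;
  i_more <~ NC 1 ;;
  While (NLe (NC 1) (V i_more))
    (c_caps ;; c_copyY ;; c_specials ;;
     If (NLe (NC 1) (V i_ok)) c_rest Skip ;;
     If (NLe (NC 1) (V i_ok)) (i_found <~ NC 1 ;; i_more <~ NC 0) c_inc).

(** [k - (k - bins)] is [min (k, bins)], the number of special bins. *)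
Definition c_search : cmd :=
  i_found <~ NC 0 ;;
  While (NLe (V i_found) (NC 0))
    (i_sp <~ V i_k -: (V i_k -: V i_bins) ;; c_try ;;
     If (NLe (NC 1) (V i_found)) Skip (incr i_bins)).

(** Resetting the initial run of digits [q - 1] and raising the next digit adds one in base [q]; the
    run covers all digits only at the last number [q ^ k - 1]. *)
Lemma inc_spec s q k F : nats s i_sp 0%N = q -> nats s i_k 0%N = k -> nats s a_F = F ->
  (forall i, (i < k)%N -> (F i < q)%N) ->
  wp c_inc s (fun t s' => (t <= k)%N /\
    ((nats s' i_more 0%N = 0%N /\ (dval q k F).+1 = (q ^ k)%N) \/
     [/\ nats s' i_more = nats s i_more, dval q k (nats s' a_F) = (dval q k F).+1 &
      forall i, (i < k)%N -> (nats s' a_F i < q)%N])).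
Proof.
move=> sq sk sF F_lt; rewrite /c_inc; wps.
apply: (wp_while (I := fun s1 => [/\ nats s1 i_sp 0%N = q, nats s1 i_k 0%N = k,
    nats s1 i_more = nats s i_more & [/\ (nats s1 i_i 0%N <= k)%N,
    forall x, (x < nats s1 i_i 0%N)%N -> F x = q.-1 /\ nats s1 a_F x = 0%N &
    forall x, (nats s1 i_i 0%N <= x)%N -> nats s1 a_F x = F x]])
  (F := fun s1 => (k - nats s1 i_i 0%N)%N)).
- by split=> //=; split=> // x; rewrite sF.
- move=> s1 fr [e1 e2 e3 [e4 lo hi]] /=; rewrite e1 e2 (hi _ (leqnn _)) => lt.
  have lt_i : (nats s1 i_i 0%N < k)%N by move: lt; clear; lia.
  have Fq := F_lt _ lt_i.
  wps; split; last by move: lt_i; clear; lia.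
  split=> //=; split; first by move: lt_i; clear; lia.
    move=> x hx; case: eqP => [->|ne]; last by apply: lo; move: hx ne; clear; lia.
    by split=> //; move: lt Fq; clear; lia.
  move=> x hx; have nex : (x == nats s1 11 0)%N = false by move: hx; clear; lia.
  by rewrite nex hi //; move: hx; clear; lia.
- move=> t s1 fr [e1 e2 e3 [e4 lo hi]] /=; rewrite e1 e2 (hi _ (leqnn _)) => lt le_t.
  apply: wp_if => /=; rewrite e2 => lt_i; wps.
    split; first by move: le_t; clear; lia.
    have {}lt_i : (nats s1 i_i 0%N < k)%N by move: lt_i; clear; lia.
    have Fq := F_lt _ lt_i.
    right; split=> //.
      apply: (dval_carry (i := nats s1 i_i 0%N)) => //.
      + by move=> x hx; have nex : (x == nats s1 11 0)%N = false by [move: hx; clear; lia]; rewrite nex; apply: lo.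
      + by rewrite eqxx hi // addn1.
      + move=> x hx; have nex : (x == nats s1 11 0)%N = false by move: hx; clear; lia.
        by rewrite nex hi //; move: hx; clear; lia.
      + by move: Fq; clear; lia.
    move=> x hx; case: eqP => [ex|ne].
      by rewrite hi //; move: lt lt_i; clear; lia.
    have [lt_x|le_x] := ltnP x (nats s1 i_i 0%N); last by rewrite hi ?F_lt.
    by rewrite (proj2 (lo x lt_x)); move: Fq; clear; lia.
  split; first by move: le_t; clear; lia.
  left; split=> //; have ei : nats s1 i_i 0%N = k by move: e4 lt_i; clear; lia.
  case: (posnP k) => [->|k0] //; apply: dval_top; last by have := F_lt 0%N k0; clear; lia.
  by move=> x hx; have [] := lo x; rewrite ?ei.
Qed.

(** Capacities take [q + k], copying [2 N], the special bins [q * (6 N + 1)], pairing the rest [N],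
    the next placement [k], and the iteration itself 1. *)
Definition try_cost (k q N : nat) : nat := (q + 2 * k + 3 * N + q * (6 * N + 1)).+1.

Definition search_cost (k n : nat) : nat := (k + k ^ k * try_cost k k n).+1.

Section Enumerate.
Variables (inp : seq rat) (T : rat) (sz : nat -> rat) (A X : nat -> nat) (m : nat).
Let n := size inp.
Let k := (n - m)%N.
Let lids := large_ids inp A m.
Hypothesis T0 : 0 <= T.
Hypothesis s_bound : forall j, (j < n)%N -> 0 <= inp`_j <= T.
Hypothesis sz_s : forall j, (j < n)%N -> sz j = inp`_j.
Hypothesis sz_n : sz n = 0.
Hypothesis A_perm : perm_eq (mkseq A n) (iota 0 n).
Hypothesis A_desc : desc n (sz \o A).
Hypothesis m_le : (m <= n)%N.
Hypothesis m_incomp : (2 < m)%N ->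
  T < sz (A (m - 1)%N) + sz (A (m - 2)%N) + sz (A (m - 3)%N).
Hypothesis X_E : forall i, (i < 2 * n)%N -> X i = lids i.

Let cx := ctx T sz A X n m k.

Definition good (f : nat -> nat) (q N : nat) : Prop :=
  gsol T (caps inp T sz A m f q) (mkseq (sz \o lids) (2 * N)).

Lemma good_ext f g q N : (forall i, (i < k)%N -> f i = g i) -> good f q N -> good g q N.
Proof.
move=> e; rewrite /good; suff -> : caps inp T sz A m f q = caps inp T sz A m g q by [].
apply/eq_in_map => c _; congr (T - _); rewrite /group big_seq [RHS]big_seq.
by apply: eq_bigr => x; rewrite mem_index_iota => /andP[_ hx]; rewrite e.
Qed.

Definition packed (s : store) (q N : nat) : Prop :=
  [/\ forall i, (i < k)%N -> (nats s a_F i < q)%N,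
   perm_eq (mkseq lids (2 * N)) (flatten [seq [:: nats s a_PA c; nats s a_PB c] | c <- iota 0 N]) &
   forall c, (c < N)%N -> sz (nats s a_PA c) + sz (nats s a_PB c) <=
      T - (if (c < q)%N then group sz A m (nats s a_F) c k else 0)].

Lemma round_spec s q N : cx s -> nats s i_sp 0%N = q -> nats s i_bins 0%N = N ->
  (q <= N)%N -> (N <= n)%N -> (forall i, (i < k)%N -> (nats s a_F i < q)%N) ->
  nats s i_more 0%N = 1%N -> nats s i_found 0%N = 0%N ->
  wp (c_caps ;; c_copyY ;; c_specials ;;
     If (NLe (NC 1) (V i_ok)) c_rest Skip ;;
     If (NLe (NC 1) (V i_ok)) (i_found <~ NC 1 ;; i_more <~ NC 0) c_inc) s
   (fun t s' => [/\ (t < try_cost k q N)%N, cx s', nats s' i_sp 0%N = q, nats s' i_bins 0%N = N &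
     [\/ [/\ nats s' i_more 0%N = 0%N, nats s' i_found 0%N = 1%N & packed s' q N],
        ~ good (nats s a_F) q N /\ [/\ nats s' i_more 0%N = 0%N, nats s' i_found 0%N = 0%N &
          (dval q k (nats s a_F)).+1 = (q ^ k)%N] |
        ~ good (nats s a_F) q N /\ [/\ nats s' i_more 0%N = 1%N, nats s' i_found 0%N = 0%N,
          dval q k (nats s' a_F) = (dval q k (nats s a_F)).+1 &
          forall i, (i < k)%N -> (nats s' a_F i < q)%N]]]).
Proof.
move=> cxs sq sN le_q le_N F_lt smore sfound; set F := nats s a_F.
apply: wp_seq; apply: wp_mono (caps_spec cxs sq) _ => t1 s1 fr1 [le_t1 cp1].
have cx1 := ctx_frame fr1 isT isT cxs; have [fn1 fq1] := fr1.
have N1 : nats s1 i_bins 0%N = N by rewrite fn1.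
apply: wp_seq; apply: wp_mono (copyY_spec N1) _ => t2 s2 fr2 [le_t2 h2 Y2].
have cx2 := ctx_frame fr2 isT isT cx1; have [fn2 fq2] := fr2.
have q2 : nats s2 i_sp 0%N = q by rewrite fn2 // fn1.
have X2 i : (i < 2 * N)%N -> nats s2 a_Y i = lids i.
  move=> hi; rewrite Y2 //; have [_ [_ _ _ ->]] := cx1; apply: X_E.
  by move: hi le_N; clear; lia.
have M2 : mkseq (sz \o nats s2 a_Y) (2 * N) = mkseq (sz \o lids) (2 * N).
  by apply/eq_in_map => i; rewrite mem_iota => /andP[_ hi] /=; rewrite X2.
have xd L : desc L (sz \o lids) := xs_desc T0 s_bound sz_s sz_n A_perm A_desc m_le (L:=L).
have yd : desc (2 * N) (sz \o nats s2 a_Y).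
  by move=> i j hij hj; rewrite /= !X2 //; [apply: (xd (2 * N)%N) | apply: leq_ltn_trans hj].
apply: wp_seq; apply: wp_mono (specials_spec cx2 q2 h2 le_q (erefl _) yd) _.
move=> t3 s3 fr3 [le_t3 cx3 q3 b3] /=; have [fn3 fq3] := fr3.
have CAP2 : mkseq (rats s2 r_CAP) q = caps inp T sz A m F q.
  by apply/eq_in_map => c; rewrite mem_iota fq2 // => /andP[_ hc]; apply: cp1.
rewrite M2 CAP2 -/(good F q N) => post.
have N3 : nats s3 i_bins 0%N = N by rewrite b3 fn2.
have F3 : nats s3 a_F = F by rewrite fn3 // fn2 // fn1.
have more3 : nats s3 i_more 0%N = 1%N by rewrite fn3 // fn2 // fn1.
have found3 : nats s3 i_found 0%N = 0%N by rewrite fn3 // fn2 // fn1.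
have [[_ _ k3] _] := cx3.
pose last s5 t4 := wp (If (NLe (NC 1) (V i_ok)) (i_found <~ NC 1 ;; i_more <~ NC 0) c_inc) s5
   (fun t s' => [/\ (t1 + (t2 + (t3 + (t4 + t))) < try_cost k q N)%N, cx s', nats s' i_sp 0%N = q, nats s' i_bins 0%N = N &
     [\/ [/\ nats s' i_more 0%N = 0%N, nats s' i_found 0%N = 1%N & packed s' q N],
        ~ good (nats s a_F) q N /\ [/\ nats s' i_more 0%N = 0%N, nats s' i_found 0%N = 0%N &
          (dval q k (nats s a_F)).+1 = (q ^ k)%N] |
        ~ good (nats s a_F) q N /\ [/\ nats s' i_more 0%N = 1%N, nats s' i_found 0%N = 0%N,
          dval q k (nats s' a_F) = (dval q k (nats s a_F)).+1 &
          forall i, (i < k)%N -> (nats s' a_F i < q)%N]]]).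
(* The common end of a round that failed, whether at a special bin or at the remaining pairs. *)
have failed s4 t4 : cx s4 -> nats s4 i_sp 0%N = q -> nats s4 i_bins 0%N = N -> nats s4 a_F = F ->
    nats s4 i_more 0%N = 1%N -> nats s4 i_found 0%N = 0%N -> nats s4 i_ok 0%N = 0%N ->
    (t4 <= N)%N -> ~ good F q N -> last s4 t4.
  move=> cx4 q4 N4 F4 more4 found4 ok4 le_t4 ng; apply: wp_if => /=; rewrite ok4 // => _.
  have [[_ _ k4] _] := cx4.
  apply: wp_mono (inc_spec q4 k4 F4 F_lt) _ => t5 s5 fr5 [le_t5 post5].
  have [fn5 fq5] := fr5.
  have [q5 N5] : nats s5 i_sp 0%N = q /\ nats s5 i_bins 0%N = N by split; rewrite fn5.
  split=> //.
  + by rewrite /try_cost; move: le_t1 le_t2 le_t3 le_t4 le_t5; clear; lia.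
  + exact: (ctx_frame fr5 isT isT cx4).
  have found5 : nats s5 i_found 0%N = 0%N by rewrite fn5.
  case: post5 => [[m0 e0]|[e1 e2 e3]]; first by apply: Or32; split=> //; split=> //.
  by apply: Or33; split=> //; split=> //; rewrite e1.
apply: wp_seq; apply: wp_if => /=; last first.
  case: post => [[ok3 ng]|[-> //]] _; apply: wp_skip.
  exact: failed.
case: post => [[-> //]|[ok3 [h3 yd3 pm3 hc3 fit3]]] _.
have [_ [T3 SZ3 A3 _]] := cx3.
apply: wp_mono (rest_spec q3 h3 ok3 T3 SZ3) _ => t4 s4 fr4 [le_t4 keep post4].
have cx4 := ctx_frame fr4 isT isT cx3; have [fn4 fq4] := fr4.
have le_t4N : (t4 <= N)%N by apply: leq_trans le_t4 (leq_subr _ _).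
case: post4 => [[ok4 nn]|[ok4 [nst pr4]]].
  (* For a good placement the rest would satisfy Hall's condition, and no nested pair could fail. *)
  apply: failed => //; rewrite ?fn4 // => gd; apply: nn.
  by apply: fits_nested yd3 _; apply: fit3.
apply: wp_if => /=; rewrite ok4 // => _; wps; split=> //=.
- by rewrite /try_cost; move: le_t1 le_t2 le_t3 le_t4N; clear; lia.
- by rewrite fn4.
- by rewrite fn4.
apply: Or31; split=> //; split=> /=.
- by rewrite fn4 // F3.
- have -> : mkseq lids (2 * N) = mkseq (nats s2 a_Y) (2 * N).
    by apply/eq_in_map => i; rewrite mem_iota => /andP[_ hi]; rewrite X2.
  apply: perm_trans pm3 _.
  have -> : iota 0 N = iota 0 q ++ [seq (q + c)%N | c <- iota 0 (N - q)].
    by rewrite -iotaDl addn0 -{1}(subnKC le_q) iotaD.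
  rewrite map_cat flatten_cat.
  rewrite (_ : [seq [:: nats s4 a_PA c; nats s4 a_PB c] | c <- iota 0 q] =
     [seq [:: nats s3 a_PA c; nats s3 a_PB c] | c <- iota 0 q]); last first.
    by apply/eq_in_map => c; rewrite mem_iota => /andP[_ hc]; have [-> ->] := keep c hc.
  rewrite perm_cat2l -map_comp.
  rewrite (_ : [seq _ | c <- iota 0 (N - q)] = [seq [:: nats s3 a_Y c; nats s3 a_Y (2 * (N - q) - 1 - c)%N] | c <- iota 0 (N - q)]); last first.
    by apply/eq_in_map => c; rewrite mem_iota => /andP[_ hc] /=; have [-> ->] := pr4 c hc.
  exact: perm_nest.
- have F4 : nats s4 a_F = F by rewrite fn4.
  move=> c hc; rewrite F4; case: ltnP => hcq.
    have [-> ->] := keep c hcq; apply: le_trans (hc3 c hcq) _.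
    by rewrite fq2 // cp1.
  rewrite subr0; have hcN : (c - q < N - q)%N by move: hc hcq; clear; lia.
  have [] := pr4 (c - q)%N hcN; rewrite subnKC // => -> ->.
  exact: nst.
Qed.
Definition valid_assignment (f : nat -> nat) (q : nat) : Prop := forall i, (i < k)%N -> (f i < q)%N.

Lemma try_spec s q N : cx s -> nats s i_sp 0%N = q -> nats s i_bins 0%N = N ->
  (q <= N)%N -> (N <= n)%N -> ((0 < k)%N -> (0 < q)%N) -> nats s i_found 0%N = 0%N ->
  wp c_try s (fun t s' => [/\ (t <= k + q ^ k * try_cost k q N)%N, cx s',
    nats s' i_sp 0%N = q, nats s' i_bins 0%N = N &
    (nats s' i_found 0%N = 0%N /\ forall f, valid_assignment f q -> ~ good f q N) \/
    (nats s' i_found 0%N = 1%N /\ packed s' q N)]).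
Proof.
move=> cxs sq sN le_q le_N q0 sfound; rewrite /c_try; wps.
have [[c1 c2 c3] [c4 c5 c6 c7]] := cxs.
apply: (wp_while (I := fun s1 => [/\ nats s1 i_k 0%N = k, (nats s1 i_i 0%N <= k)%N &
    forall x, (x < nats s1 i_i 0%N)%N -> nats s1 a_F x = 0%N])
  (F := fun s1 => (k - nats s1 i_i 0%N)%N)).
- by split.
- move=> s1 fr [e1 e2 e3] /=; rewrite e1 => lt; wps; split; last by move: lt; clear; lia.
  split=> //=.
  by move=> x hx; case: eqP => // ne; apply: e3; move: hx ne; clear; lia.
move=> t1 s1 [fn1 fq1] [e1 e2 e3] /=; rewrite e1 => le_i le_t1.
have {e3}F0 x : (x < k)%N -> nats s1 a_F x = 0%N.
  by move=> hx; apply: e3; move: le_i hx; clear; lia.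
have cx1 : cx s1 by split; split; rewrite ?fn1 ?fq1.
have [q1 N1 found1] : [/\ nats s1 i_sp 0%N = q, nats s1 i_bins 0%N = N & nats s1 i_found 0%N = 0%N].
  by split; rewrite fn1.
wps; have [[d1 d2 d3] [d4 d5 d6 d7]] := cx1.
pose I (s2 : store) := [/\ cx s2, nats s2 i_sp 0%N = q, nats s2 i_bins 0%N = N &
  [\/ [/\ nats s2 i_more 0%N = 1%N, nats s2 i_found 0%N = 0%N, valid_assignment (nats s2 a_F) q &
        forall f, valid_assignment f q -> (dval q k f < dval q k (nats s2 a_F))%N -> ~ good f q N],
     [/\ nats s2 i_more 0%N = 0%N, nats s2 i_found 0%N = 0%N & forall f, valid_assignment f q -> ~ good f q N] |
     [/\ nats s2 i_more 0%N = 0%N, nats s2 i_found 0%N = 1%N & packed s2 q N]]].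
(* The placements left times the cost of one, multiplied by the loop flag so that nothing remains to
   be paid once it is cleared. *)
apply: (wp_while (I := I) (F := fun s2 =>
  (nats s2 i_more 0%N * ((q ^ k - dval q k (nats s2 a_F)) * try_cost k q N))%N)).
- split=> //; apply: Or31; split=> //=.
    by move=> x hx; rewrite F0 // q0 //; move: hx; clear; lia.
  by move=> f _; rewrite [dval q k (nats s1 _)]dval_zero.
- move=> s2 _ [cx2 q2 N2 [[m2 f2 v2 h2]|[m2 _ _]|[m2 _ _]]] /=; rewrite m2 // => _.
  apply: wp_mono (round_spec cx2 q2 N2 le_q le_N v2 m2 f2) _ => t s3 _ [le_t cx3 q3 N3 post].
  have lt2 := dval_lt v2; set D := dval q k (nats s2 a_F) in lt2 h2 post *.
  case: post => [[m3 f3 pk]|[ng [m3 f3 eD]]|[ng [m3 f3 eD v3]]].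
  + split; first by split=> //; apply: Or33.
    rewrite m3 mul0n addn0 mul1n; apply: (leq_trans le_t).
    by rewrite -[X in (X <= _)%N]mul1n leq_mul2r subn_gt0 lt2 orbT.
  + split.
      split=> //; apply: Or32; split=> // f vf; have := dval_lt vf.
      rewrite -eD ltnS leq_eqVlt => /orP[/eqP e|]; last exact: h2.
      by move=> /(good_ext (dval_inj vf v2 e)).
    rewrite m3 mul0n addn0 mul1n; apply: (leq_trans le_t).
    by rewrite -[X in (X <= _)%N]mul1n leq_mul2r subn_gt0 lt2 orbT.
  + split.
      split=> //; apply: Or31; split=> // f vf.
      rewrite eD ltnS leq_eqVlt => /orP[/eqP e|]; last exact: h2.
      by move=> /(good_ext (dval_inj vf v2 e)).
    rewrite m3 eD !mul1n; have -> : (q ^ k - D = (q ^ k - D.+1).+1)%N by move: lt2; clear; lia.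
    by rewrite mulSn ltn_add2r.
move=> t2 s2 _ [cx2 q2 N2 post] /= lt le_t2; split=> //.
  rewrite add0n; apply: leq_add; first by move: le_t1; clear; lia.
  move: le_t2; rewrite mul1n => le_t2; apply: leq_trans (leq_addr _ _) (leq_trans le_t2 _).
  by rewrite leq_mul2r leq_subr orbT.
case: post => [[m2 _ _]|[_ f2 h2]|[_ f2 h2]]; first by rewrite m2 in lt.
  by left.
by right.
Qed.

(** Optimality: fewer than [N0] bins cannot even hold the large items, and from [N0] up to the
    result every placement has failed, whereas a packing would yield a good one by [complete_sol]
    and [reorder_sol]. *)
Lemma search_spec s N0 : cx s -> nats s i_bins 0%N = N0 -> (N0 <= m)%N -> ((0 < k)%N -> (0 < m)%N) ->
  (m <= 2 * N0)%N /\ nested T N0 (sz \o lids) ->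
  (forall N', (N' < N0)%N -> ~ ((m <= 2 * N')%N /\ nested T N' (sz \o lids))) ->
  wp c_search s (fun t s' => [/\ (t <= k.+1 * search_cost k n)%N, cx s' & exists N,
    [/\ nats s' i_bins 0%N = N, (m <= 2 * N)%N /\ (N <= n)%N, packed s' (minn k N) N &
     forall m' b', (forall j, (j < n)%N -> (b' j < m')%N) -> feasible_assignment inp T b' ->
       (N <= m')%N]]).
Proof.
move=> cxs sN le_N0 m0 [le_m nst] low; rewrite /c_search; wps.
have [[c1 c2 c3] [c4 c5 c6 c7]] := cxs.
pose I (s1 : store) := cx s1 /\ exists N, [/\ nats s1 i_bins 0%N = N, (N0 <= N <= N0 + k)%N,
  forall N' f, (N0 <= N' < N)%N -> valid_assignment f (minn k N') -> ~ good f (minn k N') N' &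
  nats s1 i_found 0%N = 0%N \/ nats s1 i_found 0%N = 1%N /\ packed s1 (minn k N) N].
apply: (wp_while (I := I) (F := fun s1 =>
  ((1 - nats s1 i_found 0%N) * ((N0 + k.+1 - nats s1 i_bins 0%N) * search_cost k n))%N)).
- split; first by split; split.
  exists N0; split=> //=; [by rewrite leqnn leq_addr | by move=> N' f; case: leqP | by left].
- move=> s1 _ [cx1 [N [N1 hN no [f1|[f1 _]]]]] /=; rewrite f1 // => _; wps; rewrite N1.
  have [[d1 d2 d3] [d4 d5 d6 d7]] := cx1; rewrite d3.
  have -> : (k - (k - N))%N = minn k N by clear; lia.
  have le_Nn : (N <= n)%N by move: hN le_N0 m_le; rewrite /k; clear; lia.
  match goal with |- wp _ ?s0 _ => set s2 := s0 end.
  have cx2 : cx s2 by split; split.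
  have q0 : (0 < k)%N -> (0 < minn k N)%N.
    by move=> k0; have := m0 k0; move: k0 le_m hN; clear; lia.
  have le_cost : (k + minn k N ^ k * try_cost k (minn k N) N < search_cost k n)%N.
    rewrite /search_cost ltnS leq_add2l; apply: leq_mul.
      by case: (posnP k) => [-> //|k0]; rewrite leq_exp2r // geq_minl.
    rewrite /try_cost ltnS; have := geq_minl k N; move: le_Nn; clear => h1 h2.
    by apply: leq_add; [lia | apply: leq_mul; lia].
  apply: wp_mono (try_spec (q := minn k N) cx2 (erefl _) N1 (geq_minr _ _) le_Nn q0 f1) _.
  move=> t s3 _ [le_t cx3 q3 N3 post]; apply: wp_if => /=.
    case: post => [[-> //]|[f3 pk]] _; wps.
    split; first by split=> //; exists N; split=> //; right.
    rewrite f3 mul0n !addn0 mul1n.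
    apply: leq_trans (leq_ltn_trans le_t le_cost) _.
    by rewrite -[X in (X <= _)%N]mul1n leq_mul2r; apply/orP; right; move: hN; clear; lia.
  case: post => [[f3 ng]|[-> //]] _; wps.
  have [lt_N|ge_N] := ltnP N (N0 + k).
    split.
      split; first by have [[g1 g2 g3] [g4 g5 g6 g7]] := cx3; split; split.
      exists N.+1; split=> //=; [by rewrite N3 addn1 | by move: hN lt_N; clear; lia | | by left].
      move=> N' f hN'; have [->|ne] := eqVneq N' N; first exact: ng.
      by apply: no; move: hN' ne; clear; lia.
    rewrite f3 N3 !mul1n addn0.
    have -> : (N0 + k.+1 - N = (N0 + k.+1 - (N + 1)).+1)%N by move: hN; clear; lia.
    by rewrite mulSn ltn_add2r (leq_ltn_trans le_t le_cost).
  (* At [N0 + k] bins the singleton placement is good up to renumbering, so the attempt cannot have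
     failed. *)
  have eN : N = (N0 + k)%N by move: hN ge_N; clear; lia.
  have [f [vf sf]] := singleton_sol T0 s_bound sz_s sz_n A_perm A_desc m_le m_incomp le_m nst.
  have [g [vg gg]] := reorder_sol T0 s_bound sz_s sz_n A_perm m_le m_incomp vf sf.
  by case: (ng g); rewrite eN.
move=> t s1 _ [cx1 [N [N1 hN no [f1|[f1 pk]]]]] /=; rewrite f1 // => _ le_t; split=> //.
  rewrite add0n; apply: leq_trans (leq_addr _ _) (leq_trans le_t _).
  by rewrite sN mul1n leq_mul2r; apply/orP; right; clear; lia.
exists N; split=> //; first by move: le_m m_le le_N0 hN; rewrite /k; clear; lia.
move=> m' b' b_lt b_ok; rewrite leqNgt; apply/negP => lt_m'.
have [lt0|le0] := ltnP m' N0.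
  apply: (low _ lt0); split.
    exact: (complete_size T0 s_bound sz_s sz_n A_perm A_desc m_le m_incomp b_lt b_ok).
  apply: fits_nested; first exact: (xs_desc T0 s_bound sz_s sz_n A_perm A_desc m_le).
  exact: (complete_fits T0 s_bound sz_s sz_n A_perm A_desc m_le m_incomp b_lt b_ok).
have [f [vf sf]] := complete_sol T0 s_bound sz_s sz_n A_perm A_desc m_le m_incomp b_lt b_ok.
have [g [vg gg]] := reorder_sol T0 s_bound sz_s sz_n A_perm m_le m_incomp vf sf.
by apply: (no m' g) => //; rewrite le0.
Qed.
End Enumerate.

(** * The complete program *)

Definition c_out : cmd :=
  i_i <~ NC 0 ;; While (NLe (V i_i +: NC 1) (V i_bins))
    (NPut a_OUT (NA a_PA (V i_i)) (V i_i) ;; NPut a_OUT (NA a_PB (V i_i)) (V i_i) ;; incr i_i) ;;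
  i_i <~ NC 0 ;; While (NLe (V i_i +: NC 1) (V i_k))
    (NPut a_OUT (NA a_A (V i_m +: V i_i)) (NA a_F (V i_i)) ;; incr i_i).

(** An id satisfying [p] occurs only once in [ids], hence not in two pairs. The predicate serves to
    exclude the dummy, which is repeated. *)
Lemma pair_disjoint (ids PA PB : nat -> nat) (p : pred nat) L N :
  perm_eq (mkseq ids L) (flatten [seq [:: PA c; PB c] | c <- iota 0 N]) ->
  (forall i j, (i < L)%N -> (j < L)%N -> p (ids i) -> ids i = ids j -> i = j) ->
  forall c d x, (c < d)%N -> (d < N)%N -> p x -> x \in [:: PA c; PB c] -> x \notin [:: PA d; PB d].
Proof.
move=> pm inj c d x cd dN px xc; apply/negP => xd.
suff : (1 < count_mem x (mkseq ids L))%N.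
  have [i hi ix] : exists2 i, (i < L)%N & ids i = x.
    have : x \in mkseq ids L.
      rewrite (perm_mem pm); apply/flatten_mapP; exists d => //.
      by rewrite mem_iota add0n.
    by case/mapP => i; rewrite mem_iota => /andP[_ hi] ->; exists i.
  rewrite /mkseq count_map (eq_in_count (a2 := pred1 i)).
    by rewrite count_uniq_mem ?iota_uniq //; case: (_ \in _).
  move=> j; rewrite mem_iota => /andP[_ hj] /=; apply/eqP/eqP => [e|-> //].
  by symmetry; apply: inj => //; rewrite ix.
rewrite (permP pm).
have -> : iota 0 N = iota 0 d ++ d :: iota d.+1 (N - d.+1).
  by rewrite -{1}(subnKC dN) addSnnS iotaD add0n.
rewrite map_cat flatten_cat (count_cat (pred1 x)) map_cons /= !addnA.
have h1 : (0 < count_mem x (flatten [seq [:: PA e; PB e] | e <- iota 0 d]))%N.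
  by rewrite -has_count has_pred1; apply/flatten_mapP; exists c; rewrite // mem_iota.
have h2 : (0 < (PA d == x) + (PB d == x))%N.
  by move: xd; rewrite !inE ![x == _]eq_sym; do 2!case: (_ == _).
by apply: (leq_trans (leq_add h1 h2)); rewrite addnA leq_addr.
Qed.

Section Output.
Variables (T : rat) (sz : nat -> rat) (inp : seq rat) (A X : nat -> nat) (m : nat).
Let n := size inp.
Let k := (n - m)%N.
Hypothesis A_perm : perm_eq (mkseq A n) (iota 0 n).
Hypothesis m_le : (m <= n)%N.
Let lids := large_ids inp A m.

Lemma ids_inj i j : (i < n)%N -> (j < n)%N -> A i = A j -> i = j.
Proof.
have := perm_uniq A_perm; rewrite iota_uniq => un hi hj e.
have := nth_uniq 0%N (s := mkseq A n); rewrite size_mkseq => /(_ _ _ hi hj un).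
by rewrite !nth_mkseq // e eqxx => /esym/eqP.
Qed.

Lemma out_spec s N : ctx T sz A X n m k s -> nats s i_bins 0%N = N -> (m <= 2 * N)%N ->
  perm_eq (mkseq lids (2 * N)) (flatten [seq [:: nats s a_PA c; nats s a_PB c] | c <- iota 0 N]) ->
  wp c_out s (fun t s' => [/\ (t <= N + k)%N,
    forall c, (c < N)%N ->
      ((nats s a_PA c < n)%N -> nats s' a_OUT (nats s a_PA c) = c) /\
      ((nats s a_PB c < n)%N -> nats s' a_OUT (nats s a_PB c) = c) &
    forall i, (i < k)%N -> nats s' a_OUT (A (m + i)%N) = nats s a_F i]).
Proof.
move=> [[c1 c2 c3] [c4 c5 c6 c7]] sN le_m pm.
have inj i j : (i < 2 * N)%N -> (j < 2 * N)%N -> (lids i < n)%N -> lids i = lids j -> i = j.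
  rewrite /lids /large_ids => _ _; case: (ltnP i m) => hi; case: (ltnP j m) => hj; rewrite ?ltnn //.
    by move=> _ e; apply: (ids_inj _ _ e); apply: leq_trans m_le.
  by move=> + e; rewrite e ltnn.
have dis := pair_disjoint (p := fun x => (x < n)%N) pm inj.
have in_large c x : (c < N)%N -> (x < n)%N -> x \in [:: nats s a_PA c; nats s a_PB c] ->
    exists2 p, (p < m)%N & x = A p.
  move=> hc hx xc; have : x \in mkseq lids (2 * N).
    by rewrite (perm_mem pm); apply/flatten_mapP; exists c; rewrite // mem_iota.
  case/mapP => p _; rewrite /lids /large_ids; case: ifP => [hp ->|_ e]; first by exists p.
  by rewrite e ltnn in hx.
move: dis in_large; set PA := nats s a_PA; set PB := nats s a_PB => dis in_large.
pose done1 (s1 : store) N1 := forall c, (c < N1)%N ->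
  ((PA c < n)%N -> nats s1 a_OUT (PA c) = c) /\ ((PB c < n)%N -> nats s1 a_OUT (PB c) = c).
rewrite /c_out; wps.
apply: (wp_while (I := fun s1 => [/\ nats s1 i_bins 0%N = N, nats s1 a_PA = PA, nats s1 a_PB = PB,
    (nats s1 i_i 0%N <= N)%N & done1 s1 (nats s1 i_i 0%N)])
  (F := fun s1 => (N - nats s1 i_i 0%N)%N)).
- by split.
- move=> s1 _ [e1 e2 e3 e4 e5] /=; rewrite e1 => lt; wps; rewrite e2 e3.
  set d := nats s1 i_i 0%N in lt e4 e5 *; have {}lt : (d < N)%N by move: lt; clear; lia.
  split; last by move: lt; clear; lia.
  split=> //=; first by move: lt; clear; lia.
  move=> c; rewrite addn1 ltnS leq_eqVlt => /orP[/eqP->|hc] /=.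
    by rewrite eqxx; split=> // _; case: eqP.
  have [h1 h2] := e5 c hc; have disc := dis c d _ hc lt.
  split=> hx.
    have := disc _ hx; rewrite !inE eqxx => /(_ isT); rewrite negb_or => /andP[/negbTE-> /negbTE->].
    exact: h1.
  have := disc _ hx; rewrite !inE eqxx orbT => /(_ isT); rewrite negb_or => /andP[/negbTE-> /negbTE->].
  exact: h2.
move=> t1 s1 [fn1 fq1] [e1 e2 e3 e4 e5] /=; rewrite e1 => le_i le_t1; wps.
have {le_i}ei : nats s1 i_i 0%N = N by move: le_i e4; clear; lia.
rewrite ei in e5.
apply: (wp_while (I := fun s2 => [/\ nats s2 i_k 0%N = k, nats s2 i_m 0%N = m, nats s2 a_A = A,
    nats s2 a_F = nats s a_F & [/\ (nats s2 i_i 0%N <= k)%N, done1 s2 N &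
    forall i, (i < nats s2 i_i 0%N)%N -> nats s2 a_OUT (A (m + i)%N) = nats s a_F i]])
  (F := fun s2 => (k - nats s2 i_i 0%N)%N)).
- split; [by rewrite /= fn1 | by rewrite /= fn1 | by rewrite /= fn1 | by rewrite /= fn1 | by split].
- move=> s2 _ [f1 f2 f3 f4 [f5 f6 f7]] /=; rewrite f1 => lt; wps; rewrite f2 f3 f4.
  set d := nats s2 i_i 0%N in lt f5 f7 *; have {}lt : (d < k)%N by move: lt; clear; lia.
  have md : (m + d < n)%N by move: lt; rewrite /k; clear; lia.
  split; last by move: lt; clear; lia.
  split=> //=; split=> /=; first by move: lt; clear; lia.
    move=> c hc /=; have [h1 h2] := f6 c hc.
    have ne x : (x < n)%N -> x \in [:: PA c; PB c] -> (x == A (m + d)) = false.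
      move=> hx /(in_large c x hc hx) [p hp ->]; apply/negP => /eqP e.
      have := ids_inj (leq_trans hp m_le) md e; move: hp; clear; lia.
    by split=> hx; rewrite ne ?inE ?eqxx ?orbT //; [apply: h1 | apply: h2].
  move=> i hi; case: eqP => [e|ne].
    have mi : (m + i < n)%N by move: hi lt; rewrite /k; clear; lia.
    by have := ids_inj mi md e => /eqP; rewrite eqn_add2l => /eqP->.
  apply: f7; rewrite ltn_neqAle; apply/andP; split.
    by apply/eqP => e; apply: ne; rewrite e.
  by move: hi; clear; lia.
move=> t2 s2 _ [f1 f2 f3 f4 [f5 f6 f7]] /=; rewrite f1 => le_i le_t2; split.
- by move: le_t1 le_t2; clear; lia.
- exact: f6.
- by move=> i hi; apply: f7; move: le_i hi; clear; lia.
Qed.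
End Output.

(** If a padding id stood at a position [i < n], all entries from there on would be negative, which
    leaves only [i] places for [n] nonnegative ones. *)
Lemma perm_prefix (A : nat -> nat) (f : nat -> rat) n L : (n <= L)%N ->
  perm_eq (mkseq A L) (iota 0 L) -> desc L (f \o A) ->
  (forall j, (j < n)%N -> 0 <= f j) -> (forall j, (n <= j < L)%N -> f j < 0) ->
  perm_eq (mkseq A n) (iota 0 n).
Proof.
move=> le_nL pm ds f0 f1.
have A_lt i : (i < L)%N -> (A i < L)%N := perm_mkseq_lt pm (i:=i).
have lt i : (i < n)%N -> (A i < n)%N.
  move=> hi; rewrite ltnNge; apply/negP => le_i.
  have neg j : (i <= j < L)%N -> (n <= A j)%N.
    move=> /andP[hij hj]; rewrite leqNgt; apply/negP => /f0; apply/negP; rewrite -ltNge.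
    have := ds i j hij hj; rewrite /= => h; apply: (le_lt_trans h); apply: f1.
    by rewrite le_i A_lt //; apply: leq_trans le_nL.
  have := permP pm (fun x => (x < n)%N).
  have -> : count (fun x => (x < n)%N) (iota 0 L) = n.
    rewrite -(subnKC le_nL) iotaD count_cat.
    rewrite (eq_in_count (a2 := predT)) ?count_predT ?size_iota; last first.
      by move=> x; rewrite mem_iota => /andP[_ hx]; rewrite hx.
    rewrite (eq_in_count (a2 := pred0)) ?count_pred0 ?addn0 //.
    by move=> x; rewrite mem_iota => /andP[hx _]; rewrite ltnNge hx.
  have le_iL : (i <= L)%N by apply: leq_trans le_nL; apply: ltnW.
  rewrite /mkseq -{1}(subnKC le_iL) iotaD map_cat count_cat.
  rewrite [X in (_ + X)%N](_ : _ = 0%N).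
    rewrite addn0 => e; have := count_size (fun x => (x < n)%N) [seq A i | i <- iota 0 i].
    by rewrite e size_map size_iota leqNgt hi.
  rewrite count_map (eq_in_count (a2 := pred0)) ?count_pred0 // => x.
  rewrite mem_iota subnKC // => hx /=.
  by apply/negbTE; rewrite -leqNgt; apply: neg.
have uL : uniq (mkseq A L) by rewrite (perm_uniq pm) iota_uniq.
have un : uniq (mkseq A n).
  by move: uL; rewrite /mkseq -{1}(subnKC le_nL) iotaD map_cat cat_uniq => /andP[].
have [_ e] := uniq_min_size (s2 := iota 0 n) un ltac:(by move=> x /mapP[i]; rewrite !mem_iota => /andP[_ hi] ->; apply: lt)
  ltac:(by rewrite size_mkseq size_iota).
by apply: uniq_perm e => //; apply: iota_uniq.
Qed.

Definition c_prep : cmd := c_pow ;; c_ids ;; c_sort ;; c_mk ;; c_X ;; c_low.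

Lemma prep_spec (inp : seq rat) (T : rat) : 0 <= T ->
  (forall j, (j < size inp)%N -> 0 <= inp`_j <= T) -> (0 < size inp)%N ->
  let n := size inp in
  wp c_prep (start inp T) (fun t s' => (t <= 18 * (n * (trunc_log 2 n).+1))%N /\
   exists sz A X m N,
   [/\ [/\ forall j, (j < n)%N -> sz j = inp`_j, sz n = 0, perm_eq (mkseq A n) (iota 0 n) & desc n (sz \o A)],
    [/\ (m <= n)%N,
     (2 < m)%N -> T < sz (A (m - 1)%N) + sz (A (m - 2)%N) + sz (A (m - 3)%N) &
     (m < n)%N -> (1 < m)%N /\ sz (A m) + sz (A (m - 1)%N) + sz (A (m - 2)%N) <= T],
    ctx T sz A X n m (n - m) s' /\ (forall i, (i < 2 * n)%N -> X i = large_ids inp A m i),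
    [/\ nats s' i_bins 0%N = N, (N <= m)%N, (m <= 2 * N)%N & nested T N (sz \o large_ids inp A m)] &
    forall N', (N' < N)%N -> ~ ((m <= 2 * N')%N /\ nested T N' (sz \o large_ids inp A m))]).
Proof.
move=> T0 s_bound n0 n; rewrite /c_prep; set l := trunc_log 2 n.
apply: wp_seq; apply: wp_mono (pow_spec (s := start inp T) (n := n) (erefl _) n0) _ => t1 s1 [fn1 fq1] [e [L1 le_n le_L le_e le_t1]].
have n1 : nats s1 i_n 0%N = n by rewrite fn1.
apply: wp_seq; apply: wp_mono (ids_spec n1 L1) _ => t2 s2 [fn2 fq2] [le_t2 A2 S2 D2 T2].
have L2 : nats s2 i_L 0%N = (2 ^ e)%N by rewrite fn2.
apply: wp_seq; apply: wp_mono (sort_spec L2 A2) _ => t3 s3 [fn3 fq3] [le_t3 A3 d3].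
have S3 : rats s3 r_SZ = rats s2 r_SZ by rewrite fq3.
have n3 : nats s3 i_n 0%N = n by rewrite fn3 // fn2.
have T3 : rats s3 r_T 0%N = T by rewrite fq3 // T2 fq1.
set A := nats s3 a_A in A3 d3; set S := rats s2 r_SZ in S2 D2 S3 d3.
have SE j : (j < n)%N -> S j = inp`_j by move=> hj; rewrite S2 // fq1.
have pA : perm_eq (mkseq A n) (iota 0 n).
  apply: (perm_prefix le_n A3 d3).
    by move=> j hj; rewrite SE //; case/andP: (s_bound j hj).
  by move=> j hj; rewrite D2.
have A_lt i : (i < n)%N -> (A i < n)%N := perm_mkseq_lt pA (i:=i).
apply: wp_seq; apply: wp_mono (mk_spec n3 T3 (erefl _) S3) _ => t4 s4 [fn4 fq4].
rewrite -/A => -[m [le_t4 [m4 k4] le_m [inc mx] [Sn Si]]].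
have n4 : nats s4 i_n 0%N = n by rewrite fn4.
have A4 : nats s4 a_A = A by rewrite fn4.
have T4 : rats s4 r_T 0%N = T by rewrite fq4.
apply: wp_seq; apply: wp_mono (X_spec n4 m4) _ => t5 s5 [fn5 fq5] [le_t5 X5].
set sz := rats s4 r_SZ in Sn Si *.
have szS i : (i < n)%N -> sz i = S i by move=> hi; apply: Si => e'; rewrite e' ltnn in hi.
have szA i : (i < n)%N -> sz (A i) = S (A i) by move=> hi; apply/szS/A_lt.
have sz_s j : (j < n)%N -> sz j = inp`_j by move=> hj; rewrite szS // SE.
have A_desc : desc n (sz \o A).
  move=> i j hij hj /=; rewrite !szA //; last exact: leq_ltn_trans hj.
  by apply: (d3 i j) => //; apply: leq_trans le_n.
have X_E i : (i < 2 * n)%N -> nats s5 a_X i = large_ids inp A m i by move=> hi; rewrite X5 // A4.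
have m5 : nats s5 i_m 0%N = m by rewrite fn5.
have T5 : rats s5 r_T 0%N = T by rewrite fq5.
have S5 : rats s5 r_SZ = sz by rewrite fq5.
have xE i : (i < 2 * n)%N -> rats s5 r_SZ (nats s5 a_X i) = (sz \o large_ids inp A m) i.
  by move=> hi; rewrite S5 X_E.
have xd L : desc L (sz \o large_ids inp A m) := xs_desc T0 s_bound sz_s Sn pA A_desc le_m (L:=L).
have xb i : 0 <= (sz \o large_ids inp A m) i <= T := xs_bound T0 s_bound sz_s Sn pA le_m i.
have x0 i : (m <= i)%N -> (sz \o large_ids inp A m) i = 0.
  by rewrite /= /large_ids leqNgt => /negbTE->.
apply: wp_mono (low_spec m5 T5 le_m xE xd xb x0) _ => t6 s6 [fn6 fq6] [N [le_t6 N6 le_N [h6 h6'] low6]].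
split.
  (* The sort takes [4 * 2 ^ e * e] with [2 ^ e <= 2 n] and [e <= l + 1]. The other phases together
     take at most [9 n + 1 <= 10 n], which gives 18. *)
  have : (t3 <= 8 * (n * l.+1))%N.
    apply: (leq_trans le_t3); rewrite -!mulnA (_ : 8 = 4 * 2)%N // -mulnA leq_mul2l /=.
    by rewrite mulnA; apply: leq_mul.
  have : (n <= n * l.+1)%N by rewrite leq_pmulr.
  move: le_t1 le_t2 le_L le_t4 le_t5 le_t6 n0; rewrite -/n; clear; lia.
exists sz, A, (nats s5 a_X), m, N; split=> //.
- split=> // [h|h].
    by rewrite !szA ?inc //; move: h le_m; clear; lia.
  have [m1 hm] := mx h; split=> //.
  by rewrite !szA //; move: h m1; clear; lia.
- split=> //; split; split; rewrite ?fq6 ?fn6 //.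
  + by rewrite fn5 // fn4.
  + by rewrite fn5.
  + by rewrite fn5.
Qed.

Definition c_main : cmd := c_prep ;; c_search ;; c_out.

Lemma time_bound_le k k' n : (k' <= k)%N ->
  (k'`! ^ 2 * k'.+1 * 2 ^ k' * n.+1 <= k`! ^ 2 * k.+1 * 2 ^ k * n.+1)%N.
Proof.
move=> le_k; rewrite leq_pmul2r //; apply: leq_mul; last by rewrite leq_pexp2l.
apply: leq_mul => //; rewrite leq_sqr; have : (k'`! <= k`!)%N; last by [].
by apply: leq_fact.
Qed.

(** A placement costs at most [7 (k + 1) (n + 1)]; the remaining [k + 1] of [search_cost] is covered
    by one more such unit, which gives 8. *)
Lemma search_time k n : (k.+1 * search_cost k n <= 8 * (k`! ^ 2 * k.+1 * 2 ^ k * n.+1))%N.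
Proof.
apply: leq_trans (leq_mul (leqnn 8) (search_bound k n.+1)).
rewrite /search_cost; have h : (0 < k ^ k)%N by case: k => // k; rewrite expn_gt0.
have : (try_cost k k n <= 7 * (k.+1 * n.+1))%N by rewrite /try_cost; nia.
move: (k ^ k)%N h (try_cost k k n) => w h c hc.
rewrite (_ : 8 * _ = k.+1 * (w * (k.+1 * n.+1) + w * (7 * (k.+1 * n.+1))))%N; last by lia.
rewrite leq_pmul2l // -addSn; apply: leq_add; last by rewrite leq_mul2l hc orbT.
by apply: leq_trans (leq_pmull _ h); apply: leq_pmulr.
Qed.

Lemma main_spec (inp : seq rat) (T : rat) : 0 <= T ->
  (forall j, (j < size inp)%N -> 0 <= inp`_j <= T) -> (0 < size inp)%N ->
  let n := size inp in
  let k := num_small inp T in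
  wp c_main (start inp T) (fun t s' =>
   [/\ (t <= 28 * (k`! ^ 2 * k.+1 * 2 ^ k * n.+1 * (trunc_log 2 n).+1))%N,
    (forall j, (j < n)%N -> (nats s' a_OUT j < nats s' i_bins 0%N)%N),
    feasible_assignment inp T (nats s' a_OUT) &
    forall m' b', (forall j, (j < n)%N -> (b' j < m')%N) -> feasible_assignment inp T b' ->
      (nats s' i_bins 0%N <= m')%N]).
Proof.
move=> T0 s_bound n0 n k; set l := trunc_log 2 n; rewrite /c_main.
apply: wp_seq; apply: wp_mono (prep_spec T0 s_bound n0) _ => t1 s1 _.
rewrite -/n => -[le_t1 [sz [A [X [m [N0 [[sz_s sz_n A_perm A_desc] [m_le inc mx] [cx1 X_E] [N1 le_N0 le_m nst] low]]]]]]].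
have m0 : (0 < n - m)%N -> (0 < m)%N.
  by rewrite subn_gt0 => /mx[+ _]; apply: ltn_trans.
apply: wp_seq.
apply: wp_mono (search_spec T0 s_bound sz_s sz_n A_perm A_desc m_le inc X_E cx1 N1 le_N0 m0 (conj le_m nst) low) _.
rewrite -/n => t2 s2 _ [le_t2 cx2 [N [N2 [le_mN le_N] [F_lt pm cap] min]]].
apply: wp_mono (out_spec A_perm m_le cx2 N2 le_mN pm) _.
rewrite -/n => t3 s3 [fn3 fq3] [le_t3 outP outF].
have N3 : nats s3 i_bins 0%N = N by rewrite fn3.
have [s_lt feas] := sound T0 s_bound sz_s sz_n A_perm m_le le_mN (geq_minr _ _) F_lt pm cap outP outF.
split=> //; [|by rewrite N3|by rewrite N3].
have le_k : (n - m <= k)%N.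
  by rewrite leq_sub2l // (num_large_le sz_s A_perm A_desc m_le) // => /mx.
set Q := (k`! ^ 2 * k.+1 * 2 ^ k * n.+1)%N.
have le_s : (t2 <= 8 * Q)%N.
  apply: (leq_trans le_t2); apply: leq_trans (search_time _ _) _.
  by rewrite leq_mul2l; apply: time_bound_le.
have nQ : (n <= Q)%N.
  by apply: (leq_trans (leqnSn n)); rewrite leq_pmull // !muln_gt0 !expn_gt0 fact_gt0.
have e1 : (Q <= Q * l.+1)%N by rewrite leq_pmulr.
have e2 : (n * l.+1 <= Q * l.+1)%N by rewrite leq_mul2r nQ orbT.
(* The preparation contributes 18, the search 8, and the output at most [N + (n - m) <= 2 n], which
   gives 28. *)
move: le_t1 le_s le_t3 le_N nQ e1 e2; rewrite -/l; clear; lia.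
Qed.

Theorem theorem4 :
  exists (P : program) (C : nat),
    forall (s : seq rat) (T : rat),
      0 <= T -> (forall j, (j < size s)%N -> 0 <= s`_j <= T) ->
      let n := size s in
      let k := num_small s T in
      exists t : nat,
        [/\ (t <= C * ((k`! ^ 2) * k.+1 * 2 ^ k * n.+1 * (trunc_log 2 n).+1))%N,
            halted P (run P t (init_state s T)) &
            solves s T (regs (run P t (init_state s T)))].
Proof.
have [P [K hP]] := @cmd_program c_main i_bins a_OUT ltac:(by vm_compute) ltac:(by vm_compute) isT isT.
(* To the 28 of the packing program, [3 n + 1 <= 4 B] is added for moving the input and the
   output. *)
exists P, (32 * K)%N => s T T0 s_bound n k; have [h0 h1] := hP s T.
set B := (k`! ^ 2 * k.+1 * 2 ^ k * n.+1 * (trunc_log 2 n).+1)%N.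
have nB : (n < B)%N.
  rewrite /B -mulnA; apply: leq_trans (leq_pmull _ _); first exact: leq_pmulr.
  by rewrite !muln_gt0 !expn_gt0 fact_gt0.
case: (posnP (size s)) => [s0|s_gt0].
  have [t [le_t hl r0]] := h0 s0; exists t; split=> //.
    by move: le_t nB; clear; nia.
  exists 0%N, (fun _ => 0%N); split=> //; first by rewrite s0.
  move=> c; rewrite big1 // => -[j hj]; exfalso; by rewrite s0 in hj.
have [t [s' [E [le_t b_lt feas min]]]] := main_spec T0 s_bound s_gt0.
have [u [le_u hl rb ro]] := h1 s_gt0 _ _ E.
exists u; split=> //.
  apply: (leq_trans le_u); rewrite [(32 * K)%N]mulnC -mulnA leq_mul2l; apply/orP; right.
  by move: le_t nB; rewrite -/n -/k -/B; clear; lia.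
exists (nats s' i_bins 0%N), (nats s' a_OUT); split=> // j hj; split; [exact: b_lt | exact: ro].
Qed.
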